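(* Let $l\ge 1$ be a fixed integer. The iteration $$\mathbf{u}^+_{n+1}=\mathbf{u}^+_n-\mathbf{P}_2\mathbf{P}_1\big((\mathbf{E}-\mathbf{K}^+)\mathbf{u}^+_n-\mathbf{q}\big)$$ with preconditioner $\mathbf{P}_1=\mathbf{P}_1^l$ defines, for any initial $\mathbf{u}_0^+$, a sequence converging to the solution $\mathbf{u}^+$ of $\mathbf{E}\mathbf{u}^+=\mathbf{K}^+\mathbf{u}^++\mathbf{q}$; namely, for all $n\ge 0$, $$\|\mathbf{u}^+-\mathbf{u}^+_{n+1}\|_{\mathbf{E}-\mathbf{K}^+}\le\eta\,\|\mathbf{u}^+-\mathbf{u}^+_n\|_{\mathbf{E}-\mathbf{K}^+},$$ where $$\eta=\sup\big\{\|(\mathbf{I}^+-\mathbf{P}_G)(\mathbf{I}^+-\mathbf{P}_1^l(\mathbf{E}-\mathbf{K}^+))\mathbf{v}^+\|_{\mathbf{E}-\mathbf{K}^+}:\ \mathbf{v}^+\in\mathbb{R}^{n_S^+n_R^+},\ \|\mathbf{v}^+\|_{\mathbf{E}-\mathbf{K}^+}=1\big\}$$ satisfies $\eta\le c$, with $c=\|\sigma_s/\sigma_t\|_\infty<1$.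
   Context: Continuous setting. Let $R\subset\mathbb{R}^d$ ($d\le 3$) be a bounded convex domain with outer unit normal $n(r)$, $S\subset\mathbb{R}^3$ the unit sphere, $D=S\times R$; $s\cdot\nabla_r=\sum_{i=1}^ds_i\partial_{r_i}$, $s\cdot n=\sum_{i=1}^ds_in_i$. Let $0\le g<1$; $\sigma_a,\sigma_s\in L^\infty(R)$ non-negative with $\sigma_a\ge\gamma>0$ a.e. for some constant $\gamma$; $\sigma_t=\sigma_a+\sigma_s$; $c=\|\sigma_s/\sigma_t\|_\infty<1$. Let $(\mathcal{S}u)(s)=\int_Sk(s\cdot s')u(s')\,ds'$ with $k(s\cdot s')=\frac{1}{4\pi}\frac{1-g^2}{[1-2g(s\cdot s')+g^2]^{3/2}}$, acting in $s$ only (the spherical harmonics of degree $m$ are eigenfunctions with eigenvalue $g^m$; they are even for even $m$ and odd for odd $m$). Discretization. Let $\mathcal{T}_h^R$, $\mathcal{T}_h^S$ be shape regular, quasi-uniform triangulations of $R$ and $S$, with $-K_S\in\mathcal{T}_h^S$ for each $K_S\in\mathcal{T}_h^S$. Let $\{\varphi_i\}_{i=1}^{n_R^+}$ be a basis of the continuous piecewise linear functions and $\{\chi_j\}_{j=1}^{n_R^-}$ the basis of element indicator functions of the piecewise constant functions on $\mathcal{T}_h^R$. Let $\{\mu_k^+\}_{k=1}^{n_S^+}$ be the basis of the even, piecewise constant functions on $\mathcal{T}_h^S$ given by the indicator functions of the antipodal pairs $K_S\cup(-K_S)$, and $\{\psi_m^-\}_{m=1}^{n_S^-}$ a basis of the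 odd, piecewise linear (in general discontinuous) functions on $\mathcal{T}_h^S$. With respect to the tensor product bases $\{\varphi_i\mu_k^+\}$ (even, spanning $\mathbb{W}_h^+$) and $\{\chi_j\psi_m^-\}$ (odd), let $\mathbf{M}^+,\mathbf{M}^-$ be the Gram matrices of $(u,w)\mapsto\int_D\sigma_tuw$, $\mathbf{K}^+,\mathbf{K}^-$ the matrices of $(u,w)\mapsto\int_D\sigma_s(\mathcal{S}u)w$, $\mathbf{R}$ the matrix (on the even basis) of $(u,w)\mapsto\int_{S\times\partial R}|s\cdot n|uw$, and $\mathbf{A}$ the $n_S^-n_R^-\times n_S^+n_R^+$ matrix with entries $\int_D(s\cdot\nabla_r(\varphi_i\mu_k^+))\,\chi_j\psi_m^-$. Set $$\mathbf{E}=\mathbf{A}^\intercal(\mathbf{M}^--\mathbf{K}^-)^{-1}\mathbf{A}+\mathbf{M}^++\mathbf{R},\qquad \mathbf{E}_0=\tfrac{1}{1-cg}\mathbf{A}^\intercal(\mathbf{M}^-)^{-1}\mathbf{A}+\mathbf{M}^++\mathbf{R}.$$ $\mathbf{E}-\mathbf{K}^+$ is symmetric positive definite, $\|\mathbf{v}\|_{\mathbf{E}-\mathbf{K}^+}^2=\mathbf{v}^\intercal(\mathbf{E}-\mathbf{K}^+)\mathbf{v}$, $\mathbf{I}^+$ is the identity matrix on $\mathbb{R}^{n_S^+n_R^+}$, and $\mathbf{q}\in\mathbb{R}^{n_S^+n_R^+}$ is a given right-hand side. Preconditioners. For $l\ge1$, $\mathbf{P}_1^l$ is the matrix defined by $\mathbf{P}_1^l\mathbf{b}=\mathbf{z}_l$,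 where $\mathbf{z}_0=0$ and $\mathbf{z}_{k+1}=\mathbf{z}_k-\mathbf{E}_0^{-1}(\mathbf{E}\mathbf{z}_k-\mathbf{b})$ for $0\le k<l$. Let $\mathbf{W}$ be the matrix whose columns are the coordinate vectors of a basis of a given subspace $\mathbb{W}_{h,N}^+\subset\mathbb{W}_h^+$. Then $$\mathbf{P}_G=\mathbf{W}\big(\mathbf{W}^\intercal(\mathbf{E}-\mathbf{K}^+)\mathbf{W}\big)^{-1}\mathbf{W}^\intercal(\mathbf{E}-\mathbf{K}^+),$$ and the product $\mathbf{P}_2\mathbf{P}_1$ is defined by $$\mathbf{P}_2\mathbf{P}_1=\mathbf{P}_1+\mathbf{W}\big(\mathbf{W}^\intercal(\mathbf{E}-\mathbf{K}^+)\mathbf{W}\big)^{-1}\mathbf{W}^\intercal\big(\mathbf{I}^+-(\mathbf{E}-\mathbf{K}^+)\mathbf{P}_1\big).$$ *)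

(* Defs.v *)
From HB Require Import structures.
From mathcomp Require Import all_boot all_order all_algebra.
From mathcomp Require Import all_classical all_reals all_analysis.
From mathcomp Require Import measurable_realfun.

Set Implicit Arguments.
Unset Strict Implicit.
Unset Printing Implicit Defensive.

Import Order.TTheory GRing.Theory Num.Theory.
Import numFieldNormedType.Exports.

Local Open Scope classical_set_scope.
Local Open Scope ring_scope.

Section measurable_rV.
Context {R : realType}.
Variable n : nat.

Let coord (i : 'I_n) (x : 'rV[R]_n) : R := x ord0 i.

Let rV_set0 : g_sigma_preimage coord set0.
Proof. exact: sigma_algebra0. Qed.

Let rV_setC A : g_sigma_preimage coord A -> g_sigma_preimage coord (~` A).
Proof. exact: sigma_algebraC. Qed.

Let rV_bigcup (F : _^nat) : (forall i, g_sigma_preimage coord (F i)) ->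
  g_sigma_preimage coord (\bigcup_i (F i)).
Proof. exact: sigma_algebra_bigcup. Qed.

(* The sigma-algebra generated by the coordinates, that is, the Borel one. *)
HB.instance Definition _ := @isMeasurable.Build default_measure_display
  'rV[R]_n (g_sigma_preimage coord) rV_set0 rV_setC rV_bigcup.

Lemma measurable_coord (i : 'I_n) :
  measurable_fun [set: 'rV[R]_n] (fun x : 'rV[R]_n => x ord0 i : R).
Proof.
move=> _ Y mY; rewrite setTI; apply: sub_sigma_algebra => /=.
rewrite -bigcup_seq/=; exists i => /=; first by rewrite mem_index_enum.
by exists Y => //; rewrite setTI.
Qed.

Lemma measurable_fun_rV d (T : measurableType d) (f : T -> 'rV[R]_n) :
  (forall i, measurable_fun [set: T] (fun x => f x ord0 i : R)) ->
  measurable_fun [set: T] f.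
Proof.
move=> mf.
suff H : g_sigma_preimage (fun i => coord i \o f) `<=` measurable.
  move=> _ A mA; rewrite setTI; apply: H.
  by rewrite g_sigma_preimage_comp; exists A => //; rewrite setTI.
apply: smallest_sub; first exact: sigma_algebra_measurable.
rewrite -bigcup_seq => A /= [i _] [B mB <-].
exact: mf.
Qed.

End measurable_rV.

Section measure_preimage.
Local Open Scope ereal_scope.
Context d d' (T1 : measurableType d) (T2 : measurableType d') (R : realType).
Variables (m : {measure set T1 -> \bar R}) (f : T1 -> T2).
Hypothesis mf : measurable_fun [set: T1] f.

Lemma pushforward_set0 : pushforward m f set0 = 0.
Proof. by rewrite /pushforward preimage_set0 measure0. Qed.

Lemma pushforward_ge0 A : 0 <= pushforward m f A.
Proof. by rewrite /pushforward. Qed.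

Lemma pushforward_sigma_additive : semi_sigma_additive (pushforward m f).
Proof.
move=> F mF tF mUF; rewrite /pushforward preimage_bigcup.
apply: measure_semi_sigma_additive.
- by move=> n; rewrite -[X in measurable X]setTI; exact: mf.
- apply/trivIsetP => /= i j _ _ ij; rewrite -preimage_setI.
  by move/trivIsetP : tF => /(_ _ _ _ _ ij) ->//; rewrite preimage_set0.
- by rewrite -preimage_bigcup -[X in measurable X]setTI; exact: mf.
Qed.

End measure_preimage.

Section lebesgue_rV.
Context {R : realType}.
Local Open Scope ereal_scope.

Definition rV_cons n (x : measurableTypeR R * 'rV[R]_n) : 'rV[R]_n.+1 :=
  \row_i (if unlift ord0 i is Some j then x.2 ord0 j else x.1).

Definition rV_uncons n (x : 'rV[R]_n.+1) : measurableTypeR R * 'rV[R]_n :=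
  (x ord0 ord0, \row_j x ord0 (lift ord0 j)).

Lemma rV_consK n : cancel (@rV_cons n) (@rV_uncons n).
Proof.
case=> t x; rewrite /rV_cons /rV_uncons; congr pair.
  by rewrite mxE unlift_none.
by apply/rowP => j; rewrite !mxE liftK.
Qed.

Lemma measurable_rV_cons n : measurable_fun setT (@rV_cons n).
Proof.
apply: measurable_fun_rV => i; rewrite /rV_cons.
case: (unliftP ord0 i) => [j ->|->].
  rewrite (_ : (fun _ => _) = (fun y : 'rV[R]_n => y ord0 j : R) \o snd).
    exact: measurableT_comp (measurable_coord j) measurable_snd.
  by apply/funext => x /=; rewrite mxE liftK.
rewrite (_ : (fun _ => _) = fst); first exact: measurable_fst.
by apply/funext => x /=; rewrite mxE unlift_none.
Qed.

Lemma measurable_rV_uncons n : measurable_fun setT (@rV_uncons n).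
Proof.
apply: measurable_fun_pair; first exact: measurable_coord.
apply: measurable_fun_rV => i.
rewrite (_ : (fun _ => _) = fun x : 'rV[R]_n.+1 => x ord0 (lift ord0 i)).
  exact: measurable_coord.
by apply/funext => x /=; rewrite mxE.
Qed.

Definition lebesgue_rV_succ n (m : {sigma_finite_measure set 'rV[R]_n -> \bar R})
    : set 'rV[R]_n.+1 -> \bar R :=
  pushforward (@lebesgue_measure R \x m) (@rV_cons n).

Section lebesgue_rV_succ_measure.
Variables (n : nat) (m : {sigma_finite_measure set 'rV[R]_n -> \bar R}).

Let lebesgue_rV_succ0 : lebesgue_rV_succ m set0 = 0.
Proof. exact: pushforward_set0. Qed.

Let lebesgue_rV_succ_ge0 A : 0 <= lebesgue_rV_succ m A.
Proof. by apply: pushforward_ge0. Qed.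

Let lebesgue_rV_succ_sigma_additive : semi_sigma_additive (lebesgue_rV_succ m).
Proof. by apply: pushforward_sigma_additive; exact: measurable_rV_cons. Qed.

HB.instance Definition _ := isMeasure.Build _ _ _ (lebesgue_rV_succ m)
  lebesgue_rV_succ0 lebesgue_rV_succ_ge0 lebesgue_rV_succ_sigma_additive.

Let lebesgue_rV_succ_sigma_finite : sigma_finite setT (lebesgue_rV_succ m).
Proof.
have /sigma_finiteP[F [TF ndF mF]] := sigma_finiteT (@lebesgue_measure R).
have /sigma_finiteP[G [TG ndG mG]] := sigma_finiteT m.
exists (fun k => @rV_uncons n @^-1` (F k `*` G k)).
  rewrite -preimage_bigcup (_ : \bigcup_k _ = setT) ?preimage_setT//.
  rewrite -subTset => -[t x] _.
  have [i _ Fit] : (\bigcup_i F i) t by rewrite -TF.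
  have [j _ Gjx] : (\bigcup_i G i) x by rewrite -TG.
  exists (maxn i j) => //; split => /=.
    by move: t Fit; exact/subsetPset/ndF/leq_maxl.
  by move: x Gjx; exact/subsetPset/ndG/leq_maxr.
move=> k; have [mFk Fk] := mF k; have [mGk Gk] := mG k; split.
  rewrite -[X in measurable X]setTI; apply: measurable_rV_uncons => //.
  exact: measurableX.
rewrite /lebesgue_rV_succ /pushforward -comp_preimage.
rewrite (_ : _ \o _ = id); last by apply/funext => x; exact: rV_consK.
by rewrite preimage_id product_measure1E// lte_mul_pinfty// ge0_fin_numE.
Qed.

HB.instance Definition _ := Measure_isSigmaFinite.Build _ _ _
  (lebesgue_rV_succ m) lebesgue_rV_succ_sigma_finite.

End lebesgue_rV_succ_measure.

Fixpoint lebesgue_rV n : {sigma_finite_measure set 'rV[R]_n -> \bar R} :=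
  if n is k.+1 then lebesgue_rV_succ (lebesgue_rV k)
  else \d_(0 : 'rV[R]_0)%R.

End lebesgue_rV.

Section euclidean.
Context {R : realType}.

Definition dot n (x y : 'rV[R]_n) : R := \sum_i x ord0 i * y ord0 i.

(* The norm `|x| of the library is the sup norm. *)
Definition enorm n (x : 'rV[R]_n) : R := Num.sqrt (dot x x).

Definition diam n (K : set 'rV[R]_n) : R :=
  sup [set enorm (x - y) | x in K & y in K].

Definition sphere : set 'rV[R]_3 := [set s | enorm s = 1].

End euclidean.

Section sphere_measure.
Context {R : realType}.
Local Open Scope ereal_scope.

Local Notation R2 := (measurableTypeR R * measurableTypeR R)%type.

(* Spherical coordinates with z = cos theta in place of the polar angle theta:
   the surface element sin(theta) dtheta dphi becomes dz dphi. *)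
Definition sphere_param (x : R2) : 'rV[R]_3 :=
  (\row_i [:: Num.sqrt (1 - x.1 ^+ 2) * cos x.2;
              Num.sqrt (1 - x.1 ^+ 2) * sin x.2; x.1]`_i)%R.

Definition sphere_param_domain : set R2 :=
  `[(-1)%R, 1%R] `*` `[0%R, (2 * pi)%R].

Lemma measurable_sphere_param_domain : measurable sphere_param_domain.
Proof. by apply: measurableX; exact: measurable_itv. Qed.

Lemma measurable_sphere_param : measurable_fun setT sphere_param.
Proof.
have m1 : measurable_fun [set: R2] (fun x : R2 => x.1 : R).
  exact: measurable_fst.
have m2 : measurable_fun [set: R2] (fun x : R2 => x.2 : R).
  exact: measurable_snd.
have mc (g : R -> R) (f : R2 -> R) : continuous g ->
    measurable_fun setT f -> measurable_fun setT (fun x => g (f x)).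
  by move=> /continuous_measurable_fun mg mf; exact: measurableT_comp mg mf.
have mq : measurable_fun [set: R2]
    (fun x : R2 => Num.sqrt (1 - (x.1 : R) ^+ 2)%R).
  apply: mc; first exact: sqrt_continuous.
  by apply: measurable_funB => //; exact: measurable_funX.
apply: measurable_fun_rV => i; rewrite /sphere_param.
under eq_fun do rewrite mxE.
case: i => [[|[|[|//]]]] /= _.
- by apply: measurable_funM mq _; apply: mc m2; exact: continuous_cos.
- by apply: measurable_funM mq _; apply: mc m2; exact: continuous_sin.
- exact: m1.
Qed.

Definition sphere_measure : set 'rV[R]_3 -> \bar R :=
  pushforward (mrestr (@lebesgue_measure R \x @lebesgue_measure R)
                      measurable_sphere_param_domain) sphere_param.

Let sphere_measure0 : sphere_measure set0 = 0.
Proof. exact: pushforward_set0. Qed.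

Let sphere_measure_ge0 A : 0 <= sphere_measure A.
Proof. by apply: pushforward_ge0. Qed.

Let sphere_measure_sigma_additive : semi_sigma_additive sphere_measure.
Proof.
by apply: pushforward_sigma_additive; exact: measurable_sphere_param.
Qed.

HB.instance Definition _ := isMeasure.Build _ _ _ sphere_measure
  sphere_measure0 sphere_measure_ge0 sphere_measure_sigma_additive.

End sphere_measure.
Arguments sphere_measure {R}.

Section meshes.
Context {R : realType}.

(* A mesh is given by its vertices p : 'I_nv -> 'rV_d and, for each element,
   the set of (the indices of) the vertices of the element. *)

Definition simplex d nv (p : 'I_nv -> 'rV[R]_d) (A : {set 'I_nv}) :
    set 'rV[R]_d :=
  [set x | exists w : 'I_nv -> R, [/\ forall v, 0 <= w v,
     \sum_(v in A) w v = 1 & x = \sum_(v in A) w v *: p v]].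

Definition affinely_independent d nv (p : 'I_nv -> 'rV[R]_d)
    (A : {set 'I_nv}) :=
  forall w : 'I_nv -> R, \sum_(v in A) w v = 0 ->
    \sum_(v in A) w v *: p v = 0 -> forall v, v \in A -> w v = 0.

Definition triangulation d nv ne (p : 'I_nv -> 'rV[R]_d)
    (T : 'I_ne -> {set 'I_nv}) (Om : set 'rV[R]_d) :=
  [/\ injective T,
      forall j, #|T j| = d.+1,
      forall j, affinely_independent p (T j),
      forall i j, simplex p (T i) `&` simplex p (T j) =
                  simplex p (T i :&: T j)
    & \bigcup_j simplex p (T j) = closure Om].

(* The radial projection onto the sphere of the simplex with the given
   vertices (of unit length). *)
Definition spherical_triangle nv (q : 'I_nv -> 'rV[R]_3) (A : {set 'I_nv}) :
    set 'rV[R]_3 :=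
  [set s | sphere s /\ exists w : 'I_nv -> R,
     (forall v, 0 <= w v) /\ s = \sum_(v in A) w v *: q v].

Definition spherical_triangle_interior nv (q : 'I_nv -> 'rV[R]_3)
    (A : {set 'I_nv}) : set 'rV[R]_3 :=
  [set s | sphere s /\ exists w : 'I_nv -> R,
     (forall v, 0 < w v) /\ s = \sum_(v in A) w v *: q v].

Definition linearly_independent d nv (p : 'I_nv -> 'rV[R]_d)
    (A : {set 'I_nv}) :=
  forall w : 'I_nv -> R, \sum_(v in A) w v *: p v = 0 ->
    forall v, v \in A -> w v = 0.

Definition spherical_triangulation nv ne (q : 'I_nv -> 'rV[R]_3)
    (T : 'I_ne -> {set 'I_nv}) :=
  [/\ injective T,
      forall v, sphere (q v),
      forall j, #|T j| = 3%N /\ linearly_independent q (T j),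
      forall i j, spherical_triangle q (T i) `&` spherical_triangle q (T j) =
                  spherical_triangle q (T i :&: T j)
    & \bigcup_j spherical_triangle q (T j) = sphere].

Definition antipode (K : set 'rV[R]_3) : set 'rV[R]_3 := [set - s | s in K].

Definition antipodally_symmetric nv ne (q : 'I_nv -> 'rV[R]_3)
    (T : 'I_ne -> {set 'I_nv}) :=
  forall j, exists j',
    spherical_triangle q (T j') = antipode (spherical_triangle q (T j)).

(* rep selects one element in each antipodal pair {K, - K}. *)
Definition antipodal_representatives nv ne n (q : 'I_nv -> 'rV[R]_3)
    (T : 'I_ne -> {set 'I_nv}) (rep : 'I_n -> 'I_ne) :=
  forall j, exists! k,
    spherical_triangle q (T j) = spherical_triangle q (T (rep k)) \/
    spherical_triangle q (T j) = antipode (spherical_triangle q (T (rep k))).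

(* kappa bounds the ratio of the diameter of an element to the radius of some
   ball, relative to the meshed set X, contained in the element. *)
Definition shape_regular d ne (kappa : R) (X : set 'rV[R]_d)
    (K : 'I_ne -> set 'rV[R]_d) :=
  forall j, exists x rho, [/\ K j x, 0 < rho,
    forall y, X y -> enorm (y - x) < rho -> K j y & diam (K j) <= kappa * rho].

Definition quasi_uniform d ne (kappa : R) (K : 'I_ne -> set 'rV[R]_d) :=
  forall i j, diam (K i) <= kappa * diam (K j).

End meshes.

Section finite_element_spaces.
Context {R : realType}.

(* f is a basis of the space V of functions on A; values outside A are
   irrelevant. *)
Definition is_basis_on (X : Type) (A : set X) (V : set (X -> R)) n
    (f : 'I_n -> X -> R) :=
  [/\ forall i, V (f i),
      forall a : 'I_n -> R, (forall x, A x -> \sum_i a i * f i x = 0) ->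
        forall i, a i = 0
    & forall h, V h -> exists a : 'I_n -> R,
        forall x, A x -> h x = \sum_i a i * f i x].

Definition affine_on d (A : set 'rV[R]_d) (f : 'rV[R]_d -> R) :=
  exists a b, forall x, A x -> f x = dot a x + b.

Definition continuous_P1 d nv ne (p : 'I_nv -> 'rV[R]_d)
    (T : 'I_ne -> {set 'I_nv}) (Om : set 'rV[R]_d) : set ('rV[R]_d -> R) :=
  [set f | {within closure Om, continuous f} /\
           forall j, affine_on (simplex p (T j)) f].

(* Discontinuous functions are only determined almost everywhere; the
   representative chosen here vanishes on the edges, and off the sphere. *)
Definition odd_P1 nv ne (q : 'I_nv -> 'rV[R]_3)
    (T : 'I_ne -> {set 'I_nv}) : set ('rV[R]_3 -> R) :=
  [set f | [/\ forall s, f (- s) = - f s,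
     forall j, affine_on (spherical_triangle_interior q (T j)) f
   & forall s, (forall j, ~ spherical_triangle_interior q (T j) s) ->
       f s = 0]].

Definition element_indicator d nv ne (p : 'I_nv -> 'rV[R]_d)
    (T : 'I_ne -> {set 'I_nv}) (j : 'I_ne) : 'rV[R]_d -> R :=
  \1_(simplex p (T j)).

Definition pair_indicator nv ne n (q : 'I_nv -> 'rV[R]_3)
    (T : 'I_ne -> {set 'I_nv}) (rep : 'I_n -> 'I_ne) (k : 'I_n) :
    'rV[R]_3 -> R :=
  \1_(spherical_triangle q (T (rep k)) `|`
      antipode (spherical_triangle q (T (rep k)))).

(* The pairs of indices are enumerated by 'I_(m * n); the bijection used is the
   inverse of mxvec_index. *)
Definition tensor_basis d m n (f : 'I_m -> 'rV[R]_3 -> R)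
    (h : 'I_n -> 'rV[R]_d -> R) (k : 'I_(m * n)) :
    'rV[R]_3 * 'rV[R]_d -> R :=
  let ij := enum_val (cast_ord (esym (mxvec_cast m n)) k) in
  fun x => f ij.1 x.1 * h ij.2 x.2.

End finite_element_spaces.

Section radiative_transfer.
Context {R : realType}.

Definition Linf_norm d (Om : set 'rV[R]_d) (f : 'rV[R]_d -> R) : \bar R :=
  'N[lebesgue_rV d]_+oo [EFin \o (f \_ Om)].

Definition Linf d (Om : set 'rV[R]_d) (f : 'rV[R]_d -> R) :=
  measurable_fun Om f /\ (Linf_norm Om f < +oo)%E.

Definition HG_kernel (g t : R) : R :=
  (4 * pi)^-1 * ((1 - g ^+ 2) / (1 - 2 * g * t + g ^+ 2) `^ (3 / 2)).

Definition scattering d (g : R) (u : 'rV[R]_3 * 'rV[R]_d -> R)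
    (x : 'rV[R]_3 * 'rV[R]_d) : R :=
  \int[sphere_measure]_(s' in sphere)
    (HG_kernel g (dot x.1 s') * u (s', x.2)).

Section domain.
Variables (d : nat) (hd : (d.+1 <= 3)%N) (Om : set 'rV[R]_d.+1).
Implicit Types u w : 'rV[R]_3 * 'rV[R]_d.+1 -> R.

(* The component s_i of s, for i = 1, ..., d. *)
Definition direction (s : 'rV[R]_3) : 'rV[R]_d.+1 :=
  \row_i s ord0 (widen_ord hd i).

Definition transport u (x : 'rV[R]_3 * 'rV[R]_d.+1) : R :=
  \sum_(i < d.+1) direction x.1 ord0 i *
    'D_(delta_mx ord0 i : 'rV[R]_d.+1) (fun r => u (x.1, r)) x.2.

Definition phase_integral (f : 'rV[R]_3 * 'rV[R]_d.+1 -> R) : R :=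
  \int[(sphere_measure \x lebesgue_rV d.+1)%E]_(x in sphere `*` Om) f x.

Definition mass_form (sigma : 'rV[R]_d.+1 -> R) u w : R :=
  phase_integral (fun x => sigma x.2 * u x * w x).

Definition scattering_form (g : R) (sigma : 'rV[R]_d.+1 -> R) u w : R :=
  phase_integral (fun x => sigma x.2 * scattering g u x * w x).

Definition transport_form u w : R :=
  phase_integral (fun x => transport u x * w x).

(* At an edge or a corner of the boundary, any unit vector of the normal cone
   is admitted. *)
Definition is_outer_normal (r nu : 'rV[R]_d.+1) :=
  enorm nu = 1 /\ forall x, Om x -> dot nu (x - r) <= 0.

Section boundary.
Variables (nv ne : nat) (p : 'I_nv -> 'rV[R]_d.+1) (T : 'I_ne -> {set 'I_nv}).

Definition boundary_facets : {set {set 'I_nv}} :=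
  [set F : {set 'I_nv} | [&& #|F| == d.+1, [exists j, F \subset T j]
     & `[< simplex p F `<=` closure Om `\` Om >]]]%SET.

Definition facet_vertex (F : {set 'I_nv}) (i : nat) : 'rV[R]_d.+1 :=
  [seq p v | v <- enum F]`_i.

Definition facet_edges (F : {set 'I_nv}) : 'M[R]_(d, d.+1) :=
  \matrix_(i < d) (facet_vertex F i.+1 - facet_vertex F 0).

Definition facet_param (F : {set 'I_nv}) (t : 'rV[R]_d) : 'rV[R]_d.+1 :=
  facet_vertex F 0 + t *m facet_edges F.

Definition unit_simplex : set 'rV[R]_d :=
  [set t | (forall i, 0 <= t ord0 i) /\ \sum_i t ord0 i <= 1].

(* The surface integral over S x (boundary of Om): on each boundary facet the
   surface element is the square root of the Gram determinant of the edges. *)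
Definition boundary_integral (f : 'rV[R]_3 * 'rV[R]_d.+1 -> R) : R :=
  \sum_(F in boundary_facets)
    Num.sqrt (\det (facet_edges F *m (facet_edges F)^T)) *
    \int[(sphere_measure \x lebesgue_rV d)%E]_(x in sphere `*` unit_simplex)
      f (x.1, facet_param F x.2).

Definition boundary_form (nu : 'rV[R]_d.+1 -> 'rV[R]_d.+1) u w : R :=
  boundary_integral
    (fun x => `|dot (direction x.1) (nu x.2)| * u x * w x).

End boundary.
End domain.

Definition form_matrix (X : Type) m n (a : (X -> R) -> (X -> R) -> R)
    (trial : 'I_n -> X -> R) (test : 'I_m -> X -> R) : 'M[R]_(m, n) :=
  \matrix_(i, j) a (trial j) (test i).

End radiative_transfer.

Section preconditioners.
Context {R : realType}.
Variable n : nat.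
Implicit Types (B E P : 'M[R]_n) (v b : 'cV[R]_n).

Definition energy_norm B v : R :=
  Num.sqrt ((v^T *m B *m v) ord0 ord0).

Fixpoint inner_iteration (E0 : 'M[R]_n) E b (l : nat) : 'cV[R]_n :=
  if l is k.+1 then
    let z := inner_iteration E0 E b k in z - invmx E0 *m (E *m z - b)
  else 0.

(* The matrix of the linear map b |-> z_l. *)
Definition precond1 (E0 : 'M[R]_n) E (l : nat) : 'M[R]_n :=
  \matrix_(i, j) inner_iteration E0 E (delta_mx j ord0) l i ord0.

Definition galerkin_projection N B (W : 'M[R]_(n, N)) : 'M[R]_n :=
  W *m invmx (W^T *m B *m W) *m W^T *m B.

Definition precond2_1 N B (W : 'M[R]_(n, N)) P : 'M[R]_n :=
  P + W *m invmx (W^T *m B *m W) *m W^T *m (1%:M - B *m P).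

Definition outer_iteration B P (q u0 : 'cV[R]_n) (k : nat) :
    'cV[R]_n :=
  iter k (fun u => u - P *m (B *m u - q)) u0.

Definition contraction_factor N B (W : 'M[R]_(n, N)) P : R :=
  sup [set energy_norm B
             ((1%:M - galerkin_projection B W) *m (1%:M - P *m B) *m v)
      | v in [set v | energy_norm B v = 1]].

End preconditioners.

(* Main.v *)
Require Import Defs.
From HB Require Import structures.
From mathcomp Require Import all_boot all_order all_algebra.
From mathcomp Require Import all_classical all_reals all_analysis.
From mathcomp Require Import measurable_realfun ess_sup_inf.
From mathcomp Require Import ring lra zify.
Set Implicit Arguments.
Unset Strict Implicit.
Unset Printing Implicit Defensive.
Import Order.TTheory GRing.Theory Num.Theory.
Import numFieldNormedType.Exports.
Local Open Scope classical_set_scope.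
Local Open Scope ring_scope.

(** Both bounds rest on operator inequalities between Gram matrices.

    The error of the outer iteration is multiplied in each step by
    (1 - P_G)(1 - P_1 B), with B = E - K^+. Since P_G is the B-orthogonal
    projection onto the coarse space, the first factor does not increase the
    energy norm. From 0 <= K^- <= c g M^- one gets E <= E_0, so that the
    l-step inner iteration satisfies E_0^-1 <= P_1 <= E^-1 <= B^-1 for
    every l >= 1; from 0 <= K^+ <= c M^+ one gets (1 - c) E_0 <= B. Hence
    0 <= B^-1 - P_1 <= c B^-1, which is the contraction.

    The inequalities for K^+ and K^- say that the scattering operator is
    nonnegative, and bounded by 1 on even and by g on odd functions. Instead of
    spherical harmonics, expand the kernel in powers of t = s . s', with
    nonnegative coefficients. The operator T_n with kernel t^n is nonnegative;
    T_n^2 is a nonnegative combination of the T_j, j <= n, of the parity of n,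
    whence by induction on n, through Cauchy-Schwarz, T_n is bounded by its
    eigenvalue on functions of degree n mod 2. Summing up, the scattering
    operator is bounded by its eigenvalue on functions of degree 0 or 1. *)

(** * Quadratic forms and the preconditioned iteration *)

(** The angular bounds must be sharp: a loss in the constant [g] would destroy [E <= E_0], a loss in
    the constant [1] would destroy [eta <= c]. Hence sums of coefficients are never estimated. The
    operators [T_n] with [n] of one parity share the eigenfunction [(e . y)^p], [p = n mod 2], and
    the scattering operator has it too; applying an operator identity to this function and
    evaluating at [e] yields the needed identity between eigenvalues. In the induction on [n] the
    term [j = n] of [T_n^2] contains the quantity to be bounded; it is kept, and what remains is a
    quadratic inequality with root [lambda_n |f|^2]. The factor [1 / (1 - c g)] in [E_0] comes from
    inverting [(1 - c g) M^- <= M^- - K^-]; in the lower bound for [B] it is harmless, since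
    [(1 - c) / (1 - c g) <= 1]. Two measure-theoretic obstacles remain. The coefficients are bounded
    only almost everywhere, so representatives bounded everywhere take their place without changing
    a matrix. Positive definiteness of the mass matrices needs basis functions independent modulo
    null sets, which is why independence is stated through open sets on which a combination does not
    vanish. *)

Section quadratic_forms.
Context {R : realType}.

Definition bilin m n (X : 'M[R]_(m, n)) (u : 'cV[R]_m) (v : 'cV[R]_n) : R :=
  (u^T *m X *m v) ord0 ord0.

(** [psd (Y - X)] plays the role of the Loewner order [X <= Y]; symmetry is recorded apart, in
    [symm]. *)
Definition psd n (X : 'M[R]_n) := forall v, 0 <= bilin X v v.

Definition pd n (X : 'M[R]_n) := forall v, v != 0 -> 0 < bilin X v v.

Definition symm n (X : 'M[R]_n) := X^T = X.

Lemma bilinE m n (X : 'M[R]_(m, n)) u v :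
  bilin X u v = \sum_i \sum_j X i j * u i ord0 * v j ord0.
Proof.
rewrite /bilin -mulmxA mxE; apply: eq_bigr => i _.
by rewrite !mxE mulr_sumr; apply: eq_bigr => j _; rewrite mulrCA mulrA.
Qed.

Lemma bilin_mul m n p k (Y : 'M[R]_(p, m)) (X : 'M[R]_(m, n)) (Z : 'M[R]_(n, k)) u v :
  bilin X (Y^T *m u) (Z *m v) = bilin (Y *m X *m Z) u v.
Proof. by rewrite /bilin trmx_mul trmxK !mulmxA. Qed.

Lemma bilin_mulr m n k (X : 'M[R]_(m, n)) (Z : 'M[R]_(n, k)) u v :
  bilin X u (Z *m v) = bilin (X *m Z) u v.
Proof. by rewrite /bilin !mulmxA. Qed.

Lemma bilin_mull m n p (Y : 'M[R]_(m, p)) (X : 'M[R]_(m, n)) u v :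
  bilin X (Y *m u) v = bilin (Y^T *m X) u v.
Proof. by rewrite /bilin trmx_mul !mulmxA. Qed.

Lemma bilinDl m n (X Y : 'M[R]_(m, n)) u v :
  bilin (X + Y) u v = bilin X u v + bilin Y u v.
Proof. by rewrite /bilin mulmxDr mulmxDl mxE. Qed.

Lemma bilinNl m n (X : 'M[R]_(m, n)) u v : bilin (- X) u v = - bilin X u v.
Proof. by rewrite /bilin mulmxN mulNmx mxE. Qed.

Lemma bilinBl m n (X Y : 'M[R]_(m, n)) u v :
  bilin (X - Y) u v = bilin X u v - bilin Y u v.
Proof. by rewrite bilinDl bilinNl. Qed.

Lemma bilinZl m n a (X : 'M[R]_(m, n)) u v :
  bilin (a *: X) u v = a * bilin X u v.
Proof. by rewrite /bilin -scalemxAr -scalemxAl mxE. Qed.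

Lemma bilin_subl m n (X : 'M[R]_(m, n)) u u' v :
  bilin X (u - u') v = bilin X u v - bilin X u' v.
Proof. by rewrite /bilin linearB /= !mulmxBl !mxE. Qed.

Lemma bilin_subr m n (X : 'M[R]_(m, n)) u v v' :
  bilin X u (v - v') = bilin X u v - bilin X u v'.
Proof. by rewrite /bilin mulmxBr !mxE. Qed.

Lemma bilin_scalel m n (X : 'M[R]_(m, n)) a u v :
  bilin X (a *: u) v = a * bilin X u v.
Proof. by rewrite /bilin linearZ /= -!scalemxAl mxE. Qed.

Lemma bilin_scaler m n (X : 'M[R]_(m, n)) a u v :
  bilin X u (a *: v) = a * bilin X u v.
Proof. by rewrite /bilin -scalemxAr mxE. Qed.

Lemma bilin_sym n (X : 'M[R]_n) u v : symm X -> bilin X u v = bilin X v u.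
Proof.
move=> sX; rewrite [LHS](_ : _ = (u^T *m X *m v)^T ord0 ord0); last first.
  by rewrite [RHS]mxE.
by rewrite !trmx_mul trmxK sX mulmxA.
Qed.

Lemma bilin1 n (X : 'M[R]_n) u v : symm X ->
  bilin X u v = bilin 1%:M (X *m u) v.
Proof. by move=> sX; rewrite bilin_mull sX mulmx1. Qed.

Lemma pd_psd n (X : 'M[R]_n) : pd X -> psd X.
Proof.
move=> pX v; have [->|v0] := eqVneq v 0; last exact/ltW/pX.
by rewrite /bilin mulmx0 mxE.
Qed.

Lemma psd_add n (X Y : 'M[R]_n) : psd X -> psd Y -> psd (X + Y).
Proof. by move=> pX pY v; rewrite bilinDl addr_ge0. Qed.

Lemma pd_add n (X Y : 'M[R]_n) : pd X -> psd Y -> pd (X + Y).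
Proof. by move=> pX pY v v0; rewrite bilinDl ltr_wpDr ?pX. Qed.

Lemma psd_congr m n (X : 'M[R]_m) (A : 'M[R]_(m, n)) : psd X -> psd (A^T *m X *m A).
Proof. by move=> pX v; rewrite -bilin_mul trmxK. Qed.

Lemma symm_congr m n (X : 'M[R]_m) (A : 'M[R]_(m, n)) :
  symm X -> symm (A^T *m X *m A).
Proof. by rewrite /symm => sX; rewrite !trmx_mul trmxK sX mulmxA. Qed.

Lemma psd_CS n (X : 'M[R]_n) u v : symm X -> psd X ->
  bilin X u v ^+ 2 <= bilin X u u * bilin X v v.
Proof.
move=> sX pX; set b := bilin X u v; set a := bilin X u u; set c := bilin X v v.
have H t : 0 <= a - 2 * t * b + t ^+ 2 * c.
  have := pX (u - t *: v); rewrite !bilin_subl !bilin_subr !bilin_scalel.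
  by rewrite !bilin_scaler (bilin_sym v u sX) -/a -/b -/c; lra.
have a0 : 0 <= a by exact: pX.
have : 0 <= c by exact: pX.
rewrite le_eqVlt => /predU1P[c0|c0].
  rewrite -c0 mulr0; have [->|b0] := eqVneq b 0; first by rewrite expr0n.
  (* For [c = 0] the quadratic degenerates to a linear function of [t]; this [t] makes it equal to
     [-1]. *)
  have := H ((a + 1) / (2 * b)); rewrite -c0 mulr0 addr0.
  have -> : 2 * ((a + 1) / (2 * b)) * b = a + 1 by field.
  lra.
have := H (b / c).
have -> : a - 2 * (b / c) * b + (b / c) ^+ 2 * c = (a * c - b ^+ 2) / c.
  by field; rewrite gt_eqF.
by rewrite pmulr_lge0 ?invr_gt0 // subr_ge0.
Qed.

Lemma pd_unit n (X : 'M[R]_n) : pd X -> X \in unitmx.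
Proof.
move=> pX; rewrite -row_free_unit -kermx_eq0; apply/eqP/row_matrixP => i.
rewrite row0; set w := row i _.
have wX : w *m X = 0.
  by apply/sub_kermxP; exact: row_sub.
apply/eqP; rewrite -trmx_eq0; apply/negP => /negP w0.
by have := pX _ w0; rewrite /bilin trmxK wX mul0mx mxE ltxx.
Qed.

Lemma symm_inv n (X : 'M[R]_n) : symm X -> symm (invmx X).
Proof. by rewrite /symm trmx_inv => ->. Qed.

Lemma bilin_inv n (X : 'M[R]_n) v : symm X -> X \in unitmx ->
  bilin (invmx X) v v = bilin X (invmx X *m v) (invmx X *m v).
Proof.
move=> sX uX; rewrite -{2}(symm_inv sX) bilin_mul.
by rewrite mulVmx // mul1mx.
Qed.

Lemma pd_inv n (X : 'M[R]_n) : symm X -> pd X -> pd (invmx X).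
Proof.
move=> sX pX v v0; have uX := pd_unit pX; rewrite bilin_inv //; apply: pX.
apply: contra_neq v0 => v0.
by rewrite -[v]mul1mx -(mulmxV uX) -mulmxA v0 mulmx0.
Qed.

(** With [x = X^-1 v] and [y = Y^-1 v], the mixed term is [x^T X y = v^T y = y^T Y y]. Expanding the
    form of [X] at [x - y] gives [x^T X x >= 2 y^T Y y - y^T X y >= y^T Y y]. *)
Lemma psd_inv_le n (X Y : 'M[R]_n) : symm X -> symm Y -> pd X ->
  psd (Y - X) -> psd (invmx X - invmx Y).
Proof.
move=> sX sY pX pYX v.
have uX := pd_unit pX.
have uY : Y \in unitmx.
  by apply: pd_unit; rewrite -(subrK X Y) addrC; exact: pd_add.
rewrite bilinBl subr_ge0 !bilin_inv //.
set x := invmx X *m v; set y := invmx Y *m v.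
have vX : X *m x = v by rewrite mulmxA mulmxV // mul1mx.
have vY : Y *m y = v by rewrite mulmxA mulmxV // mul1mx.
have h1 : bilin X x y = bilin Y y y.
  by rewrite (bilin1 _ _ sX) (bilin1 _ _ sY) vX vY.
have := pd_psd pX (x - y); rewrite !bilin_subl !bilin_subr (bilin_sym y x sX) h1.
by have := pYX y; rewrite bilinBl; lra.
Qed.

Lemma pd_le n (X Y : 'M[R]_n) : pd X -> psd (Y - X) -> pd Y.
Proof. by move=> pX pYX; rewrite -(subrK X Y) addrC; exact: pd_add. Qed.

Lemma symmD n (X Y : 'M[R]_n) : symm X -> symm Y -> symm (X + Y).
Proof. by rewrite /symm linearD /= => -> ->. Qed.

Lemma symmB n (X Y : 'M[R]_n) : symm X -> symm Y -> symm (X - Y).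
Proof. by rewrite /symm linearB /= => -> ->. Qed.

Lemma symmZ n a (X : 'M[R]_n) : symm X -> symm (a *: X).
Proof. by rewrite /symm linearZ /= => ->. Qed.

Lemma energy_normE n (B : 'M[R]_n) v : energy_norm B v = Num.sqrt (bilin B v v).
Proof. by []. Qed.

(* [X] plays the part of [B^-1 - P], so that [X *m B = 1 - P *m B]. *)
Lemma energy_norm_contract n (B X : 'M[R]_n) c v : 0 <= c ->
  symm B -> pd B -> symm X -> psd X -> psd (c *: invmx B - X) ->
  energy_norm B (X *m B *m v) <= c * energy_norm B v.
Proof.
move=> c0 sB pB sX pX pBX; rewrite !energy_normE -mulmxA.
set w := B *m v; set y := X *m w; set z := B *m y.
have uB := pd_unit pB.
have iB t : bilin (invmx B) (B *m t) (B *m t) = bilin B t t.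
  by rewrite bilin_inv // mulmxA mulVmx // mul1mx.
have Xle t : bilin X t t <= c * bilin (invmx B) t t.
  by have := pBX t; rewrite bilinBl bilinZl subr_ge0.
have e1 : bilin B y y = bilin X w z.
  by rewrite (bilin1 w z sX) -/y /z bilin_mulr mul1mx.
(* The squared energy of [y] is the [X]-product of [w = B v] and [z = B y]. Cauchy-Schwarz in [X],
   then [X <= c B^-1], bound its square by [c^2] times the squared energies of [v] and [y]; one
   factor cancels. *)
have h := psd_CS w z sX pX; rewrite -e1 in h.
have : bilin B y y ^+ 2 <= (c * bilin B v v) * (c * bilin B y y).
  apply: le_trans h _; apply: ler_pM => //.
    by rewrite -(iB v); exact: Xle.
  by rewrite -(iB y); exact: Xle.
have : 0 <= bilin B y y by exact: pd_psd.
rewrite le_eqVlt => /predU1P[<- _|y0 hy].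
  by rewrite sqrtr0 mulr_ge0 // sqrtr_ge0.
rewrite -[X in X * _](ger0_norm c0) -(sqrtr_sqr c) -sqrtrM ?sqr_ge0 // ler_wsqrtr //.
by rewrite -(ler_pM2r y0) -expr2; move: hy; rewrite expr2; lra.
Qed.

Lemma energy_norm_ge0 n (B : 'M[R]_n) v : 0 <= energy_norm B v.
Proof. exact: sqrtr_ge0. Qed.

Lemma energy_norm0 n (B : 'M[R]_n) : energy_norm B 0 = 0.
Proof. by rewrite energy_normE /bilin mulmx0 mxE sqrtr0. Qed.

Lemma energy_norm_gt0 n (B : 'M[R]_n) v : pd B -> v != 0 -> 0 < energy_norm B v.
Proof. by move=> pB v0; rewrite energy_normE sqrtr_gt0 pB. Qed.

Lemma energy_normZ n (B : 'M[R]_n) a v :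
  energy_norm B (a *: v) = `|a| * energy_norm B v.
Proof.
rewrite !energy_normE bilin_scalel bilin_scaler mulrA -expr2.
by rewrite sqrtrM ?sqr_ge0 // sqrtr_sqr.
Qed.

(** The vector [invmx B *m delta_mx i ord0] represents the coordinate [i] in the [B]-inner product,
    so Cauchy-Schwarz applies. This turns decay of the energy into convergence of the
    coordinates. *)
Lemma norm_coord_le_energy n (B : 'M[R]_n) (v : 'cV[R]_n) i : symm B -> pd B ->
  `|v i ord0| <=
  energy_norm B (invmx B *m delta_mx i ord0) * energy_norm B v.
Proof.
move=> sB pB; rewrite -sqrtr_sqr !energy_normE -sqrtrM; last exact: pd_psd.
rewrite ler_wsqrtr // (_ : v i ord0 = bilin B (invmx B *m delta_mx i ord0) v).
  by apply: psd_CS => //; exact: pd_psd.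
rewrite bilin_mull (symm_inv sB) mulVmx ?pd_unit // /bilin mulmx1.
by rewrite trmx_delta -rowE mxE.
Qed.

Lemma gram_pd n N (B : 'M[R]_n) (W : 'M[R]_(n, N)) :
  pd B -> row_free W^T -> pd (W^T *m B *m W).
Proof.
move=> pB fW v v0; rewrite -bilin_mul trmxK; apply: pB.
apply: contra_neq v0 => Wv; apply: trmx_inj; apply: (row_free_inj fW).
by rewrite -trmx_mul Wv !trmx0 mul0mx.
Qed.

Lemma galerkin_energy_le n N (B : 'M[R]_n) (W : 'M[R]_(n, N)) v :
  symm B -> pd B -> row_free W^T ->
  energy_norm B ((1%:M - galerkin_projection B W) *m v) <= energy_norm B v.
Proof.
move=> sB pB fW; have uG := pd_unit (gram_pd pB fW).
rewrite mulmxBl mul1mx !energy_normE ler_wsqrtr //.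
set P := galerkin_projection B W; set x := P *m v.
(* Self-adjointness and idempotence in the [B]-product at once; the squared energy of [v - P v] is
   then that of [v] minus that of [P v]. *)
have BP : B *m P = P^T *m B *m P.
  have sI := symm_inv (symm_congr W sB).
  rewrite /P /galerkin_projection; set I := invmx _ in sI *.
  have IG : I *m (W^T *m B *m W) = 1%:M by exact: mulVmx.
  rewrite !trmx_mul trmxK sI sB !mulmxA.
  rewrite [RHS](_ : _ = B *m W *m (I *m (W^T *m B *m W)) *m I *m W^T *m B).
    by rewrite IG mulmx1.
  by rewrite !mulmxA.
have h : bilin B v x = bilin B x x.
  by rewrite /x [RHS]bilin_mull [RHS]bilin_mulr -BP bilin_mulr.
have : 0 <= bilin B x x by exact: pd_psd.
by rewrite !bilin_subl !bilin_subr (bilin_sym x v sB) h; lra.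
Qed.

(** The recursion of [inner_iteration] run on matrices with right-hand side [1%:M], which opens the
    preconditioner to matrix identities. *)
Fixpoint precond1_mx n (E0 E : 'M[R]_n) l : 'M[R]_n :=
  if l is k.+1 then
    let P := precond1_mx E0 E k in P - invmx E0 *m (E *m P - 1%:M)
  else 0.

Lemma precond1_mxE n (E0 E : 'M[R]_n) l b :
  precond1_mx E0 E l *m b = inner_iteration E0 E b l.
Proof.
elim: l => [|l IH] /=; first by rewrite mul0mx.
by rewrite mulmxBl -mulmxA mulmxBl -mulmxA IH mul1mx.
Qed.

Lemma precond1E n (E0 E : 'M[R]_n) l : precond1 E0 E l = precond1_mx E0 E l.
Proof.
by apply/matrixP => i j; rewrite !mxE -precond1_mxE -colE mxE.
Qed.

Section precond1_bounds.
Variables (n : nat) (E0 E : 'M[R]_n).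
Hypotheses (sE0 : symm E0) (sE : symm E) (pE : pd E) (pE0E : psd (E0 - E)).

Let G := invmx E0.
Let N := 1%:M - G *m E.
Let uE := pd_unit pE.
Let pE0 := pd_le pE pE0E.
Let uE0 := pd_unit pE0.
Let sG : symm G := symm_inv sE0.

Let trN : N^T = 1%:M - E *m G.
Proof. by rewrite /N linearB /= trmx1 trmx_mul sE sG. Qed.

Definition iter_mul (X : 'M[R]_n) l := iter l (mulmx N) X.

(** Since [N] moves across as [N^T], [N^(l+2) X = N (N^l X) N^T] is a congruence of [N^l X]. An
    induction with step two therefore needs only the cases [X] and [N X]. *)
Lemma symm_psd_iter_mul X l : symm X -> psd X -> N *m X = X *m N^T ->
  psd (N *m X) -> symm (iter_mul X l) /\ psd (iter_mul X l).
Proof.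
move=> sX pX cX pNX.
have cl k : N *m iter_mul X k = iter_mul X k *m N^T.
  by elim: k => // k IH; rewrite /iter_mul /= -/(iter_mul X k) {1}IH mulmxA.
suff : (symm (iter_mul X l) /\ psd (iter_mul X l)) /\
       (symm (iter_mul X l.+1) /\ psd (iter_mul X l.+1)) by case.
elim: l => [|l [IH1 IH2]].
  by split=> //; split=> //; rewrite /symm /= trmx_mul sX -cX.
split => //.
have -> : iter_mul X l.+2 = (N^T)^T *m iter_mul X l *m N^T.
  by rewrite trmxK -mulmxA -cl.
by case: IH1 => s p; split; [exact: symm_congr | exact: psd_congr].
Qed.

(** The error of the inner iteration is [E^-1 - P_l = N^l E^-1], and [N E^-1 = E^-1 - E_0^-1] is
    nonnegative because [E <= E_0]. *)
Lemma precond1_mx_le l : symm (precond1_mx E0 E l) /\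
  psd (invmx E - precond1_mx E0 E l).
Proof.
have D k : invmx E - precond1_mx E0 E k = iter_mul (invmx E) k.
  elim: k => [|k IH] /=; first by rewrite subr0.
  rewrite -IH mulmxBl mul1mx -mulmxA (mulmxBr E) mulmxV // -/G.
  by rewrite -[1%:M - _]opprB mulmxN opprK opprB addrA addrAC.
have [] := @symm_psd_iter_mul (invmx E) l.
- exact: symm_inv.
- exact/pd_psd/pd_inv.
- by rewrite trN mulmxBl mulmxBr mul1mx mulmx1 -mulmxA mulmxV // mulmxA mulVmx // mulmx1 mul1mx.
- rewrite mulmxBl mul1mx -mulmxA mulmxV // mulmx1; exact: psd_inv_le.
rewrite -D => s p; split => //.
by rewrite -[precond1_mx _ _ _](subKr (invmx E)); apply: symmB => //; exact: symm_inv.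
Qed.

(** [P_1 = G], and the increments [P_(k+1) - P_k = N^k G] are nonnegative: [N G = G (E_0 - E) G].
    The iteration thus increases from [G] on; [l = 0] is excluded as [P_0 = 0]. *)
Lemma precond1_mx_ge l : (0 < l)%N -> psd (precond1_mx E0 E l - G).
Proof.
case: l => // l _.
have P1 : precond1_mx E0 E 1 = G.
  by rewrite /= mulmx0 -/G (_ : 0 - 1%:M = - 1%:M) ?sub0r // mulmxN mulmx1 opprK.
have C k : precond1_mx E0 E k.+1 - precond1_mx E0 E k = iter_mul G k.
  elim: k => [|k IH]; first by rewrite P1 subr0.
  have dP m : precond1_mx E0 E m.+1 - precond1_mx E0 E m =
      G - G *m (E *m precond1_mx E0 E m).
    by rewrite /= addrAC subrr add0r mulmxBr mulmx1 opprB.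
  have -> : iter_mul G k.+1 = N *m iter_mul G k by [].
  rewrite -IH /N; move: (dP k.+1) (dP k).
  move: (precond1_mx E0 E k.+2) (precond1_mx E0 E k.+1) (precond1_mx E0 E k).
  move=> c b a -> dba.
  by rewrite mulmxBl mul1mx -mulmxA !mulmxBr {1}dba opprB addrA subrK.
have psdC k : psd (iter_mul G k).
  have [] := @symm_psd_iter_mul G k => //.
  - exact/pd_psd/pd_inv.
  - by rewrite trN mulmxBl mulmxBr mul1mx mulmx1 mulmxA.
  - move=> v; rewrite mulmxBl mul1mx bilinBl.
    have -> : bilin (G *m E *m G) v v = bilin E (G *m v) (G *m v).
      by rewrite bilin_mull bilin_mulr sG.
    have -> : bilin G v v = bilin E0 (G *m v) (G *m v) by exact: bilin_inv.
    by have := pE0E (G *m v); rewrite bilinBl.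
elim: l => [|l IH].
  by rewrite P1 subrr => v; rewrite /bilin mulmx0 mul0mx mxE.
by rewrite -(subrK (precond1_mx E0 E l.+1) (precond1_mx E0 E l.+2)) -addrA C; exact: psd_add.
Qed.

End precond1_bounds.

(** The estimate by [c] comes first: it shows that the set is bounded above, so that [sup] is a
    genuine supremum. Homogeneity then carries the bound from unit vectors to all vectors. *)
Lemma contraction_factor_spec n N (B : 'M[R]_n) (W : 'M[R]_(n, N)) P c :
  0 <= c -> symm B -> pd B -> row_free W^T -> symm P ->
  psd (invmx B - P) -> psd (P - (1 - c) *: invmx B) ->
  contraction_factor B W P <= c /\
  forall v, energy_norm B
      ((1%:M - galerkin_projection B W) *m (1%:M - P *m B) *m v) <=
    contraction_factor B W P * energy_norm B v.
Proof.
move=> c0 sB pB fW sP PleB BleP.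
have uB := pd_unit pB.
have le_c v : energy_norm B
    ((1%:M - galerkin_projection B W) *m (1%:M - P *m B) *m v) <=
    c * energy_norm B v.
  rewrite -mulmxA; apply: le_trans (galerkin_energy_le _ sB pB fW) _.
  have -> : 1%:M - P *m B = (invmx B - P) *m B by rewrite mulmxBl mulVmx.
  apply: energy_norm_contract => //.
    by apply: symmB => //; exact: symm_inv.
  move=> w; have := BleP w; rewrite !bilinBl !bilinZl; lra.
set T := _ *m _ in le_c *.
have ubc : ubound [set energy_norm B (T *m v) | v in [set v | energy_norm B v = 1]] c.
  by move=> _ [v /= v1 <-]; rewrite (le_trans (le_c v)) // v1 mulr1.
split.
  rewrite /contraction_factor -/T.
  (* In dimension zero no vector has norm 1; the supremum of the empty set is 0 by convention. *)
  have [->|/set0P ne] := eqVneq [set energy_norm B (T *m v) | v in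
    [set v | energy_norm B v = 1]] set0; first by rewrite sup0.
  exact: ge_sup.
move=> v; have [->|v0] := eqVneq v 0.
  by rewrite mulmx0 energy_norm0 mulr0.
have e0 := energy_norm_gt0 pB v0.
rewrite -ler_pdivrMr //; apply: ub_le_sup; first by exists c.
exists ((energy_norm B v)^-1 *: v) => /=.
  by rewrite energy_normZ gtr0_norm ?invr_gt0 // mulVf // gt_eqF.
by rewrite -/T -scalemxAr energy_normZ gtr0_norm ?invr_gt0 // mulrC.
Qed.

Lemma cvg_colP n (x : nat -> 'cV[R]_n) (y : 'cV[R]_n) :
  (forall i, (fun k => x k i ord0) @ \oo --> y i ord0) -> x @ \oo --> y.
Proof.
move=> h; apply/cvg_ballP => e e0.
have : \forall k \near \oo, forall i, ball (y i ord0) e (x k i ord0).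
  apply: filter_forall => i; have /cvg_ballP := h i; exact.
by apply: filterS => k hk; split => // i j; rewrite ord1; exact: hk.
Qed.

Lemma outer_iteration_converges n N (B : 'M[R]_n) (W : 'M[R]_(n, N)) P c q :
  0 <= c < 1 -> symm B -> pd B -> row_free W^T -> symm P ->
  psd (invmx B - P) -> psd (P - (1 - c) *: invmx B) ->
  (forall u0, let un := outer_iteration B (precond2_1 B W P) q u0 in
     (un @ \oo --> invmx B *m q) /\
     forall k, energy_norm B (invmx B *m q - un k.+1) <=
       contraction_factor B W P * energy_norm B (invmx B *m q - un k)) /\
  contraction_factor B W P <= c.
Proof.
move=> /andP[c0 c1] sB pB fW sP PleB BleP.
have uB := pd_unit pB.
have [etac etaP] := contraction_factor_spec c0 sB pB fW sP PleB BleP.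
split => // u0 un; set u := invmx B *m q.
have qE : q = B *m u by rewrite mulmxA mulmxV // mul1mx.
have step k : energy_norm B (u - un k.+1) <=
    contraction_factor B W P * energy_norm B (u - un k).
  (* With [Z = W (W^T B W)^-1 W^T] one has [P_G = Z B] and [P_2 P_1 B = P B + Z B (1 - P B)], so
     [1 - P_2 P_1 B] factors as [(1 - P_G) (1 - P B)]. *)
  have -> : u - un k.+1 =
      (1%:M - galerkin_projection B W) *m (1%:M - P *m B) *m (u - un k).
    have -> : un k.+1 = un k - precond2_1 B W P *m (B *m un k - q) by [].
    rewrite qE -mulmxBr -(opprB u) !mulmxN opprK opprD addrA.
    move: (u - un k) => e.
    rewrite /precond2_1 /galerkin_projection.
    set Z := W *m invmx _ *m W^T; clearbody Z; set T := 1%:M - P *m B.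
    have -> : (P + Z *m (1%:M - B *m P)) *m (B *m e) = P *m B *m e + Z *m B *m T *m e.
      rewrite mulmxDl -!mulmxA; congr (_ + _ *m _).
      by rewrite mulmxBl mul1mx /T mulmxBl mul1mx mulmxBr !mulmxA.
    rewrite (mulmxBl 1%:M) mul1mx mulmxBl opprD addrA.
    by rewrite [X in X - _ = _](_ : _ = T *m e) // /T mulmxBl mul1mx.
  exact: etaP.
split => //.
have decay k : energy_norm B (u - un k) <= geometric (energy_norm B (u - un 0%N)) c k.
  elim: k => [|k IH]; first by rewrite /= expr0 mulr1.
  apply: le_trans (step k) _; rewrite /= exprS mulrCA.
  apply: le_trans (ler_wpM2r (energy_norm_ge0 _ _) etac) _.
  by rewrite ler_wpM2l.
apply: cvg_colP => i.
have key k : `|un k i ord0 - u i ord0| <=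
    geometric (energy_norm B (invmx B *m delta_mx i ord0) *
               energy_norm B (u - un 0%N)) c k.
  have := norm_coord_le_energy (u - un k) i sB pB.
  rewrite mxE [X in `|_ + X|]mxE distrC => /le_trans; apply.
  by rewrite /= -mulrA ler_wpM2l ?energy_norm_ge0 //; exact: decay.
apply/cvgrPdist_le => e e0.
have gc : geometric (energy_norm B (invmx B *m delta_mx i ord0) *
               energy_norm B (u - un 0%N)) c @ \oo --> 0.
  by apply: cvg_geometric; rewrite ger0_norm.
have /cvgrPdist_le /(_ _ e0) := gc.
apply: filterS => k; rewrite sub0r normrN => hk.
by rewrite distrC (le_trans (key k)) // (le_trans (ler_norm _)).
Qed.

(** The purely algebraic half. The matrix [A] acts by congruence, so the order relations between the
    odd matrices pass through it; the discretization has to supply only the signs of the matrices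
    and the bounds of [Kp], [Km] by [Mp], [Mm]. *)
Theorem preconditioned_iteration m n N (Mp Rb Kp : 'M[R]_n) (Mm Km : 'M[R]_m)
    (A : 'M[R]_(m, n)) (W : 'M[R]_(n, N)) (q : 'cV[R]_n) (c g : R) (l : nat) :
  0 <= c < 1 -> 0 <= g < 1 -> symm Mp -> symm Rb -> symm Kp -> symm Mm ->
  symm Km -> pd Mp -> psd Rb -> psd Kp -> psd (c *: Mp - Kp) -> pd Mm ->
  psd Km -> psd ((c * g) *: Mm - Km) -> row_free W^T -> (0 < l)%N ->
  let E := A^T *m invmx (Mm - Km) *m A + Mp + Rb in
  let E0 := (1 - c * g)^-1 *: (A^T *m invmx Mm *m A) + Mp + Rb in
  let B := E - Kp in
  let P1 := precond1 E0 E l in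
  let eta := contraction_factor B W P1 in
  (exists u : 'cV[R]_n,
    [/\ E *m u = Kp *m u + q,
        forall u', E *m u' = Kp *m u' + q -> u' = u
      & forall u0, let un := outer_iteration B (precond2_1 B W P1) q u0 in
          (un @ \oo --> u) /\
          forall n, energy_norm B (u - un n.+1) <=
                    eta * energy_norm B (u - un n)])
  /\ eta <= c /\ c < 1.
Proof.
move=> /andP[c0 c1] /andP[g0 g1] sMp sRb sKp sMm sKm pMp pRb pKp pKpc pMm pKm pKmc.
move=> fW l0 E E0 B P1 eta.
have cg0 : 0 <= c * g by rewrite mulr_ge0.
have cgc : c * g <= c by rewrite ler_piMr // ltW.
have cg1 : 0 < 1 - c * g by lra.
have pD : pd (Mm - Km).
  apply: (@pd_le _ ((1 - c * g) *: Mm)).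
    by move=> v v0; rewrite bilinZl mulr_gt0 // pMm.
  by move=> v; have := pKmc v; rewrite !bilinBl !bilinZl; lra.
have sD : symm (Mm - Km) by exact: symmB.
have pI := pd_psd (pd_inv sD pD).
(* Inverting [(1 - c g) Mm <= Mm - Km] explains the scaling of the first term of [E0]. *)
have E0E : psd (E0 - E).
  have pS : psd ((1 - c * g)^-1 *: invmx Mm - invmx (Mm - Km)).
    rewrite -invmxZ; last first.
      by rewrite unitmxZ ?unitfE ?gt_eqF // pd_unit.
    apply: psd_inv_le => //; first exact: symmZ.
      by move=> v v0; rewrite bilinZl mulr_gt0 // pMm.
    by move=> v; have := pKmc v; rewrite !bilinBl !bilinZl; lra.
  move=> v; have := psd_congr A pS v.
  by rewrite mulmxBr mulmxBl -scalemxAr -scalemxAl !bilinBl !bilinDl !bilinZl; lra.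
have sE : symm E by apply: symmD => //; apply: symmD => //; apply/symm_congr/symm_inv.
have sE0 : symm E0.
  by apply: symmD => //; apply: symmD => //; apply/symmZ/symm_congr/symm_inv.
have pE : pd E.
  by rewrite /E (addrC _ Mp); apply: pd_add => //; apply: pd_add => //; exact: psd_congr.
have sB : symm B by exact: symmB.
have pB0 : psd (B - (1 - c) *: E0).
  have pS : psd (invmx (Mm - Km) - invmx Mm).
    by apply: psd_inv_le => // v; rewrite bilinBl bilinBl opprB subrKC.
  have pMmi := pd_psd (pd_inv sMm pMm).
  move=> v; have h1 := psd_congr A pS v; have h2 := psd_congr A pMmi v.
  have h3 := pKpc v; have h4 := pRb v.
  move: h1 h3; rewrite mulmxBr mulmxBl !(bilinBl, bilinDl, bilinZl) => h1 h3.
  set a := bilin _ v v in h1 *; set b := bilin (_ *m invmx Mm *m _) v v in h1 h2 *.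
  (* The scaled term of [E0] still fits below, since [c g <= c] gives [(1 - c) / (1 - c g) <= 1]. *)
  have : (1 - c) * ((1 - c * g)^-1 * b) <= b.
    by rewrite mulrA ler_piMl // ler_pdivrMr // mul1r; lra.
  have : 0 <= c * bilin Rb v v by rewrite mulr_ge0.
  by lra.
have pE0 : pd E0 by exact: pd_le pE E0E.
have pB : pd B.
  apply: pd_le pB0 => v v0; rewrite bilinZl mulr_gt0 ?pE0 //; lra.
have uB := pd_unit pB.
have [sP PE] := precond1_mx_le sE0 sE pE E0E l.
have EP := precond1_mx_ge sE0 sE pE E0E l0.
have [cv etac] : (forall u0, let un := outer_iteration B (precond2_1 B W P1) q u0 in
     (un @ \oo --> invmx B *m q) /\
     forall k, energy_norm B (invmx B *m q - un k.+1) <=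
       eta * energy_norm B (invmx B *m q - un k)) /\ eta <= c.
  rewrite /eta /P1 precond1E; apply: outer_iteration_converges => //.
  - by rewrite c0 c1.
  - have h : psd (invmx B - invmx E).
      by apply: psd_inv_le => // v; rewrite /B opprB subrKC; exact: pKp.
    by move=> v; have := h v; have := PE v; rewrite !bilinBl; lra.
  - have h : psd (invmx ((1 - c) *: E0) - invmx B).
      apply: psd_inv_le => //; first exact: symmZ.
      by move=> v v0; rewrite bilinZl mulr_gt0 ?pE0 //; lra.
    move=> v; have := h v; have := EP v.
    have uS : (1 - c) *: E0 \in unitmx.
      by rewrite unitmxZ ?pd_unit // unitfE; apply/eqP; lra.
    rewrite invmxZ // !bilinBl !bilinZl => h1 h2.
    have : bilin (invmx B) v v <= (1 - c)^-1 * bilin (invmx E0) v v by lra.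
    rewrite ler_pdivlMl; last by lra.
    by lra.
split; last by [].
exists (invmx B *m q); split => //.
  by apply/eqP; rewrite addrC -subr_eq -mulmxBl mulmxA mulmxV // mul1mx.
move=> u' /eqP; rewrite addrC -subr_eq -mulmxBl => /eqP <-.
by rewrite mulmxA mulVmx // mul1mx.
Qed.

End quadratic_forms.

(** * Integrals of bounded measurable functions *)

Section bounded_measurable.
Context d (T : measurableType d) (R : realType).
Implicit Types (D : set T) (f g : T -> R).

(** The integrands handled below belong to this class on sets of finite measure. Being closed under
    the algebraic operations, it settles the integrability side conditions of linearity and of
    Fubini's theorem. *)
Definition bmeas D f :=
  measurable_fun D f /\ exists M, forall x, D x -> `|f x| <= M.

Lemma bmeas_cst D r : bmeas D (fun=> r).
Proof. by split; [exact: measurable_cst | exists `|r|]. Qed.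

Lemma bmeasD D f g : bmeas D f -> bmeas D g -> bmeas D (fun x => f x + g x).
Proof.
move=> [mf [M hM]] [mg [N hN]]; split; first exact: measurable_funD.
exists (M + N) => x Dx; apply: le_trans (ler_normD _ _) _.
by rewrite lerD ?hM ?hN.
Qed.

Lemma bmeasM D f g : bmeas D f -> bmeas D g -> bmeas D (fun x => f x * g x).
Proof.
move=> [mf [M hM]] [mg [N hN]]; split; first exact: measurable_funM.
by exists (M * N) => x Dx; rewrite normrM ler_pM ?hM ?hN.
Qed.

Lemma bmeasZ D r f : bmeas D f -> bmeas D (fun x => r * f x).
Proof. by move=> bf; apply: bmeasM => //; exact: bmeas_cst. Qed.

Lemma bmeasN D f : bmeas D f -> bmeas D (fun x => - f x).
Proof.
move=> [mf [M hM]]; split; first exact: measurableT_comp.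
by exists M => x Dx; rewrite normrN hM.
Qed.

Lemma bmeasB D f g : bmeas D f -> bmeas D g -> bmeas D (fun x => f x - g x).
Proof. by move=> bf bg; apply: bmeasD => //; exact: bmeasN. Qed.

Lemma bmeasX D f n : bmeas D f -> bmeas D (fun x => f x ^+ n).
Proof.
move=> bf; elim: n => [|n IH]; first by under eq_fun do rewrite expr0; exact: bmeas_cst.
by under eq_fun do rewrite exprS; exact: bmeasM.
Qed.

Lemma bmeas_sum D I (r : seq I) (P : pred I) (F : I -> T -> R) :
  (forall i, P i -> bmeas D (F i)) -> bmeas D (fun x => \sum_(i <- r | P i) F i x).
Proof.
move=> bF; elim: r => [|i r IH].
  by under eq_fun do rewrite big_nil; exact: bmeas_cst.
have [Pi|Pi] := boolP (P i); under eq_fun do rewrite big_cons.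
  by rewrite Pi; apply: bmeasD => //; exact: bF.
by rewrite (negbTE Pi).
Qed.

Lemma bmeas_prod D I (r : seq I) (P : pred I) (F : I -> T -> R) :
  (forall i, P i -> bmeas D (F i)) -> bmeas D (fun x => \prod_(i <- r | P i) F i x).
Proof.
move=> bF; elim: r => [|i r IH].
  by under eq_fun do rewrite big_nil; exact: bmeas_cst.
have [Pi|Pi] := boolP (P i); under eq_fun do rewrite big_cons.
  by rewrite Pi; apply: bmeasM => //; exact: bF.
by rewrite (negbTE Pi).
Qed.

Lemma bmeas_abs D f : bmeas D f -> bmeas D (fun x => `|f x|).
Proof.
move=> [mf [M hM]]; split; first exact: measurableT_comp.
by exists M => x Dx; rewrite normr_id hM.
Qed.

Lemma bmeas_eq D f g : (forall x, D x -> f x = g x) -> bmeas D f -> bmeas D g.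
Proof.
move=> fg [mf [M hM]]; split; last by exists M => x Dx; rewrite -fg ?hM.
by apply: eq_measurable_fun mf => x; rewrite inE; exact: fg.
Qed.

Lemma bmeasS D D' f : measurable D -> D' `<=` D -> bmeas D f -> bmeas D' f.
Proof.
move=> mD DD' [mf [M hM]]; split; first exact: measurable_funS mf.
by exists M => x /DD' /hM.
Qed.

Lemma bmeas_indic D A : measurable A -> bmeas D (\1_A : T -> R).
Proof.
move=> mA; split; first exact: measurable_indic.
by exists 1 => x _; rewrite indicE ger0_norm ?ler0n // lern1 leq_b1.
Qed.

Variable m : {measure set T -> \bar R}.

Lemma bmeas_integrable D f : measurable D -> (m D < +oo)%E -> bmeas D f ->
  m.-integrable D (EFin \o f).
Proof.
move=> mD mfin [mf [M hM]]; apply: measurable_bounded_integrable => //.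
by exists M; split; [exact: num_real | move=> r Mr x /= /hM /le_trans; apply; exact: ltW].
Qed.

Section finite_domain.
Variable D : set T.
Hypotheses (mD : measurable D) (finD : (m D < +oo)%E).
Local Notation integral f := (Rintegral m D f).

Lemma bint_sum I (r : seq I) (F : I -> T -> R) : (forall i, bmeas D (F i)) ->
  \int[m]_(x in D) (\sum_(i <- r) F i x) = \sum_(i <- r) \int[m]_(x in D) F i x.
Proof.
move=> bF; elim: r => [|i r IH].
  rewrite big_nil; under eq_Rintegral do rewrite big_nil.
  by rewrite Rintegral_cst // mul0r.
rewrite big_cons; under eq_Rintegral do rewrite big_cons.
rewrite RintegralD ?IH //; apply: bmeas_integrable => //.
exact: (@bmeas_sum _ _ r xpredT).
Qed.

Lemma bintD f g : bmeas D f -> bmeas D g ->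
  \int[m]_(x in D) (f x + g x) = integral f + integral g.
Proof. by move=> bf bg; rewrite RintegralD //; exact: bmeas_integrable. Qed.

Lemma bintB f g : bmeas D f -> bmeas D g ->
  \int[m]_(x in D) (f x - g x) = integral f - integral g.
Proof. by move=> bf bg; rewrite RintegralB //; exact: bmeas_integrable. Qed.

Lemma bintZ r f : bmeas D f ->
  \int[m]_(x in D) (r * f x) = r * integral f.
Proof. by move=> bf; rewrite RintegralZl //; exact: bmeas_integrable. Qed.

Lemma le_bint f g : bmeas D f -> bmeas D g -> (forall x, D x -> f x <= g x) ->
  integral f <= integral g.
Proof. by move=> bf bg; apply: le_Rintegral => //; exact: bmeas_integrable. Qed.

Lemma bint_norm_le f M : 0 <= M -> bmeas D f -> (forall x, D x -> `|f x| <= M) ->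
  `|integral f| <= M * fine (m D).
Proof.
move=> M0 bf hM.
apply: le_trans (le_normr_Rintegral _ _) _ => //; first exact: bmeas_integrable.
rewrite -Rintegral_cst //; apply: le_bint => //; first exact: bmeas_abs.
exact: bmeas_cst.
Qed.

Lemma bint_CS f g : bmeas D f -> bmeas D g ->
  (\int[m]_(x in D) (f x * g x)) ^+ 2 <=
  (\int[m]_(x in D) (f x ^+ 2)) * \int[m]_(x in D) (g x ^+ 2).
Proof.
move=> bf bg; set b := \int[m]_(x in D) _; set a := \int[m]_(x in D) _.
set c := \int[m]_(x in D) _.
have bff := bmeasX 2 bf; have bgg := bmeasX 2 bg; have bfg := bmeasM bf bg.
have H t : 0 <= a - 2 * t * b + t ^+ 2 * c.
  rewrite -!bintZ // -bintB // ?bmeasZ //; last exact: bmeasZ.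
  rewrite -bintD; [|by apply: bmeasB => //; exact: bmeasZ|exact: bmeasZ].
  apply: Rintegral_ge0 => x _.
  rewrite (_ : _ + _ = (f x - t * g x) ^+ 2) ?sqr_ge0 //; ring.
have a0 : 0 <= a by apply: Rintegral_ge0 => x _; exact: sqr_ge0.
have : 0 <= c by apply: Rintegral_ge0 => x _; exact: sqr_ge0.
rewrite le_eqVlt => /predU1P[c0|c0].
  rewrite -c0 mulr0; have [->|b0] := eqVneq b 0; first by rewrite expr0n.
  (* As for matrices: when [c = 0] this [t] gives the value [-1]. *)
  have := H ((a + 1) / (2 * b)); rewrite -c0 mulr0 addr0.
  have -> : 2 * ((a + 1) / (2 * b)) * b = a + 1 by field.
  lra.
have := H (b / c).
have -> : a - 2 * (b / c) * b + (b / c) ^+ 2 * c = (a * c - b ^+ 2) / c.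
  by field; rewrite gt_eqF.
by rewrite pmulr_lge0 ?invr_gt0 // subr_ge0.
Qed.

End finite_domain.
End bounded_measurable.

Lemma bmeas_comp d d' (T : measurableType d) (U : measurableType d') (R : realType)
    (D : set T) (E : set U) (h : T -> U) (f : U -> R) :
  measurable D -> measurable E -> measurable_fun setT h ->
  (forall x, D x -> E (h x)) -> bmeas E f -> bmeas D (f \o h).
Proof.
move=> mD mE mh hDE [mf [M hM]]; split; last by exists M => x /hDE /hM.
apply: (@measurable_comp _ _ _ _ _ _ E) => //.
  by move=> _ [x Dx <-]; exact: hDE.
exact: measurable_funS mh.
Qed.

Section product_integral.
Context d1 d2 (T1 : measurableType d1) (T2 : measurableType d2) (R : realType).
Variables (m1 : {sigma_finite_measure set T1 -> \bar R})
          (m2 : {sigma_finite_measure set T2 -> \bar R}).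
Variables (A : set T1) (B : set T2).
Hypotheses (mA : measurable A) (mB : measurable B)
  (finA : (m1 A < +oo)%E) (finB : (m2 B < +oo)%E).

Lemma product_measure_fin : ((m1 \x m2)%E (A `*` B) < +oo)%E.
Proof. by rewrite product_measure1E // lte_mul_pinfty // ge0_fin_numE. Qed.

Lemma bmeas_fst f : bmeas A f -> bmeas (A `*` B) (fun x : T1 * T2 => f x.1 : R).
Proof.
move=> bf; apply: (bmeas_comp (h := fst) (E := A)) => //; first exact: measurableX.
by move=> x [].
Qed.

Lemma bmeas_snd f : bmeas B f -> bmeas (A `*` B) (fun x : T1 * T2 => f x.2 : R).
Proof.
move=> bf; apply: (bmeas_comp (h := snd) (E := B)) => //; first exact: measurableX.
by move=> x [].
Qed.

Lemma bint_prod f g : bmeas A f -> bmeas B g ->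
  \int[(m1 \x m2)%E]_(x in A `*` B) (f x.1 * g x.2) =
  (\int[m1]_(x in A) f x) * \int[m2]_(y in B) g y.
Proof.
move=> bf bg; have bfg := bmeasM (bmeas_fst bf) (bmeas_snd bg).
have ifg := bmeas_integrable (measurableX mA mB) product_measure_fin bfg.
have iF := bmeas_integrable mA finA bf; have iG := bmeas_integrable mB finB bg.
(* Fubini's theorem is applied on the whole product space, to the integrand extended by zero outside
   the rectangle. *)
rewrite {1}/Rintegral integral_mkcond -integral12_prod_meas1; last first.
  by apply/(integrable_mkcond _ _).1 => //; exact: measurableX.
rewrite /fubini_F.
have iF' : m1.-integrable setT (fun x => ((f \_ A) x)%:E).
  rewrite (_ : (fun x => _) = (EFin \o f) \_ A); last by rewrite restrict_EFin.
  by apply/(integrable_mkcond _ _).1.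
rewrite (eq_integral (fun x => ((f \_ A) x)%:E * (\int[m2]_(y in B) g y)%:E)%E).
  rewrite integralZr // fineM //; last exact: integrable_fin_num.
  by rewrite [in RHS]Rintegral_mkcond.
move=> x _; rewrite !patchE.
have [xA|xA] := boolP (x \in A).
  rewrite [in RHS]/Rintegral fineK; last exact: integrable_fin_num.
  rewrite -integralZl // [RHS]integral_mkcond; apply: eq_integral => y _.
  by rewrite !patchE in_setX xA /=; case: ifP.
rewrite mul0e -[RHS](integral0 m2 setT); apply: eq_integral => y _.
by rewrite patchE in_setX (negbTE xA).
Qed.

End product_integral.

Lemma bmeas_restrict d (T : measurableType d) (R : realType) (D : set T) (f : T -> R) :
  measurable D -> bmeas D f -> bmeas setT (f \_ D).
Proof.
move=> mD [mf [M hM]]; split; first exact/(measurable_restrictT _ _).1.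
by exists (Num.max M 0) => x _; rewrite patchE; case: ifPn => [|_];
  rewrite ?inE ?normr0 le_max ?lexx ?orbT // => /hM ->.
Qed.

Lemma measurable_preimage d d' (T : measurableType d) (U : measurableType d')
    (f : T -> U) B : measurable_fun setT f -> measurable B -> measurable (f @^-1` B).
Proof. by move=> mf mB; rewrite -[X in measurable X]setTI; exact: mf. Qed.

(** * Moments and the antipodal map on the sphere *)

Section sphere_integral.
Context {R : realType}.
Local Notation R2 := (measurableTypeR R * measurableTypeR R)%type.
Local Notation mu2 := ((@lebesgue_measure R \x @lebesgue_measure R)%E).
Local Notation dom := (@sphere_param_domain R).

Lemma dotE3 (x y : 'rV[R]_3) :
  dot x y = x ord0 0 * y ord0 0 + x ord0 1 * y ord0 1 + x ord0 2%:R * y ord0 2%:R.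
Proof.
rewrite /dot !big_ord_recl big_ord0 addr0 addrA.
by congr (_ * _ + _ * _ + _ * _); congr (_ ord0 _); apply: val_inj.
Qed.

Lemma sphereP (x : 'rV[R]_3) : sphere x <-> dot x x = 1.
Proof.
rewrite /sphere /= /enorm; split => [|->]; last exact: sqrtr1.
move=> /(congr1 (fun t => t ^+ 2)); rewrite expr1n sqr_sqrtr //.
by apply: sumr_ge0 => i _; exact: sqr_ge0.
Qed.

Lemma measurable_dot n (y : 'rV[R]_n) : measurable_fun setT (fun x : 'rV[R]_n => dot y x).
Proof.
apply: measurable_sum => i; apply: measurable_funM => //.
exact: measurable_coord.
Qed.

Lemma measurable_sphere : measurable (@sphere R).
Proof.
rewrite (_ : sphere = (fun x : 'rV[R]_3 => dot x x) @^-1` [set 1]); last first.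
  by apply/seteqP; split => x /sphereP.
apply: measurable_preimage (measurable_set1 1).
by apply: measurable_sum => i; apply: measurable_funM; exact: measurable_coord.
Qed.

Lemma sphere_param_in x : dom x -> sphere (sphere_param x).
Proof.
case: x => z t [/=]; rewrite in_itv /= => /andP[z1 z2] _.
apply/sphereP; rewrite dotE3 !mxE /= -!expr2 !exprMn -mulrDr cos2Dsin2 mulr1.
rewrite sqr_sqrtr ?subrK // subr_ge0 -ler_sqrt ?ltr01 // sqrtr_sqr sqrtr1.
by rewrite ler_norml z1 z2.
Qed.

Lemma sphere_domain_fin : (mu2 dom < +oo)%E.
Proof.
rewrite product_measure1E; [|exact: measurable_itv|exact: measurable_itv].
by rewrite /= !lebesgue_measure_itv /=; case: ifP => _; case: ifP => _;
  rewrite ?mul0e ?mule0 -?EFinB -?EFinM ltry.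
Qed.

Let sphere_measure_fin_num : fin_num_fun (@sphere_measure R).
Proof.
move=> A mA; rewrite ge0_fin_numE //; apply: le_lt_trans sphere_domain_fin.
rewrite /sphere_measure /pushforward /mrestr; apply: le_measure; rewrite ?inE //.
  apply: measurableI; last exact: measurable_sphere_param_domain.
  by apply: measurable_preimage => //; exact: measurable_sphere_param.
exact: measurable_sphere_param_domain.
Qed.

(** Finiteness makes [sphere_measure] sigma-finite, as [bint_prod] demands of both factors. *)
HB.instance Definition _ := @Measure_isFinite.Build _ _ _ (@sphere_measure R)
  sphere_measure_fin_num.

Lemma sphere_measure_fin A : measurable A -> (sphere_measure A < +oo :> \bar R)%E.
Proof. by move=> mA; rewrite ltey_eq fin_num_measure. Qed.

(** The formula for image measures, with two adjustments: [h] is controlled only on the sphere and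
    is extended by zero, and the preimage [P] of the sphere exceeds the parameter rectangle, by a
    set that is null for the restricted measure. *)
Lemma sphere_integralE (h : 'rV[R]_3 -> R) : bmeas sphere h ->
  \int[sphere_measure]_(s in sphere) h s = \int[mu2]_(x in dom) h (sphere_param x).
Proof.
move=> bh; have mS := measurable_sphere; have mp := @measurable_sphere_param R.
have mD := @measurable_sphere_param_domain R.
pose h' := h \_ (@sphere R).
have bh' : bmeas setT h'.
  exact: bmeas_restrict.
pose P := @sphere_param R @^-1` sphere.
have mP : measurable P by exact: measurable_preimage.
have DP : dom `<=` P by move=> x; exact: sphere_param_in.
pose hp := h' \o @sphere_param R.
have bhp : bmeas setT hp by exact: (bmeas_comp (E := setT)).
have bmp A : bmeas A hp by exact: bmeasS bhp.
transitivity (\int[mrestr mu2 mD]_(x in P) hp x).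
  congr fine; transitivity (\int[pushforward (mrestr mu2 mD) (@sphere_param R)]_(s in sphere) (h' s)%:E)%E.
    rewrite (eq_integral (EFin \o h')); first exact: eq_measure_integral.
    by move=> s Ss; rewrite /h' /= patchE Ss.
  rewrite integral_pushforward //; first by apply/measurable_EFinP; case: bh'.
  apply: bmeas_integrable => //.
  by rewrite /= /mrestr setIidr //; exact: sphere_domain_fin.
transitivity (\int[mrestr mu2 mD]_(x in dom) hp x).
  have mPD : measurable (P `\` dom) by exact: measurableD.
  congr fine; rewrite -{1}(setDUK DP) integral_setU //; last 2 first.
  - by apply/measurable_EFinP; case: (bmp (dom `|` (P `\` dom))).
  - by apply/disj_setPS => x [Dx [_ /(_ Dx)]].
  rewrite [X in (_ + X)%E]null_set_integral ?adde0 //; first by apply/measurable_EFinP; case: (bmp (P `\` dom)).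
  by rewrite /= /mrestr setDE -setIA setICl setI0 measure0.
rewrite [LHS](_ : _ = \int[mu2]_(x in dom) hp x).
  apply: eq_Rintegral => x; rewrite inE => /sphere_param_in Sx.
  by rewrite /hp /= /h' patchE mem_set.
rewrite /Rintegral (eq_measure_integral mu2) // => A mA AD.
by rewrite /= /mrestr setIidl.
Qed.

End sphere_integral.

(** * One-dimensional integrals: circle moments and beta moments *)

Section one_dim.
Context {R : realType}.
Local Notation mu := (@lebesgue_measure R).

Lemma Rint_FTC (F f : R -> R) (a b : R) : a < b ->
  {within `[a, b], continuous f} ->
  (forall x, a <= x <= b -> is_derive x 1 F (f x)) ->
  \int[mu]_(x in `[a, b]) f x = F b - F a.
Proof.
move=> ab cf dF; have cF x : a <= x <= b -> {for x, continuous F}.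
  by move=> /dF dFx; apply/differentiable_continuous/derivable1_diffP.
rewrite /Rintegral (@continuous_FTC2 _ f F a b) //.
  split.
  - by move=> x; rewrite in_itv /= => /andP[/ltW ax /ltW xb]; have [] := dF x; rewrite ?ax ?xb.
  - by apply: cvg_at_right_filter; apply: cF; rewrite lexx ltW.
  - by apply: cvg_at_left_filter; apply: cF; rewrite lexx ltW.
move=> x; rewrite in_itv /= => /andP[/ltW ax /ltW xb].
by rewrite derive1E; apply: derive_val; apply: dF; rewrite ax xb.
Qed.

Lemma itv_fin (a b : R) : (mu `[a, b]%classic < +oo)%E.
Proof. by rewrite lebesgue_measure_itv /=; case: ifP => _; rewrite -?EFinB ltry. Qed.

Lemma bmeas_continuous_itv (f : R -> R) a b : {within `[a, b], continuous f} ->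
  bmeas (T := measurableTypeR R) `[a, b]%classic f.
Proof.
move=> cf; split.
  exact: subspace_continuous_measurable_fun.
have [M [_ hM]] : bounded_set (f @` `[a, b]).
  by apply: compact_bounded; apply: continuous_compact => //; exact: segment_compact.
exists (M + 1) => x xab; apply: hM; first by rewrite ltrDl.
by exists x.
Qed.

Section circle.
Variables x0 x1 : R.
Let A (t : R) := x0 * cos t + x1 * sin t.
Let A' (t : R) := x1 * cos t - x0 * sin t.

Let dA (t : R) : is_derive t 1 A (A' t).
Proof.
rewrite /A /A'; apply: is_derive_eq; rewrite /GRing.scale /=.
ring.
Qed.

Let dA' (t : R) : is_derive t 1 A' (- A t).
Proof.
rewrite /A /A'; apply: is_derive_eq; rewrite /GRing.scale /=.
ring.
Qed.

Let cA : continuous A.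
Proof. by move=> t; apply/differentiable_continuous/derivable1_diffP. Qed.

Lemma bmeas_circle n : bmeas (T := measurableTypeR R) `[0, 2 * pi]%classic (fun t => A t ^+ n).
Proof.
apply: bmeasX; apply: bmeas_continuous_itv; exact: continuous_subspaceT.
Qed.

(** The longitude integral of the n-th power of the horizontal part of [x . s], without the radius
    of the circle of latitude. *)
Definition circle_moment n := \int[mu]_(t in `[0, 2 * pi]) A t ^+ n.

Lemma circle_moment0 : circle_moment 0 = 2 * pi.
Proof.
rewrite /circle_moment; under eq_Rintegral do rewrite expr0.
have p0 := pi_gt0 R.
rewrite Rintegral_cst // mul1r.
have := @lebesgue_measure_itv R `[0, 2 * pi]; rewrite /= lte_fin ifT; last by lra.
by move=> ->; rewrite -EFinB /= subr0.
Qed.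

Lemma circle_moment1 : circle_moment 1 = 0.
Proof.
have p0 := pi_gt0 R.
rewrite /circle_moment; under eq_Rintegral do rewrite expr1.
have dF t : 0 <= t <= 2 * pi -> is_derive t 1 (fun t => - A' t) (A t).
  by move=> _; have := is_deriveN (dA' t); rewrite opprK; exact.
rewrite (Rint_FTC _ _ dF); [|by lra|exact: continuous_subspaceT].
by rewrite /A' mulr_natl sin2pi cos2pi sin0 cos0; lra.
Qed.

(** Integrate the derivative of [A^(n+1) A'] over a full period, where the boundary terms cancel.
    The derivative simplifies by [A'' = - A] and [A^2 + A'^2 = x0^2 + x1^2]. *)
Lemma circle_momentSS n :
  n.+2%:R * circle_moment n.+2 = n.+1%:R * (x0 ^+ 2 + x1 ^+ 2) * circle_moment n.
Proof.
have p0 := pi_gt0 R.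
have b := bmeas_circle; have fin := itv_fin 0 (2 * pi).
apply/eqP; rewrite eq_sym -subr_eq0; apply/eqP.
rewrite /circle_moment -!bintZ // -bintB //; try by apply: bmeasZ.
have dF (t : R) : 0 <= t <= 2 * pi -> is_derive t 1 (fun t => A t ^+ n.+1 * A' t)
    (n.+1%:R * (x0 ^+ 2 + x1 ^+ 2) * A t ^+ n - n.+2%:R * A t ^+ n.+2).
  move=> _; have -> : (fun t => A t ^+ n.+1 * A' t) = A ^+ n.+1 * A'.
    by apply/funext => u; rewrite mulrfctE exprfctE.
  apply: (is_derive_eq (is_deriveM (is_deriveX n.+1 (dA t)) (dA' t))); rewrite exprfctE /GRing.scale /=.
  have -> : x0 ^+ 2 + x1 ^+ 2 = A t ^+ 2 + A' t ^+ 2.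
    rewrite /A /A' -[LHS]mulr1 -(cos2Dsin2 t); ring.
  rewrite -(natr1 n.+1) -mulr_natr.
  rewrite (exprS _ n.+1) (exprS _ n); move: (A t) (A' t) (A t ^+ n) => a a' an; ring.
rewrite (Rint_FTC _ _ dF); [|by lra|].
  by rewrite /A /A' mulr_natl sin2pi cos2pi sin0 cos0; lra.
have cAn k : continuous (fun t => A t ^+ k).
  by move=> t; apply: (@continuous_comp _ _ _ A (fun u => u ^+ k));
    [exact: cA | exact: exprn_continuous].
apply: continuous_subspaceT => t.
by apply: cvgB; apply: cvgM; [exact: cvg_cst|exact: cAn|exact: cvg_cst|exact: cAn].
Qed.
End circle.

Lemma circle_moment_odd x0 x1 n : odd n -> circle_moment x0 x1 n = 0.
Proof.
move=> on; rewrite -(odd_double_half n) on add1n.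
elim: (n./2) => [|k IH]; first exact: circle_moment1.
have := circle_momentSS x0 x1 k.*2.+1; rewrite IH mulr0 => /eqP.
by rewrite mulf_eq0 pnatr_eq0 /= doubleS => /eqP.
Qed.

(** For even [m] this is the Beta function at [(j + 1, (m + 1) / 2)]. It is the height integral left
    once only even powers of [sqrt (1 - z^2)] survive. *)
Definition beta_moment j m := \int[mu]_(z in `[-1, 1]) ((1 - z ^+ 2) ^+ j * z ^+ m).

Let c1 j : continuous (fun z : R => (1 - z ^+ 2) ^+ j).
Proof.
move=> z; apply: (@continuous_comp R R R (fun z => 1 - z ^+ 2) (fun u => u ^+ j)); last exact: exprn_continuous.
by apply: cvgB; [exact: cvg_cst | exact: exprn_continuous].
Qed.

Let c2 j m : continuous (fun z : R => (1 - z ^+ 2) ^+ j * z ^+ m).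
Proof. by move=> z; apply: cvgM; [exact: c1 | exact: exprn_continuous]. Qed.

Lemma bmeas_beta j m : bmeas (T := measurableTypeR R) `[-1, 1]%classic (fun z => (1 - z ^+ 2) ^+ j * z ^+ m).
Proof. apply: bmeas_continuous_itv; apply: continuous_subspaceT; exact: c2. Qed.

Lemma beta_moment0 m : beta_moment 0 m = (1 + (-1) ^+ m) / m.+1%:R.
Proof.
have m0 : m.+1%:R != 0 :> R by rewrite pnatr_eq0.
have dF (z : R) : -1 <= z <= 1 -> is_derive z 1 (fun z => z ^+ m.+1 / m.+1%:R)
    ((1 - z ^+ 2) ^+ 0 * z ^+ m).
  move=> _; have -> : (fun z : R => z ^+ m.+1 / m.+1%:R) = m.+1%:R^-1 *: (@id R ^+ m.+1).
    by apply/funext => u; rewrite mulrC scalrfctE exprfctE.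
  have h := is_deriveZ m.+1%:R^-1 (is_deriveX m.+1 (is_derive_id z (1 : R))).
  by apply: (is_derive_eq h); rewrite /GRing.scale /= expr0 mul1r mulr1 mulKf.
rewrite /beta_moment (Rint_FTC _ _ dF); [|by lra|apply: continuous_subspaceT; exact: c2].
by rewrite expr1n exprS mulN1r mulNr opprK -mulrDl.
Qed.

(** Integrate the derivative of [(1 - z^2)^(j+1) z^(m+1)], which vanishes at both ends. *)
Lemma beta_momentS j m :
  m.+1%:R * beta_moment j.+1 m = 2 * j.+1%:R * beta_moment j m.+2.
Proof.
have b := bmeas_beta; have fin := itv_fin (-1) 1.
apply/eqP; rewrite -subr_eq0; apply/eqP.
rewrite /beta_moment -!bintZ // -bintB //; try by apply: bmeasZ.
have dF (z : R) : -1 <= z <= 1 -> is_derive z 1 (fun z => (1 - z ^+ 2) ^+ j.+1 * z ^+ m.+1)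
    (m.+1%:R * ((1 - z ^+ 2) ^+ j.+1 * z ^+ m) - 2 * j.+1%:R * ((1 - z ^+ 2) ^+ j * z ^+ m.+2)).
  move=> _; pose w := fun z : R => 1 - z ^+ 2.
  have dw : is_derive z 1 w (- (2 * z)).
    have h := is_deriveB (is_derive_cst (1 : R) z (1 : R)) (is_deriveX 2 (is_derive_id z (1 : R))).
    by apply: (is_derive_eq h); rewrite /GRing.scale /=; ring.
  have -> : (fun z => (1 - z ^+ 2) ^+ j.+1 * z ^+ m.+1) = w ^+ j.+1 * (id ^+ m.+1).
    by apply/funext => u; rewrite mulrfctE !exprfctE.
  have h := is_deriveM (is_deriveX j.+1 dw) (is_deriveX m.+1 (is_derive_id z (1 : R))).
  apply: (is_derive_eq h); rewrite !exprfctE /GRing.scale /= /w mulr1.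
  rewrite !(exprS z) (exprS _ j); move: (z ^+ m) ((1 - z ^+ 2) ^+ j) => a b'; ring.
rewrite (Rint_FTC _ _ dF); [|by lra|].
  by rewrite sqrrN expr1n subrr !exprS !mul0r subrr.
apply: continuous_subspaceT => z.
by apply: cvgB; apply: cvgM; [exact: cvg_cst|exact: c2|exact: cvg_cst|exact: c2].
Qed.

End one_dim.

(** * Even moments of linear functions on the sphere *)

Section moments.
Context {R : realType}.
Local Notation mu := (@lebesgue_measure R).

Lemma big_even_ord (V : zmodType) (f : nat -> V) M :
  (forall k, odd k -> f k = 0) ->
  \sum_(k < (2 * M).+1) f k = \sum_(j < M.+1) f (2 * j)%N.
Proof.
move=> fo; elim: M => [|M IH]; first by rewrite !big_ord_recl !big_ord0.
rewrite mulnS big_ord_recr big_ord_recr /= IH [RHS]big_ord_recr /= mulnS.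
by rewrite (fo (2 * M).+1) ?addr0 //= mul2n odd_double.
Qed.

(** Rotation invariance of the circle, read off the recursion, which involves [x0] and [x1] only
    through [x0^2 + x1^2]. *)
Lemma circle_moment_even (x0 x1 : R) M :
  circle_moment x0 x1 (2 * M) = circle_moment 1 0 (2 * M) * (x0 ^+ 2 + x1 ^+ 2) ^+ M.
Proof.
elim: M => [|M IH]; first by rewrite !circle_moment0 expr0 mulr1.
have n0 : (2 * M).+2%:R != 0 :> R by rewrite pnatr_eq0.
rewrite mulnS !add2n; apply: (mulfI n0); rewrite mulrA !circle_momentSS IH.
by rewrite expr1n expr0n /= addr0 mulr1 (exprS _ M); ring.
Qed.

(** The identity that lets the expansion of a moment collapse to a binomial formula for
    [x2^2 + (x0^2 + x1^2)]. By the recursions of its three factors the left side is multiplied by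
    [(M - j) / (j + 1)] when [j] grows by one, like ['C(M, j)]. *)
Lemma binomial_moments M j : (j <= M)%N ->
  'C(2 * M, 2 * j)%:R * beta_moment j (2 * (M - j)) * circle_moment 1 0 (2 * j) =
  4 * pi / (2 * M).+1%:R * 'C(M, j)%:R :> R.
Proof.
elim: j => [|j IH] jM.
  rewrite muln0 !bin0 mul1r mulr1 subn0 beta_moment0 circle_moment0.
  by rewrite exprM sqrrN !expr1n mulrAC; congr (_ / _); ring.
have {}IH := IH (ltnW jM).
pose i := (M - j.+1)%N; have MjE : (M - j = i.+1)%N by rewrite /i; lia.
rewrite -/i; rewrite MjE in IH.
have hB := @beta_momentS R j (2 * i).
have hG := @circle_momentSS R 1 0 (2 * j).
have hC1 : (2 * j).+1%:R * 'C(2 * M, (2 * j).+1)%:R = (2 * i).+2%:R * 'C(2 * M, 2 * j)%:R :> R.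
  by rewrite -!natrM mul_bin_left; congr (_ * _)%:R; rewrite /i; lia.
have hC2 : (2 * j).+2%:R * 'C(2 * M, (2 * j).+2)%:R = (2 * i).+1%:R * 'C(2 * M, (2 * j).+1)%:R :> R.
  by rewrite -!natrM mul_bin_left; congr (_ * _)%:R; rewrite /i; lia.
have hD : j.+1%:R * 'C(M, j.+1)%:R = i.+1%:R * 'C(M, j)%:R :> R.
  by rewrite -!natrM mul_bin_left; congr (_ * _)%:R; rewrite /i; lia.
have -> : (2 * j.+1 = (2 * j).+2)%N by lia.
have e2 : (2 * i.+1 = (2 * i).+2)%N by lia.
rewrite e2 in IH.
move: hB hG hC1 hC2 hD IH.
rewrite expr1n expr0n /= addr0 mulr1.
move: (beta_moment j.+1 _) (beta_moment j _) (circle_moment 1 0 (2 * j).+2) (circle_moment 1 0 (2 * j)) => B' B G' G.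
move: ('C(2 * M, (2 * j).+2)%:R) ('C(2 * M, (2 * j).+1)%:R) ('C(2 * M, 2 * j)%:R) ('C(M, j.+1)%:R) ('C(M, j)%:R) => C2 C1 C0 D1 D0.
have j0 : j.+1%:R != 0 :> R by rewrite pnatr_eq0.
have a0 : (2 * j).+1%:R != 0 :> R by rewrite pnatr_eq0.
have b0 : (2 * j).+2%:R != 0 :> R by rewrite pnatr_eq0.
have c0 : (2 * i).+1%:R != 0 :> R by rewrite pnatr_eq0.
move=> hB hG hC1 hC2 hD IH.
have -> : B' = 2 * j.+1%:R * B / (2 * i).+1%:R by rewrite -hB mulrC mulKf.
have -> : G' = (2 * j).+1%:R * G / (2 * j).+2%:R by rewrite -hG mulrC mulKf.
have -> : C2 = (2 * i).+1%:R * ((2 * i).+2%:R * C0 / (2 * j).+1%:R) / (2 * j).+2%:R.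
  by rewrite -hC1 (mulrC _ C1) mulfK // -hC2 mulrC mulKf.
have -> : D1 = i.+1%:R * D0 / j.+1%:R by rewrite -hD mulrC mulKf.
(* Isolates the previous right-hand side, with ratio [(M - j) / (j + 1)] since [i.+1] is [M - j]. *)
rewrite [RHS](_ : _ = (4 * pi / (2 * M).+1%:R * D0) * (i.+1%:R / j.+1%:R)); last by rewrite -mulrA [_ * D0]mulrC -!mulrA.
rewrite -IH.
have -> : (2 * j).+2%:R = 2 * j.+1%:R :> R by rewrite -natrM; congr _%:R; lia.
have -> : (2 * i).+2%:R = 2 * i.+1%:R :> R by rewrite -natrM; congr _%:R; lia.
move: j0 a0 c0; move: (j.+1%:R) (i.+1%:R) ((2 * j).+1%:R) ((2 * i).+1%:R) => j' i' a c j0 a0 c0.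
by field; rewrite j0 a0 c0.
Qed.

Lemma bmeas_coord i : bmeas sphere (fun s : 'rV[R]_3 => s ord0 i).
Proof.
split; first by apply: measurable_funTS; exact: measurable_coord.
exists 1 => s /sphereP; rewrite /dot => ss.
rewrite -[X in _ <= X]sqrtr1 -sqrtr_sqr ler_wsqrtr // -ss (bigD1 i) //= -expr2.
by rewrite lerDl; apply: sumr_ge0 => j _; exact: sqr_ge0.
Qed.

Lemma bmeas_dot (x : 'rV[R]_3) : bmeas sphere (dot x).
Proof.
apply: (@bmeas_sum _ _ _ _ _ _ xpredT) => i _.
by apply: bmeasZ; exact: bmeas_coord.
Qed.

(** In the parameters, [x . s = x2 z + w(z) A(t)]. The binomial expansion separates height and
    longitude; odd powers of [A] integrate to zero, so the square root occurs in even powers only,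
    and the rest is resummed. *)
Theorem sphere_moment_even (x : 'rV[R]_3) M :
  \int[sphere_measure]_(s in sphere) (dot x s) ^+ (2 * M) =
  4 * pi / (2 * M).+1%:R * (dot x x) ^+ M.
Proof.
rewrite sphere_integralE; last by apply: bmeasX; exact: bmeas_dot.
set x0 := x ord0 0; set x1 := x ord0 1; set x2 := x ord0 2%:R.
have mI := @measurable_itv R `[-1, 1]; have mJ := @measurable_itv R `[0, 2 * pi].
pose w (z : R) := Num.sqrt (1 - z ^+ 2).
have cw : continuous w.
  move=> z; apply: (@continuous_comp R R R (fun z => 1 - z ^+ 2) Num.sqrt); last exact: sqrt_continuous.
  by apply: cvgB; [exact: cvg_cst | exact: exprn_continuous].
have bw k : bmeas (T := measurableTypeR R) `[-1, 1]%classic (fun z => w z ^+ k).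
  by apply: bmeasX; apply: bmeas_continuous_itv; exact: continuous_subspaceT.
have bz k : bmeas (T := measurableTypeR R) `[-1, 1]%classic (fun z => z ^+ k).
  apply: bmeasX; apply: bmeas_continuous_itv; apply: continuous_subspaceT => z; exact: cvg_id.
pose F k z := (x2 ^+ (2 * M - k) * 'C(2 * M, k)%:R) * (z ^+ (2 * M - k) * w z ^+ k).
pose G k t := (x0 * cos t + x1 * sin t) ^+ k.
have bF k : bmeas (T := measurableTypeR R) `[-1, 1]%classic (F k).
  by apply: bmeasZ; apply: bmeasM.
transitivity (\int[(mu \x mu)%E]_(y in sphere_param_domain) (\sum_(k < (2 * M).+1) F k y.1 * G k y.2)).
  apply: eq_Rintegral.
  move=> y _; rewrite dotE3 !mxE /= -/x0 -/x1 -/x2 -/(w y.1).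
  have -> : x0 * (w y.1 * cos y.2) + x1 * (w y.1 * sin y.2) + x2 * y.1 =
    x2 * y.1 + w y.1 * (x0 * cos y.2 + x1 * sin y.2) by ring.
  rewrite exprDn; apply: eq_bigr => k _; rewrite /F /G -mulr_natr !exprMn; ring.
rewrite bint_sum; last 3 first.
- exact: measurable_sphere_param_domain.
- exact: sphere_domain_fin.
- move=> k; apply: bmeasM.
    by apply: bmeas_fst.
  by apply: bmeas_snd => //; exact: bmeas_circle.
pose f k := x2 ^+ (2 * M - k) * 'C(2 * M, k)%:R *
  (\int[mu]_(z in `[-1, 1]) (z ^+ (2 * M - k) * w z ^+ k)) * circle_moment x0 x1 k.
transitivity (\sum_(k < (2 * M).+1) f k).
  apply: eq_bigr => k _.
  rewrite (@bint_prod _ _ (measurableTypeR R) (measurableTypeR R) R mu mu _ _ mI mJ (itv_fin _ _) (itv_fin _ _) _ _ (bF k) (bmeas_circle _ _ k)).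
  rewrite /f /F bintZ //; first exact: itv_fin.
  exact: bmeasM.
rewrite big_even_ord; last by move=> k ok; rewrite /f circle_moment_odd // mulr0.
have -> : dot x x = x2 ^+ 2 + (x0 ^+ 2 + x1 ^+ 2) by rewrite dotE3 -/x0 -/x1 -/x2; ring.
rewrite exprDn mulr_sumr; apply: eq_bigr => j _.
have jM : (j <= M)%N by rewrite -ltnS.
have -> : f (2 * j)%N = x2 ^+ (2 * (M - j)) * (x0 ^+ 2 + x1 ^+ 2) ^+ j *
    ('C(2 * M, 2 * j)%:R * beta_moment j (2 * (M - j)) * circle_moment 1 0 (2 * j)).
  rewrite /f circle_moment_even -mulnBr.
  have -> : \int[mu]_(z in `[-1, 1]) (z ^+ (2 * (M - j)) * w z ^+ (2 * j)) = beta_moment j (2 * (M - j)).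
    apply: eq_Rintegral => z; rewrite inE /= in_itv /= => /andP[z1 z2].
    rewrite mulrC (exprM (w z)) /w sqr_sqrtr //.
    by rewrite subr_ge0 -ler_sqrt ?ltr01 // sqrtr_sqr sqrtr1 ler_norml z1 z2.
  by ring.
by rewrite binomial_moments // exprM -mulr_natr; ring.
Qed.

End moments.

(** * Invariance of the surface measure under the antipodal map *)

Section antipodal_invariance.
Context {R : realType}.
Local Notation mu := (@lebesgue_measure R).

Lemma lebesgue_measure_shift (c : R) A : measurable A ->
  mu ((fun x => x + c) @^-1` A) = mu A.
Proof.
move=> mA; have mc : measurable_fun setT (fun x : measurableTypeR R => (x + c : measurableTypeR R)).
  by apply: measurable_funD.
transitivity (pushforward mu (fun x : measurableTypeR R => (x + c : measurableTypeR R)) A); first by [].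
apply/esym/lebesgue_measure_unique => //= _ [[a b]] _ <-.
rewrite /pushforward (_ : _ @^-1` _ = `]a - c, b - c]%classic).
  rewrite !lebesgue_measure_itv /= !lte_fin ltrD2r -!EFinB.
  by case: ifP => // _; congr (_%:E); ring.
by apply/seteqP; split => x /=; rewrite !in_itv /= ltrBlDr lerBrDr.
Qed.

Let I : set (measurableTypeR R) := `[-1, 1]%classic.
Let J : set (measurableTypeR R) := `[0, 2 * pi]%classic.
Let mI : measurable I := @measurable_itv R `[-1, 1].
Let mJ : measurable J := @measurable_itv R `[0, 2 * pi].

(* In the coordinates (height, longitude) of [sphere_param] the antipodal map is
   [turn]. *)
Let half_turn (t : measurableTypeR R) : measurableTypeR R :=
  if t <= pi then t + pi else t - pi.

Let measurable_half_turn : measurable_fun setT half_turn.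
Proof.
apply: measurable_fun_if => //.
- exact: measurable_fun_ler.
- by apply: measurable_funTS; exact: measurable_funD.
- by apply: measurable_funTS; exact: measurable_funB.
Qed.

(** The half turn exchanges the two halves of the interval by translations. The restriction to [J]
    matters: on the whole line the two translates would overlap. *)
Let half_turn_measure A : measurable A -> mu (half_turn @^-1` A `&` J) = mu (A `&` J).
Proof.
move=> mA; have p0 := pi_gt0 R.
pose B1 := A `&` `[pi, 2 * pi]%classic; pose B2 := A `&` `]0, pi]%classic.
have mB1 : measurable B1 by exact: measurableI.
have mB2 : measurable B2 by exact: measurableI.
have -> : half_turn @^-1` A `&` J =
    ((fun x => x + pi) @^-1` B1) `|` ((fun x => x - pi) @^-1` B2).
  apply/seteqP; split => t /=; rewrite /half_turn /B1 /B2 /J /= !in_itv /=.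
    case=> + /andP[t0 t1]; case: ifPn => tp At; [left|right]; split => //; apply/andP; split; lra.
  case=> -[At /andP[h1 h2]].
    have -> : t <= pi by lra.
    by split => //; apply/andP; split; lra.
  have -> : (t <= pi) = false by apply/negbTE; rewrite -ltNge; lra.
  by split => //; apply/andP; split; lra.
have msh c B : measurable B -> measurable ((fun x : measurableTypeR R => (x + c : measurableTypeR R)) @^-1` B).
  by move=> mB; apply: measurable_preimage => //; exact: measurable_funD.
have d1 (a : R) : mu (A `&` [set a]) = 0.
  apply: (@subset_measure0 _ _ _ mu _ [set a]) => //.
  - exact: measurableI.
  - exact: lebesgue_measure_set1.
(* The two halves do not match exactly: the preimage yields the half open at 0, the splitting of [J]
   the half open at [pi]. They differ by single points, which are null. *)
have endpoint : mu (A `&` `]0, pi]%classic) = mu (A `&` `[0, pi[%classic).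
  have -> : A `&` `]0, pi]%classic = (A `&` `]0, pi[%classic) `|` (A `&` [set (pi : R)]).
    rewrite -setIUr; congr (_ `&` _); apply/seteqP; split => t /=; rewrite !in_itv /=.
      by rewrite le_eqVlt => /andP[-> /predU1P[->|->]]; [right|left].
    by move=> [/andP[-> /ltW ->]//|->]; rewrite p0 lexx.
  have -> : A `&` `[0, pi[%classic = (A `&` `]0, pi[%classic) `|` (A `&` [set (0 : R)]).
    rewrite -setIUr; congr (_ `&` _); apply/seteqP; split => t /=; rewrite !in_itv /=.
      by rewrite le_eqVlt => /andP[/predU1P[<-|->] ->]; [right|left].
    by move=> [/andP[/ltW -> ->]//|->]; rewrite p0 lexx.
  by rewrite !measureU0 //; solve [exact: measurableI | exact: d1].
have -> : A `&` J = B1 `|` (A `&` `[0, pi[%classic).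
  rewrite /B1 -setIUr; congr (_ `&` _); apply/seteqP; split => t; rewrite /J /= !in_itv /=.
    by move=> /andP[t0 ->]; case: (leP pi t) => tp; [left|right]; rewrite ?t0.
  by case=> /andP[h1 h2]; apply/andP; split; lra.
rewrite measureU; [|exact: msh|exact: msh|].
  transitivity (mu B1 + mu B2)%E.
    by congr (_ + _)%E; exact: lebesgue_measure_shift.
  rewrite /B2 endpoint [RHS]measureU //.
    exact: measurableI.
  apply/seteqP; split => t //=; rewrite /B1 /= !in_itv /= => -[[_ /andP[h1 _]] [_ /andP[_ h2]]].
  by lra.
apply/seteqP; split => t //=; rewrite /B1 /B2 /= !in_itv /= => -[[_ /andP[h1 h2]] [_ /andP[h3 h4]]].
by lra.
Qed.

Let finI : (mu I < +oo)%E := itv_fin (-1) 1.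
Let finJ : (mu J < +oo)%E := itv_fin 0 (2 * pi).
Let muI := mfrestr mI finI.
Let muJ := mfrestr mJ finJ.

Let prodE B : measurable B -> (muI \x muJ)%E B = (mu \x mu)%E (B `&` (I `*` J)).
Proof.
move=> mB; rewrite (product_measure_unique (m' := mrestr (mu \x mu)%E (measurableX mI mJ))) // => X Y mX mY.
by rewrite /= /mrestr -setXI product_measure1E //; exact: measurableI.
Qed.

Let turn (x : measurableTypeR R * measurableTypeR R) : measurableTypeR R * measurableTypeR R :=
  (- x.1, half_turn x.2).

Let measurable_turn : measurable_fun setT turn.
Proof.
apply: measurable_fun_pair; last by apply: measurableT_comp.
by apply: measurableT_comp => //; exact: measurable_fst.
Qed.

(** By uniqueness of the product measure it is enough to compare on rectangles, where the reflection
    of the height and the half turn of the longitude act separately. *)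
Let turn_measure B : measurable B -> (muI \x muJ)%E (turn @^-1` B) = (muI \x muJ)%E B.
Proof.
move=> mB; rewrite [RHS](product_measure_unique (m' := pushforward (muI \x muJ)%E turn)) // => X Y mX mY.
rewrite /= /pushforward (_ : turn @^-1` _ = (-%R @^-1` X) `*` (half_turn @^-1` Y)) //.
rewrite product_measure1E; last 2 first.
- by apply: measurable_preimage => //; exact: oppr_measurable.
- exact: measurable_preimage.
rewrite /muI /muJ /= /mfrestr /mrestr half_turn_measure //; congr (_ * _)%E.
rewrite -[RHS]lebesgue_measureN /pushforward; last exact: measurableI.
congr (mu _); rewrite preimage_setI; congr (_ `&` _).
by apply/seteqP; split => z; rewrite /I /= !in_itv /= => /andP[h1 h2]; apply/andP; split; lra.
Qed.

Let sphere_param_turn x : sphere_param_domain x -> sphere_param (turn x) = - sphere_param x.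
Proof.
move=> _; have cB t : cos (t - pi) = - cos t :> R by rewrite -[in RHS](subrK pi t) cosDpi opprK.
have sB t : sin (t - pi) = - sin t :> R by rewrite -[in RHS](subrK pi t) sinDpi opprK.
apply/rowP => -[[|[|[|//]]] i3]; rewrite !mxE /= ?sqrrN // /half_turn; case: ifP => _;
  by rewrite ?cosDpi ?sinDpi ?cB ?sB mulrN.
Qed.

Lemma measurable_opp_rV n : measurable_fun setT (fun s : 'rV[R]_n => - s).
Proof.
apply: measurable_fun_rV => i; under eq_fun do rewrite mxE.
by apply: measurableT_comp => //; exact: measurable_coord.
Qed.

Lemma sphere_measure_opp A : measurable A ->
  sphere_measure ((fun s : 'rV[R]_3 => - s) @^-1` A) = sphere_measure A.
Proof.
move=> mA; have mp := @measurable_sphere_param R.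
have mopp : measurable ((fun s : 'rV[R]_3 => - s) @^-1` A).
  by apply: measurable_preimage => //; exact: measurable_opp_rV.
have mE B : measurable B -> sphere_measure B = (muI \x muJ)%E (@sphere_param R @^-1` B).
  by move=> mB; rewrite prodE //; exact: measurable_preimage.
have mpA : measurable (@sphere_param R @^-1` A) by exact: measurable_preimage.
rewrite (mE _ mopp) (mE _ mA) -(turn_measure mpA).
rewrite !prodE; last 2 first.
- by apply: measurable_preimage => //; exact: measurable_preimage.
- exact: measurable_preimage.
congr (_ _); apply/seteqP; split => x [/= Ax Dx]; split => //=.
  by rewrite sphere_param_turn.
by rewrite -sphere_param_turn.
Qed.

Lemma sphereN (s : 'rV[R]_3) : sphere (- s) <-> sphere s.
Proof. by rewrite !sphereP !dotE3 !mxE !mulrNN. Qed.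

Lemma bmeas_opp (h : 'rV[R]_3 -> R) : bmeas sphere h -> bmeas sphere (fun s => h (- s)).
Proof.
move=> bh; apply: (bmeas_comp (h := fun s : 'rV[R]_3 => - s) (E := sphere)) => //;
  try exact: measurable_sphere; first exact: measurable_opp_rV.
by move=> s /sphereN.
Qed.

Lemma sphere_integral_opp (h : 'rV[R]_3 -> R) : bmeas sphere h ->
  \int[sphere_measure]_(s in sphere) h (- s) = \int[sphere_measure]_(s in sphere) h s.
Proof.
move=> bh; have mS := @measurable_sphere R; have mopp := @measurable_opp_rV 3.
have bh' := bmeas_restrict mS bh.
have pS : (fun s : 'rV[R]_3 => - s) @^-1` sphere = sphere.
  by apply/seteqP; split => s /=; rewrite sphereN.
have hN s : sphere s -> (h \_ sphere) (- s) = h (- s).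
  by move=> Ss; rewrite patchE mem_set //; apply/sphereN.
pose f := EFin \o (h \_ sphere).
have fS s : s \in sphere -> f s = (h s)%:E by move=> Ss; rewrite /f /= patchE Ss.
have mf : measurable_fun setT f by apply/measurable_EFinP; case: bh'.
have intf : sphere_measure.-integrable ((fun s : 'rV[R]_3 => - s) @^-1` sphere) (f \o (fun s => - s)).
  rewrite pS; suff : sphere_measure.-integrable sphere (EFin \o (fun s => (h \_ sphere) (- s))) by [].
  apply: bmeas_integrable => //; first exact: sphere_measure_fin.
  apply: bmeas_eq (bmeas_opp bh) => s Ss.
  by rewrite hN.
have := integral_pushforward mopp mf intf mS; rewrite pS => E.
rewrite /Rintegral; congr fine.
transitivity (\int[sphere_measure]_(s in sphere) (f \o (fun s => - s)%R) s)%E.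
  apply: eq_integral => s; rewrite inE => Ss.
  by rewrite -(hN s Ss).
transitivity (\int[sphere_measure]_(s in sphere) f s)%E; last first.
  by apply: eq_integral => s Ss; exact: fS.
rewrite -E; apply: eq_measure_integral => A mA _; exact: sphere_measure_opp.
Qed.

End antipodal_invariance.

Lemma poly_eq_horner (R : realType) (p q : {poly R}) :
  (forall a, p.[a] = q.[a]) -> p = q.
Proof.
move=> pq; apply/eqP; rewrite -subr_eq0; apply/eqP; set r := p - q.
apply/eqP; apply: contraT => r0.
have := @max_poly_roots R r [seq i%:R | i <- iota 0 (size r)] r0.
rewrite size_map size_iota ltnn; apply.
  by apply/allP => _ /mapP[i _ ->]; rewrite /root /r !hornerE pq subrr.
by rewrite map_inj_uniq ?iota_uniq // => i j /eqP; rewrite eqr_nat => /eqP.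
Qed.

(** * Zonal operators *)

Section zonal.
Context {R : realType}.
Implicit Types (s x y : 'rV[R]_3) (f h : 'rV[R]_3 -> R).
Local Notation S := (@sphere R).
Local Notation sint f := (\int[sphere_measure]_(s in S) f s).

Let mS := @measurable_sphere R.
Let finS := sphere_measure_fin mS.

(** Indexed by words of length [n] rather than by multi-indices: the expansion of [(x . y)^n] then
    has all coefficients equal to 1. *)
Definition monom n (w : {ffun 'I_n -> 'I_3}) s : R := \prod_i s ord0 (w i).

Definition moment f n (w : {ffun 'I_n -> 'I_3}) : R :=
  \int[sphere_measure]_(s in S) (f s * monom w s).

Definition zonal_op n f s : R :=
  \int[sphere_measure]_(y in S) ((dot s y) ^+ n * f y).

Definition zonal_form n f h : R :=
  \int[sphere_measure]_(s in S) (zonal_op n f s * h s).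

Definition sqnorm f : R := \int[sphere_measure]_(s in S) (f s ^+ 2).

Lemma dotX x y n : dot x y ^+ n = \sum_(w : {ffun 'I_n -> 'I_3}) monom w x * monom w y.
Proof.
rewrite -[in LHS](card_ord n) -prodr_const /dot (bigA_distr_bigA (fun _ j => x ord0 j * y ord0 j)).
by apply: eq_bigr => w _; rewrite big_split.
Qed.

Lemma dotC n (x y : 'rV[R]_n) : dot x y = dot y x.
Proof. by apply: eq_bigr => i _; rewrite mulrC. Qed.

Lemma bmeas_monom n w : bmeas S (@monom n w).
Proof. by apply: (@bmeas_prod _ _ _ _ _ _ xpredT) => i _; exact: bmeas_coord. Qed.

Lemma bmeas_dotX x n : bmeas S (fun y => dot x y ^+ n).
Proof. by apply: bmeasX; exact: bmeas_dot. Qed.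

Lemma zonal_opE n f s : bmeas S f ->
  zonal_op n f s = \sum_(w : {ffun 'I_n -> 'I_3}) moment f w * monom w s.
Proof.
move=> bf; rewrite /zonal_op.
under eq_Rintegral do rewrite dotX mulr_suml.
rewrite bint_sum // => [|w]; last first.
  by apply: bmeasM => //; apply: bmeasZ; exact: bmeas_monom.
apply: eq_bigr => w _; rewrite mulrC -bintZ //; last by apply: bmeasM => //; exact: bmeas_monom.
by apply: eq_Rintegral => y _; rewrite mulrAC mulrA.
Qed.

Lemma bmeas_zonal_op n f : bmeas S f -> bmeas S (zonal_op n f).
Proof.
move=> bf; rewrite (_ : zonal_op n f = fun s => \sum_(w : {ffun 'I_n -> 'I_3}) moment f w * monom w s).
  by apply: (@bmeas_sum _ _ _ _ _ _ xpredT) => w _; apply: bmeasZ; exact: bmeas_monom.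
by apply/funext => s; rewrite zonal_opE.
Qed.

(** The kernel [(s . y)^n] is the Gram kernel of the map sending [s] to all its monomials. Symmetry
    and nonnegativity of the form can be read off this finite sum. *)
Lemma zonal_formE n f h : bmeas S f -> bmeas S h ->
  zonal_form n f h = \sum_(w : {ffun 'I_n -> 'I_3}) moment f w * moment h w.
Proof.
move=> bf bh; rewrite /zonal_form.
under eq_Rintegral do rewrite zonal_opE // mulr_suml.
rewrite bint_sum // => [|w]; last first.
  by apply: bmeasM => //; apply: bmeasZ; exact: bmeas_monom.
apply: eq_bigr => w _; rewrite -bintZ //; last by apply: bmeasM => //; exact: bmeas_monom.
by apply: eq_Rintegral => y _; rewrite -mulrA (mulrC (monom w y)).
Qed.

Lemma zonal_formC n f h : bmeas S f -> bmeas S h ->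
  zonal_form n f h = zonal_form n h f.
Proof.
by move=> bf bh; rewrite !zonal_formE //; apply: eq_bigr => w _; rewrite mulrC.
Qed.

Lemma zonal_form_ge0 n f : bmeas S f -> 0 <= zonal_form n f f.
Proof. by move=> bf; rewrite zonal_formE // sumr_ge0 // => w _; exact: sqr_ge0. Qed.

(** Replacing [y] by [- y] preserves the integral and changes the sign of the integrand. *)
Lemma zonal_op_parity n f p : bmeas S f -> (forall s, f (- s) = (-1) ^+ p * f s) ->
  odd n != odd p -> forall s, zonal_op n f s = 0.
Proof.
move=> bf fp np s; rewrite /zonal_op.
have bh : bmeas S (fun y => dot s y ^+ n * f y) by apply: bmeasM => //; exact: bmeas_dotX.
have := sphere_integral_opp bh.
have -> : \int[sphere_measure]_(y in S) (dot s (- y) ^+ n * f (- y)) =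
    \int[sphere_measure]_(y in S) (-1 * (dot s y ^+ n * f y)).
  apply: eq_Rintegral => y _; rewrite fp.
  have -> : dot s (- y) = - dot s y by rewrite !dotE3 !mxE; ring.
  rewrite (exprNn (dot s y)) mulrACA -(signr_odd _ n) -(signr_odd _ p).
  by move: np; case: (odd n); case: (odd p) => // _; rewrite ?expr1 ?expr0 ?mulr1 ?mul1r.
by rewrite bintZ //; lra.
Qed.

(* The eigenvalue of the kernel t^n on functions of degree 0 (n even) or 1
   (n odd). *)
Definition zonal_eigen n : R := 4 * pi / (n.+1 + odd n)%:R.

Lemma zonal_eigen_gt0 n : 0 < zonal_eigen n.
Proof. by rewrite /zonal_eigen divr_gt0 ?mulr_gt0 ?pi_gt0 // ltr0n. Qed.

(* Expanding the integral of [(x + a y, .)^(2M)] in powers of [a]. *)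
Lemma mixed_moments x y M : dot x x = 1 -> dot y y = 1 ->
  \poly_(m < (2 * M).+1) ('C(2 * M, m)%:R *
     \int[sphere_measure]_(s in S) (dot x s ^+ (2 * M - m) * dot y s ^+ m)) =
  (4 * pi / (2 * M).+1%:R) *: ('X^2 + (2 * dot x y) *: 'X + 1) ^+ M.
Proof.
move=> x1 y1; apply: poly_eq_horner => a; rewrite horner_poly !hornerE.
have -> : a ^+ 2 + 2 * dot x y * a + 1 = dot (x + a *: y) (x + a *: y).
  have -> : dot (x + a *: y) (x + a *: y) = dot x x + 2 * dot x y * a + a ^+ 2 * dot y y.
    by rewrite !dotE3 !mxE; ring.
  by rewrite x1 y1; ring.
rewrite -sphere_moment_even.
have b m : bmeas S (fun s => dot x s ^+ (2 * M - m) * dot y s ^+ m).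
  by apply: bmeasM; exact: bmeas_dotX.
transitivity (\int[sphere_measure]_(s in S) (\sum_(m < (2 * M).+1)
   ('C(2 * M, m)%:R * a ^+ m) * (dot x s ^+ (2 * M - m) * dot y s ^+ m))).
  rewrite bint_sum // => [|m]; last by apply: bmeasZ; exact: b.
  by apply: eq_bigr => m _; rewrite bintZ // mulrAC.
apply: eq_Rintegral => s _.
have -> : dot (x + a *: y) s = dot x s + a * dot y s by rewrite !dotE3 !mxE; ring.
rewrite exprDn; apply: eq_bigr => m _; rewrite exprMn -mulr_natl; ring.
Qed.

(** For even [n] the function is constant and the value is a plain moment; for odd [n] it is linear,
    and the value is a coefficient in [mixed_moments]. *)
Lemma zonal_op_eigen n e x : dot e e = 1 -> dot x x = 1 ->
  zonal_op n (fun y => dot e y ^+ odd n) x = zonal_eigen n * dot e x ^+ odd n.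
Proof.
move=> e1 x1; rewrite /zonal_op /zonal_eigen; case: (boolP (odd n)) => on.
  (* So that [n = 2 M - 1]: the coefficient of the first power of [a] is the integral of
     [(x . s)^n (e . s)], up to the factor [2 M]. *)
  pose M := (n./2).+1; have nE : n = (2 * M).-1 by rewrite /M; have := odd_double_half n; rewrite on; lia.
  have := congr1 (fun p : {poly R} => p`_1) (mixed_moments M x1 e1).
  rewrite coef_poly coefZ ltnS (_ : 1 <= 2 * M)%N; last by rewrite /M; lia.
  have -> : (('X^2 + (2 * dot x e) *: 'X + 1) ^+ M)`_1 = M%:R * (2 * dot x e).
    have := coef_deriv (('X^2 + (2 * dot x e) *: 'X + 1) ^+ M) 0; rewrite mulr1n => <-.
    rewrite deriv_exp !poly.derivE -horner_coef0 !hornerE hornerMn !hornerE.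
    by rewrite expr2 mul0r add0r expr1n mulr1 -mulr_natl mulrA.
  rewrite bin1 subn1 -nE expr1 => h.
  have M0 : (2 * M)%:R != 0 :> R by rewrite pnatr_eq0 /M; lia.
  have -> : (n.+1 + true = (2 * M).+1)%N by rewrite nE /M; lia.
  apply: (mulfI M0); rewrite h natrM (dotC e); ring.
have nE : n = (2 * n./2)%N by have := odd_double_half n; rewrite (negbTE on); lia.
rewrite expr0 mulr1 addn0; under eq_Rintegral do rewrite expr0 mulr1.
by rewrite nE sphere_moment_even x1 expr1n mulr1.
Qed.

(* The composition of the kernel t^n with itself is the kernel
   \sum_j (zonal_comp n j) t^j; the coefficients come from [mixed_moments]. *)
Definition zonal_comp n j : R :=
  4 * pi / (2 * n).+1%:R / 'C(2 * n, n)%:R *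
  ('C(n, j)%:R * 2 ^+ j * (('X^2 + 1) ^+ (n - j) : {poly R})`_(n - j)).

Lemma zonal_comp_ge0 n j : 0 <= zonal_comp n j.
Proof.
rewrite /zonal_comp mulr_ge0 ?divr_ge0 ?mulr_ge0 ?pi_ge0 ?ler0n ?exprn_ge0 //.
rewrite addrC exprDn coef_sum sumr_ge0 // => i _.
by rewrite expr1n mul1r -exprM coefMn coefXn mulrn_wge0.
Qed.

(** [(X^2 + 1)^(n - j)] contains even powers only, so its coefficient at [n - j] vanishes when
    [n - j] is odd. *)
Lemma zonal_comp_parity n j : (j <= n)%N -> odd j != odd n -> zonal_comp n j = 0.
Proof.
move=> jn jo; rewrite /zonal_comp (addrC 'X^2) (exprDn 1 'X^2) coef_sum big1 ?mulr0 // => i _.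
rewrite expr1n mul1r -exprM coefMn coefXn (_ : (_ == _) = false) ?mul0rn //.
by apply/negbTE; move: jo; apply: contra => /eqP; lia.
Qed.

(** The middle coefficient, at [a^n], of [mixed_moments n]; on the right [(X^2 + 1) + 2 (x . y) X]
    is expanded in powers of [x . y]. *)
Lemma zonal_kernelE n x y : dot x x = 1 -> dot y y = 1 ->
  \int[sphere_measure]_(s in S) (dot x s ^+ n * dot y s ^+ n) =
  \sum_(j < n.+1) zonal_comp n j * dot x y ^+ j.
Proof.
move=> x1 y1; have := congr1 (fun p : {poly R} => p`_n) (mixed_moments n x1 y1).
rewrite coef_poly coefZ ltnS leq_pmull // (_ : (2 * n - n = n)%N); last by lia.
have C0 : 'C(2 * n, n)%:R != 0 :> R by rewrite pnatr_eq0 -lt0n bin_gt0; lia.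
move=> h; apply: (mulfI C0); rewrite h.
rewrite addrAC exprDn coef_sum mulr_sumr [RHS]mulr_sumr; apply: eq_bigr => j _.
have jn : (j <= n)%N by rewrite -ltnS.
rewrite coefMn exprZn -scalerAr coefZ coefMXn ifF ?ltnNge ?jn // /zonal_comp exprMn -mulr_natl.
move: C0 {h}; move: ('C(2 * n, n)%:R : R) => C C0.
by field; rewrite C0 -natrM nat1r pnatr_eq0.
Qed.

Lemma zonal_form_comp n f : bmeas S f ->
  \int[sphere_measure]_(s in S) (zonal_op n f s ^+ 2) =
  \sum_(j < n.+1) zonal_comp n j * zonal_form j f f.
Proof.
move=> bf; have bT := bmeas_zonal_op n bf.
transitivity (zonal_form n (zonal_op n f) f).
  by rewrite zonal_formC // /zonal_form; apply: eq_Rintegral => s _; rewrite expr2.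
rewrite /zonal_form; under [RHS]eq_bigr => j _.
  rewrite -bintZ //; last by apply: bmeasM => //; exact: bmeas_zonal_op.
  over.
rewrite -bint_sum //; last first.
  by move=> j; apply: bmeasZ; apply: bmeasM => //; exact: bmeas_zonal_op.
apply: eq_Rintegral => s; rewrite inE => /sphereP s1.
under [RHS]eq_bigr do rewrite mulrA.
rewrite -mulr_suml; congr (_ * _).
have bd := bmeas_dotX s n.
(* Symmetry of [zonal_form], an identity of finite sums, does the work of exchanging two integrals
   over the sphere. *)
have -> : zonal_op n (zonal_op n f) s = zonal_form n f (fun y => dot s y ^+ n).
  by apply: eq_Rintegral => y _; rewrite mulrC.
rewrite zonal_formC // /zonal_form.
under [RHS]eq_bigr => j _.
  rewrite -bintZ //; last by apply: bmeasM => //; exact: bmeas_dotX.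
  over.
rewrite -bint_sum //; last first.
  by move=> j; apply: bmeasZ; apply: bmeasM => //; exact: bmeas_dotX.
apply: eq_Rintegral => y; rewrite inE => /sphereP y1.
under [RHS]eq_bigr do rewrite mulrA.
rewrite -mulr_suml -zonal_kernelE //; congr (_ * _).
by apply: eq_Rintegral => z _; rewrite mulrC.
Qed.

(** The decomposition of [T_n^2] is applied to [(e . y)^(n mod 2)] and evaluated at [e]. Every [j]
    with a nonzero coefficient has the parity of [n], hence the same eigenfunction. *)
Lemma zonal_eigen_comp n :
  \sum_(j < n.+1) zonal_comp n j * zonal_eigen j = zonal_eigen n ^+ 2.
Proof.
pose e : 'rV[R]_3 := delta_mx ord0 ord0.
have e1 : dot e e = 1 by rewrite dotE3 !mxE /=; lra.
pose h y := dot e y ^+ odd n.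
have bh : bmeas S h by exact: bmeas_dotX.
transitivity (zonal_op n (zonal_op n h) e); last first.
  have -> : zonal_op n (zonal_op n h) e = zonal_op n (fun y => zonal_eigen n * h y) e.
    by apply: eq_Rintegral => y; rewrite inE => /sphereP y1; rewrite (zonal_op_eigen n e1 y1).
  rewrite /zonal_op; under eq_Rintegral do rewrite mulrCA.
  rewrite bintZ //; last by apply: bmeasM => //; exact: bmeas_dotX.
  by rewrite -/(zonal_op n h e) zonal_op_eigen // e1 expr1n mulr1 expr2.
have bd := bmeas_dotX e n.
have -> : zonal_op n (zonal_op n h) e = zonal_form n h (fun y => dot e y ^+ n).
  by apply: eq_Rintegral => y _; rewrite mulrC.
rewrite zonal_formC // /zonal_form.
transitivity (\sum_(j < n.+1) zonal_comp n j * zonal_op j h e).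
  apply: eq_bigr => j _; have jn : (j <= n)%N by rewrite -ltnS.
  have [jo|jo] := eqVneq (odd j) (odd n); last by rewrite zonal_comp_parity // !mul0r.
  by rewrite /h -jo zonal_op_eigen // e1 expr1n mulr1.
under eq_bigr => j _.
  rewrite -bintZ //; last by apply: bmeasM => //; exact: bmeas_dotX.
  over.
rewrite -bint_sum //; last first.
  by move=> j; apply: bmeasZ; apply: bmeasM => //; exact: bmeas_dotX.
apply: eq_Rintegral => y; rewrite inE => /sphereP y1.
under eq_bigr do rewrite mulrA.
rewrite -mulr_suml -zonal_kernelE //; congr (_ * _).
by apply: eq_Rintegral => z _; rewrite mulrC.
Qed.

Lemma sqnorm_ge0 f : 0 <= sqnorm f.
Proof. by apply: Rintegral_ge0 => s _; exact: sqr_ge0. Qed.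

(* With T the operator with kernel t^n, <Tf, f>^2 <= <T^2 f, f> |f|^2, and T^2 is
   a combination with nonnegative coefficients of operators of degree j <= n. *)
Theorem zonal_form_le n f : bmeas S f -> zonal_form n f f <= zonal_eigen n * sqnorm f.
Proof.
move=> bf; elim/ltn_ind: n => n IH.
set x := zonal_form n f f; set N := sqnorm f; set L := zonal_eigen n.
have N0 : 0 <= N by exact: sqnorm_ge0.
have L0 : 0 < L by exact: zonal_eigen_gt0.
have x0 : 0 <= x by exact: zonal_form_ge0.
have CS : x ^+ 2 <= (\sum_(j < n.+1) zonal_comp n j * zonal_form j f f) * N.
  rewrite -zonal_form_comp //; apply: bint_CS => //; exact: bmeas_zonal_op.
(* The term [j = n] involves [x] itself and escapes the induction hypothesis; it is split off on
   both sides. *)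
set k := zonal_comp n n; have k0 : 0 <= k by exact: zonal_comp_ge0.
have hs := zonal_eigen_comp n; rewrite big_ord_recr /= -/k -/L in hs.
rewrite big_ord_recr /= -/k -/x in CS.
set sE := \sum_(i < n) _ in hs; set sF := \sum_(i < n) _ in CS.
have sFE : sF <= sE * N.
  rewrite mulr_suml; apply: ler_sum => j _; rewrite -mulrA.
  by rewrite ler_wpM2l ?zonal_comp_ge0 // IH.
have sE0 : 0 <= sE.
  by apply: sumr_ge0 => j _; rewrite mulr_ge0 ?zonal_comp_ge0 // ltW ?zonal_eigen_gt0.
have kL : k <= L by rewrite -(ler_pM2r L0) -expr2 -hs lerDr.
rewrite leNgt; apply/negP => Lx.
have h1 : x ^+ 2 <= (L ^+ 2 - k * L) * N * N + k * x * N.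
  apply: le_trans CS _; rewrite mulrDl lerD2r ler_wpM2r // (le_trans sFE) //.
  by rewrite -hs; lra.
(* This product is [x^2 - k x N - (L^2 - k L) N^2], which [h1] says is at most 0. The second factor
   is positive because [k <= L]. *)
have h2 : 0 < (x - L * N) * (x + L * N - k * N).
  apply: mulr_gt0; first by rewrite subr_gt0.
  have : k * N <= L * N by rewrite ler_wpM2r.
  have : 0 <= L * N by rewrite mulr_ge0 // ltW.
  by lra.
lra.
Qed.

End zonal.

(** * The scattering operator *)

Section binomial_series.
Context {R : realType}.
Implicit Types (t x : R).

(* The Taylor coefficients of (1 - t)^(-3/2); a partial sum fails to solve the
   differential equation (1 - t) y' = 3/2 y by one monomial only. *)
Fixpoint binc n : R := if n is k.+1 then binc k * (k%:R + 3 / 2) / k.+1%:R else 1.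

Definition binsum N t : R := \sum_(n < N) binc n * t ^+ n.

Lemma binc_ge0 n : 0 <= binc n.
Proof. by elim: n => //= n IH; rewrite divr_ge0 // mulr_ge0 // addr_ge0 // divr_ge0. Qed.

Lemma binc_le n : binc n <= n.+1%:R.
Proof.
elim: n => //= n IH; rewrite ler_pdivrMr ?ltr0n //.
have n0 : 0 <= n%:R :> R by [].
apply: le_trans (_ : n.+1%:R * (n%:R + 3 / 2) <= _).
  by rewrite ler_wpM2r // addr_ge0 // divr_ge0.
rewrite mulrC ler_wpM2r // -(natr1 n.+1) -(natr1 n); lra.
Qed.

Lemma binsumS N t : binsum N.+1 t = binsum N t + binc N * t ^+ N.
Proof. by rewrite /binsum big_ord_recr. Qed.

Lemma is_derive_binsum N t :
  is_derive t 1 (binsum N) (\sum_(n < N) binc n * (n%:R * t ^+ n.-1)).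
Proof.
elim: N => [|N IH].
  rewrite big_ord0 (_ : binsum 0 = cst 0); first exact: is_derive_cst.
  by apply/funext => x; rewrite /binsum big_ord0.
rewrite big_ord_recr (_ : binsum N.+1 = binsum N + binc N *: (@id R ^+ N)); last first.
  by apply/funext => x; rewrite /binsum big_ord_recr addrfctE scalrfctE exprfctE.
have h := is_deriveD IH (is_deriveZ (binc N) (is_deriveX N (is_derive_id t (1 : R)))).
by apply: (is_derive_eq h); rewrite /GRing.scale /= mulr1.
Qed.

Lemma binsum_ode N t :
  (1 - t) * (\sum_(n < N.+1) binc n * (n%:R * t ^+ n.-1)) =
  3 / 2 * binsum N.+1 t - (N%:R + 3 / 2) * binc N * t ^+ N.
Proof.
elim: N => [|N IH]; first by rewrite /binsum !big_ord_recr !big_ord0 /= !expr0; ring.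
rewrite (binsumS N.+1) big_ord_recr mulrDr IH.
have e : N.+1%:R * binc N.+1 = (N%:R + 3 / 2) * binc N.
  by rewrite /= mulrC divfK ?pnatr_eq0 // mulrC.
have -> : (1 - t) * (binc N.+1 * (N.+1%:R * t ^+ N.+1.-1)) =
    (N.+1%:R * binc N.+1) * (t ^+ N - t ^+ N.+1) by rewrite exprS /=; ring.
rewrite -e; move: (binc N.+1) (binsum N.+1 t) (t ^+ N.+1) (t ^+ N) (N.+1%:R : R) => b' B T T' n'.
ring.
Qed.

Let w t := Num.sqrt (1 - t).

Lemma is_derive_sqrt_sub t : t < 1 -> is_derive t 1 w (- (2 * w t)^-1).
Proof.
move=> t1; have t0 : 0 < 1 - t by rewrite subr_gt0.
have h1 := is_deriveB (is_derive_cst (1 : R) t (1 : R)) (is_derive_id t (1 : R)).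
have h2 := is_derive1_sqrt t0.
have := @is_derive1_comp R Num.sqrt (cst 1 - id) t _ _ h2 h1.
by rewrite sub0r mulrN1.
Qed.

(** For the full series the product with [(1 - t)^(3/2)] would be the constant 1. For a partial sum,
    [binsum_ode] leaves one monomial in the derivative. *)
Lemma is_derive_binsum_error N t : t < 1 ->
  is_derive t 1 (fun t => w t ^+ 3 * binsum N.+1 t)
    (- (w t * (N%:R + 3 / 2) * binc N * t ^+ N)).
Proof.
move=> t1; have t0 : 0 < 1 - t by rewrite subr_gt0.
have w0 : w t != 0 by rewrite gt_eqF // sqrtr_gt0.
have w2 : w t ^+ 2 = 1 - t by rewrite sqr_sqrtr // ltW.
have -> : (fun t => w t ^+ 3 * binsum N.+1 t) = w ^+ 3 * binsum N.+1.
  by apply/funext => x; rewrite mulrfctE exprfctE.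
have h := is_deriveM (is_deriveX 3 (is_derive_sqrt_sub t1)) (is_derive_binsum N.+1 t).
apply: (is_derive_eq h); rewrite exprfctE /GRing.scale /=.
set D := \sum_(n < N.+1) _.
have -> : w t ^+ 3 * D = w t * ((1 - t) * D) by rewrite -w2; ring.
rewrite binsum_ode; field.
by rewrite w0.
Qed.

(** The product is 1 at 0, so the mean value theorem between 0 and [t] bounds the deviation by its
    derivative. The leading 2 is a crude bound for [sqrt (1 - c)]. *)
Lemma binsum_error N t : `|t| < 1 ->
  `|w t ^+ 3 * binsum N.+1 t - 1| <= 2 * (N%:R + 3 / 2) * binc N * `|t| ^+ N.
Proof.
move=> t1; pose F t := w t ^+ 3 * binsum N.+1 t.
have F0 : F 0 = 1.
  rewrite /F /w subr0 sqrtr1 expr1n mul1r.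
  by elim: (N) => [|n IH]; rewrite binsumS; [rewrite /binsum big_ord0 add0r mul1r | rewrite IH expr0n mulr0 addr0].
pose dF t := - (w t * (N%:R + 3 / 2) * binc N * t ^+ N).
have dFP x : x < 1 -> is_derive x 1 F (dF x) by exact: is_derive_binsum_error.
have cF x : x < 1 -> {for x, continuous F}.
  by move=> /dFP dFx; apply/differentiable_continuous/derivable1_diffP.
have cFw a b : b < 1 -> {within `[a, b], continuous F}.
  move=> b1; apply: continuous_in_subspaceT => x; rewrite inE /= in_itv /= => /andP[_ xb].
  by apply: cF; exact: le_lt_trans b1.
have bd c : `|c| <= `|t| -> `|dF c * t| <= 2 * (N%:R + 3 / 2) * binc N * `|t| ^+ N.
  move=> ct; rewrite normrM normrN !normrM normrX.
  have n0 : 0 <= N%:R + 3 / 2 :> R by rewrite addr_ge0 // divr_ge0.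
  rewrite (ger0_norm (sqrtr_ge0 _)) (ger0_norm n0) (ger0_norm (binc_ge0 N)).
  have w2 : w c <= 2.
    rewrite -[X in _ <= X]ger0_norm // -sqrtr_sqr ler_wsqrtr //.
    by have := ler_norm (- c); rewrite normrN; lra.
  apply: (@le_trans _ _ (2 * (N%:R + 3 / 2) * binc N * `|t| ^+ N * `|t|)).
    rewrite ler_wpM2r // ler_pM //; last by rewrite lerXn2r.
      by rewrite !mulr_ge0 ?binc_ge0 // sqrtr_ge0.
    by rewrite !ler_wpM2r // ?binc_ge0.
  by rewrite ler_piMr ?(ltW t1) // !mulr_ge0 ?binc_ge0 ?exprn_ge0.
rewrite -/(F t) -[X in _ - X]F0; have [t0|t0|->] := ltgtP t 0.
- have dF' x : x \in `]t, 0[ -> is_derive x 1 F (dF x).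
    by rewrite in_itv /= => /andP[_ x0]; apply: dFP; exact: lt_trans x0 ltr01.
  have [c] := MVT t0 dF' (cFw _ _ ltr01).
  rewrite in_itv /= sub0r => /andP[tc c0] e.
  rewrite distrC e mulrN normrN; apply: bd; rewrite !ltr0_norm //; lra.
- have t1' : t < 1 by rewrite (le_lt_trans (ler_norm _)).
  have dF' x : x \in `]0, t[ -> is_derive x 1 F (dF x).
    by rewrite in_itv /= => /andP[_ xt]; apply: dFP; exact: lt_trans xt t1'.
  have [c] := MVT t0 dF' (cFw _ _ t1').
  rewrite in_itv /= subr0 => /andP[c0 ct] e.
  rewrite e; apply: bd; rewrite !gtr0_norm //; lra.
- rewrite subrr normr0 !mulr_ge0 ?binc_ge0 ?exprn_ge0 ?addr_ge0 //.
Qed.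

Lemma bernoulli_exprn (d : R) n : 0 <= d -> 1 + n%:R * d <= (1 + d) ^+ n.
Proof.
move=> d0; elim: n => [|n IH]; first by rewrite mul0r addr0.
rewrite exprS; apply: le_trans (ler_wpM2l _ IH); last by rewrite addr_ge0.
rewrite -(natr1 n); have : 0 <= n%:R * d * d by rewrite !mulr_ge0.
lra.
Qed.

(** Writing [1 / y = 1 + d], Bernoulli's inequality gives [n d y^n <= 1], whence the bound
    [1 / d]. *)
Lemma natr_mul_expr_bounded (y : R) : 0 <= y < 1 -> exists C, 0 < C /\ forall n, n%:R * y ^+ n <= C.
Proof.
move=> /andP[y0 y1]; have [->|yn0] := eqVneq y 0.
  exists 1; split => // -[|n]; first by rewrite mul0r.
  by rewrite exprS mul0r mulr0.
have yp : 0 < y by rewrite lt0r yn0.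
pose d := y^-1 - 1; have d0 : 0 < d by rewrite subr_gt0 invf_gt1.
exists d^-1; split; first by rewrite invr_gt0.
move=> n; have := bernoulli_exprn n (ltW d0).
have -> : 1 + d = y^-1 by rewrite /d; lra.
rewrite exprVn => h; have yn : 0 < y ^+ n by rewrite exprn_gt0.
rewrite -(ler_pM2r yn) mulVf ?gt_eqF // in h.
rewrite -(ler_pM2r d0) mulVf ?gt_eqF //.
apply: le_trans h; rewrite mulrDl mul1r; have := ltW yn; lra.
Qed.

(** The mean [y] of [x, 1, 1] satisfies [x <= y^3]. Hence [N^3 x^N] is at most [(N y^N)^3], which is
    bounded, and a large [N] makes [N^2 x^N] small. The 10 comes from
    [2 (N + 3/2) (N + 1) <= 10 N^2] for [N >= 1]. *)
Lemma quadratic_mul_expr_small (x e : R) : 0 <= x < 1 -> 0 < e ->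
  exists N, 2 * (N%:R + 3 / 2) * N.+1%:R * x ^+ N <= e.
Proof.
move=> /andP[x0 x1] e0; pose y := (x + 2) / 3.
have y01 : 0 <= y < 1 by apply/andP; split; rewrite /y; lra.
have xy : x <= y ^+ 3.
  have -> : y ^+ 3 = x + ((x - 1) ^+ 2 * (x + 8)) / 27 by rewrite /y; field.
  by rewrite lerDl divr_ge0 // mulr_ge0 ?sqr_ge0 //; lra.
have [C [C0 hC]] := natr_mul_expr_bounded y01.
have y0 : 0 <= y by case/andP: y01.
pose N := (Num.truncn (10 * C ^+ 3 / e)).+1.
have N0 : 0 < N%:R :> R by rewrite ltr0n.
have N1 : 1 <= N%:R :> R by rewrite ler1n.
have hN : 10 * C ^+ 3 / e < N%:R by exact: truncnS_gt.
exists N.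
have h1 : 2 * (N%:R + 3 / 2) * N.+1%:R <= 10 * N%:R ^+ 2 :> R.
  have -> : N.+1%:R = N%:R + 1 :> R by rewrite natr1.
  by move: (N%:R : R) N1 => z z1; nra.
apply: (@le_trans _ _ (10 * N%:R ^+ 2 * (y ^+ 3) ^+ N)).
  by apply: ler_pM => //; rewrite ?mulr_ge0 ?exprn_ge0 ?addr_ge0 // lerXn2r // nnegrE exprn_ge0.
rewrite -(ler_pM2r N0).
have -> : 10 * N%:R ^+ 2 * (y ^+ 3) ^+ N * N%:R = 10 * (N%:R * y ^+ N) ^+ 3.
  have -> : (y ^+ 3) ^+ N = (y ^+ N) ^+ 3 by rewrite -!exprM mulnC.
  by ring.
apply: (@le_trans _ _ (10 * C ^+ 3)).
  rewrite ler_wpM2l // lerXn2r // nnegrE ?mulr_ge0 ?exprn_ge0 //; exact: ltW.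
by move: hN; rewrite ltr_pdivrMr // (mulrC _ e) => /ltW.
Qed.

End binomial_series.

(** * Expansion of the Henyey-Greenstein kernel *)

Section henyey_greenstein.
Context {R : realType}.
Variable g : R.
Hypothesis g01 : 0 <= g < 1.
Let g0 : 0 <= g. Proof. by case/andP: g01. Qed.
Let g1 : g < 1. Proof. by case/andP: g01. Qed.

Lemma HG_denom_gt0 (t : R) : `|t| <= 1 -> 0 < 1 - 2 * g * t + g ^+ 2.
Proof.
rewrite ler_norml => /andP[t1 t2].
have -> : 1 - 2 * g * t + g ^+ 2 = (1 - g) ^+ 2 + 2 * g * (1 - t) by ring.
by rewrite ltr_pwDl ?exprn_gt0 ?subr_gt0 // !mulr_ge0 // subr_ge0.
Qed.

Lemma powR_three_halves (x : R) : 0 <= x -> x `^ (3 / 2) = Num.sqrt x ^+ 3.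
Proof.
by move=> x0; rewrite mulrC powRrM powR12_sqrt // powR_mulrn // sqrtr_ge0.
Qed.

Lemma HG_kernelE (t : R) : `|t| <= 1 ->
  HG_kernel g t = (4 * pi)^-1 * ((1 - g ^+ 2) / Num.sqrt (1 - 2 * g * t + g ^+ 2) ^+ 3).
Proof. by move=> t1; rewrite /HG_kernel powR_three_halves // ltW // HG_denom_gt0. Qed.

Let q : R := 1 + g ^+ 2.
Let q0 : 0 < q. Proof. by rewrite ltr_pwDl // sqr_ge0. Qed.
Let C : R := (4 * pi)^-1 * ((1 - g ^+ 2) / Num.sqrt q ^+ 3).
Let C0 : 0 <= C.
Proof.
apply: mulr_ge0; first by rewrite invr_ge0 mulr_ge0 ?pi_ge0.
apply: divr_ge0; last by rewrite exprn_ge0 // sqrtr_ge0.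
by rewrite subr_ge0 exprn_ile1 // ltW.
Qed.

(* 1 - 2 g t + g^2 = q (1 - (2 g / q) t), with 2 g / q < 1 on account of g < 1. *)
Definition HG_coef n : R := C * binc n * (2 * g / q) ^+ n.

Lemma HG_coef_ge0 n : 0 <= HG_coef n.
Proof.
apply: mulr_ge0; first by apply: mulr_ge0 => //; exact: binc_ge0.
by apply/exprn_ge0/divr_ge0; [exact: mulr_ge0 | exact: ltW].
Qed.

(** The kernel is [C / w^3] with [w = sqrt (1 - r t)], and its error is [C / w^3] times the
    deviation in [binsum_error]. As [r < 1], both are uniform on [|t| <= 1], and the approximating
    coefficients are nonnegative. *)
Lemma HG_kernel_approx e : 0 < e -> exists N, forall t, `|t| <= 1 ->
  `|HG_kernel g t - \sum_(n < N) HG_coef n * t ^+ n| <= e.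
Proof.
move=> e0; pose r := 2 * g / q.
have r0 : 0 <= r by rewrite divr_ge0 ?mulr_ge0 // ltW.
have r1 : r < 1.
  rewrite ltr_pdivrMr // mul1r /q -subr_gt0.
  have -> : 1 + g ^+ 2 - 2 * g = (1 - g) ^+ 2 by ring.
  by rewrite exprn_gt0 // subr_gt0.
pose w0 := Num.sqrt (1 - r); have w0p : 0 < w0 by rewrite sqrtr_gt0 subr_gt0.
(* The added 1 makes the bound positive, so that the tolerance can be divided by it. *)
pose C' := C / w0 ^+ 3 + 1.
have C'0 : 0 < C' by rewrite ltr_wpDl // divr_ge0 // exprn_ge0 // ltW.
have eC : 0 < e / C' by exact: divr_gt0.
have r01 : 0 <= r < 1 by rewrite r0.
have qr : q * r = 2 * g by rewrite /r mulrC divfK ?gt_eqF.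
have [N hN] := quadratic_mul_expr_small r01 eC.
exists N.+1 => t t1; have tau1 : `|r * t| <= r.
  by rewrite normrM (ger0_norm r0) ler_piMr.
have tau2 : `|r * t| < 1 by exact: le_lt_trans r1.
pose w := Num.sqrt (1 - r * t).
have wp : 0 < w by rewrite sqrtr_gt0 subr_gt0 (le_lt_trans (ler_norm _)).
have w0w : w0 <= w.
  by rewrite ler_wsqrtr // lerB // (le_trans (ler_norm _)).
have -> : HG_kernel g t = C / w ^+ 3.
  rewrite HG_kernelE // /C /w.
  have -> : 1 - 2 * g * t + g ^+ 2 = q * (1 - r * t).
    rewrite mulrBr mulr1 (mulrA q) qr /q; ring.
  by rewrite sqrtrM ?ltW // exprMn (invfM (_ ^+ 3)) !mulrA.
have -> : \sum_(n < N.+1) HG_coef n * t ^+ n = C * binsum N.+1 (r * t).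
  by rewrite /binsum mulr_sumr; apply: eq_bigr => n _; rewrite /HG_coef -/r (exprMn _ r) !mulrA.
have -> : C / w ^+ 3 - C * binsum N.+1 (r * t) =
    - ((C / w ^+ 3) * (w ^+ 3 * binsum N.+1 (r * t) - 1)).
  by field; rewrite gt_eqF.
rewrite normrN normrM.
have Cw : `|C / w ^+ 3| <= C'.
  rewrite ger0_norm; last by rewrite divr_ge0 // exprn_ge0 // ltW.
  apply: (@le_trans _ _ (C / w0 ^+ 3)); last by rewrite lerDl.
  rewrite ler_wpM2l // lef_pV2 ?posrE ?exprn_gt0 // lerXn2r // nnegrE; exact: ltW.
apply: (@le_trans _ _ (C' * (e / C'))); last by rewrite mulrCA divff ?mulr1 // gt_eqF.
apply: ler_pM => //; apply: le_trans (binsum_error N tau2) _; apply: le_trans hN.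
apply: ler_pM; rewrite ?mulr_ge0 ?binc_ge0 ?exprn_ge0 ?addr_ge0 //.
  by rewrite ler_wpM2l ?binc_le // mulr_ge0 // addr_ge0.
by rewrite lerXn2r // nnegrE.
Qed.

End henyey_greenstein.

(** Serves to transfer measurability and boundedness from the polynomial approximations to the
    kernel and to the scattering operator. *)
Lemma bmeas_uniform_limit d (T : measurableType d) (R : realType) (D : set T)
    (f : T -> R) :
  (forall e, 0 < e -> exists2 h, bmeas D h & forall x, D x -> `|f x - h x| <= e) ->
  bmeas D f.
Proof.
move=> H; split; last first.
  have [h [_ [M hM]] fh] := H 1 ltr01; exists (1 + M) => x Dx.
  by rewrite -(subrK (h x) (f x)) (le_trans (ler_normD _ _)) // lerD ?fh ?hM.
have /choice[h hP] : forall n : nat, exists h, bmeas D h /\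
    forall x, D x -> `|f x - h x| <= n.+1%:R^-1.
  by move=> n; have [|h bh fh] := H n.+1%:R^-1; [rewrite invr_gt0 ltr0n | exists h].
apply: (@measurable_fun_cvg _ _ _ _ h) => [n|x Dx]; first by case: (hP n) => -[].
apply/cvgrPdist_le => e e0.
have /cvgrPdist_le/(_ _ e0) := @cvg_harmonic R.
apply: filterS => n; rewrite sub0r normrN => hn.
by rewrite (le_trans ((hP n).2 x Dx)) // (le_trans _ hn) // ler_norm.
Qed.

Section scattering_on_sphere.
Context {R : realType}.
Variable g : R.
Hypothesis g01 : 0 <= g < 1.
Implicit Types (s y : 'rV[R]_3) (f h : 'rV[R]_3 -> R).
Local Notation S := (@sphere R).
Local Notation mu := (@lebesgue_measure R).
Local Notation a := (HG_coef g).

Let mS := @measurable_sphere R.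
Let finS := sphere_measure_fin mS.
Let vol : R := fine (sphere_measure S).

Lemma dot_sphere_le1 s y : S s -> S y -> `|dot s y| <= 1.
Proof.
move=> /sphereP s1 /sphereP y1.
have H e : e ^+ 2 = 1 -> 0 <= 2 + 2 * e * dot s y.
  move=> e1; have -> : 2 + 2 * e * dot s y = dot (s + e *: y) (s + e *: y).
    have -> : dot (s + e *: y) (s + e *: y) = dot s s + 2 * e * dot s y + e ^+ 2 * dot y y.
      by rewrite !dotE3 !mxE; ring.
    by rewrite s1 y1 e1; ring.
  by apply: sumr_ge0 => i _; exact: sqr_ge0.
have h1 := H 1 (expr1n _ _); have h2 := H (-1).
rewrite sqrrN expr1n in h2; have {}h2 := h2 erefl.
by rewrite ler_norml; apply/andP; split; lra.
Qed.

Definition scat f s : R := \int[sphere_measure]_(y in S) (HG_kernel g (dot s y) * f y).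

Definition scat_form f h : R := \int[sphere_measure]_(s in S) (scat f s * h s).

Definition HG_poly N t : R := \sum_(n < N) a n * t ^+ n.

Lemma bmeas_HG_poly N s : bmeas S (fun y => HG_poly N (dot s y)).
Proof. by apply: (@bmeas_sum _ _ _ _ _ _ xpredT) => n _; apply: bmeasZ; exact: bmeas_dotX. Qed.

Lemma bmeas_HG s : S s -> bmeas S (fun y => HG_kernel g (dot s y)).
Proof.
move=> Ss; apply: bmeas_uniform_limit => e e0.
have [N hN] := HG_kernel_approx g01 e0.
by exists (fun y => HG_poly N (dot s y)); [exact: bmeas_HG_poly | move=> y Sy; exact/hN/dot_sphere_le1].
Qed.

Definition scat_approx N f s : R := \sum_(n < N) a n * zonal_op n f s.

Lemma scat_approxE N f s : bmeas S f ->
  scat_approx N f s = \int[sphere_measure]_(y in S) (HG_poly N (dot s y) * f y).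
Proof.
move=> bf; rewrite /scat_approx; under [RHS]eq_Rintegral do rewrite mulr_suml.
rewrite bint_sum // => [|n]; last first.
  by apply: bmeasM => //; apply: bmeasZ; exact: bmeas_dotX.
apply: eq_bigr => n _; rewrite -bintZ //; last by apply: bmeasM => //; exact: bmeas_dotX.
by apply: eq_Rintegral => y _; rewrite mulrA.
Qed.

Lemma bmeas_scat_approx N f : bmeas S f -> bmeas S (scat_approx N f).
Proof.
move=> bf; apply: (@bmeas_sum _ _ _ _ _ _ xpredT) => n _; apply: bmeasZ.
exact: bmeas_zonal_op.
Qed.

Let vol0 : 0 <= vol. Proof. by rewrite /vol fine_ge0. Qed.

Lemma scat_approx_error N f M e s : bmeas S f -> 0 <= M -> 0 <= e ->
  (forall y, S y -> `|f y| <= M) ->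
  (forall t, `|t| <= 1 -> `|HG_kernel g t - HG_poly N t| <= e) -> S s ->
  `|scat f s - scat_approx N f s| <= e * M * vol.
Proof.
move=> bf M0 e0 hM hN Ss; rewrite scat_approxE // /scat -bintB //; last 2 first.
- by apply: bmeasM => //; exact: bmeas_HG.
- by apply: bmeasM => //; exact: bmeas_HG_poly.
have bd y : S y -> `|HG_kernel g (dot s y) * f y - HG_poly N (dot s y) * f y| <= e * M.
  by move=> Sy; rewrite -mulrBl normrM ler_pM //; [exact/hN/dot_sphere_le1 | exact: hM].
apply: (bint_norm_le mS finS _ _ bd); first exact: mulr_ge0.
apply: bmeasB; apply: bmeasM => //; [exact: bmeas_HG | exact: bmeas_HG_poly].
Qed.

Lemma bmeas_bound f : bmeas S f -> exists2 M, 0 <= M & forall y, S y -> `|f y| <= M.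
Proof. by move=> [_ [M hM]]; exists `|M| => // y /hM /le_trans; apply; exact: ler_norm. Qed.

Lemma bmeas_scat f : bmeas S f -> bmeas S (scat f).
Proof.
move=> bf; apply: bmeas_uniform_limit => e e0.
have [M M0 hM] := bmeas_bound bf.
pose C := M * vol + 1; have C0 : 0 < C by rewrite ltr_wpDl // mulr_ge0.
have [N hN] := HG_kernel_approx g01 (divr_gt0 e0 C0).
exists (scat_approx N f) => [|s Ss]; first exact: bmeas_scat_approx.
apply: le_trans (scat_approx_error bf M0 _ hM hN Ss) _; first by rewrite ltW // divr_gt0.
by rewrite -mulrA mulrAC ler_pdivrMr // ler_wpM2l ?(ltW e0) // /C lerDl.
Qed.

(** The constant depends on [f] and [h] but not on [N] or [e], so properties of the zonal forms pass
    to the limit through [small_error]. *)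
Lemma scat_form_error f h : bmeas S f -> bmeas S h ->
  exists2 K, 0 <= K & forall N e, 0 <= e ->
    (forall t, `|t| <= 1 -> `|HG_kernel g t - HG_poly N t| <= e) ->
    `|scat_form f h - \sum_(n < N) a n * zonal_form n f h| <= e * K.
Proof.
move=> bf bh; have [M M0 hM] := bmeas_bound bf; have [L L0 hL] := bmeas_bound bh.
exists (M * vol * L * vol) => [|N e e0 hN]; first by rewrite !mulr_ge0.
have -> : \sum_(n < N) a n * zonal_form n f h =
    \int[sphere_measure]_(s in S) (scat_approx N f s * h s).
  under [RHS]eq_Rintegral do rewrite mulr_suml.
  rewrite bint_sum // => [|n]; last first.
    by apply: bmeasM => //; apply: bmeasZ; exact: bmeas_zonal_op.
  apply: eq_bigr => n _; rewrite -bintZ //; last by apply: bmeasM => //; exact: bmeas_zonal_op.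
  by apply: eq_Rintegral => y _; rewrite mulrA.
have bs := bmeas_scat bf; have ba := bmeas_scat_approx N bf.
rewrite -bintB //; try exact: bmeasM.
have bd s : S s -> `|scat f s * h s - scat_approx N f s * h s| <= e * M * vol * L.
  by move=> Ss; rewrite -mulrBl normrM ler_pM ?hL // scat_approx_error.
apply: le_trans (bint_norm_le mS finS _ _ bd) _.
- by rewrite !mulr_ge0.
- by apply: bmeasB; exact: bmeasM.
- by rewrite -/vol !mulrA.
Qed.

Lemma small_error (x y K : R) : 0 <= K -> (forall e, 0 < e -> x <= y + e * K) -> x <= y.
Proof.
move=> K0 H; apply/ler_addgt0Pr => e e0.
have K1 : 0 < K + 1 by rewrite ltr_wpDl.
apply: le_trans (H _ (divr_gt0 e0 K1)) _; rewrite lerD2l mulrAC ler_pdivrMr //.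
by rewrite ler_wpM2l ?(ltW e0) // lerDl.
Qed.

Lemma scat_form_ge0 f : bmeas S f -> 0 <= scat_form f f.
Proof.
move=> bf; have [K K0 hK] := scat_form_error bf bf.
apply: (small_error K0) => e e0; have [N hN] := HG_kernel_approx g01 e0.
have := hK N e (ltW e0) hN; rewrite ler_norml => /andP[h1 _].
have : 0 <= \sum_(n < N) a n * zonal_form n f f.
  by apply: sumr_ge0 => n _; rewrite mulr_ge0 ?HG_coef_ge0 ?zonal_form_ge0.
lra.
Qed.

Lemma scat_formC f h : bmeas S f -> bmeas S h -> scat_form f h = scat_form h f.
Proof.
suff H f' h' : bmeas S f' -> bmeas S h' -> scat_form f' h' <= scat_form h' f'.
  by move=> bf bh; apply/eqP; rewrite eq_le !H.
move=> bf bh; have [K K0 hK] := scat_form_error bf bh; have [L L0 hL] := scat_form_error bh bf.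
apply: (small_error (addr_ge0 K0 L0)) => e e0; have [N hN] := HG_kernel_approx g01 e0.
have := hK N e (ltW e0) hN; have := hL N e (ltW e0) hN.
rewrite !ler_norml => /andP[h1 _] /andP[_ h2].
have E : \sum_(n < N) a n * zonal_form n f' h' = \sum_(n < N) a n * zonal_form n h' f'.
  by apply: eq_bigr => n _; rewrite zonal_formC.
move: h1 h2; rewrite E; lra.
Qed.

End scattering_on_sphere.

(** * Moments of the kernel on the interval, of degree 0 and 1 *)

Section HG_moments.
Context {R : realType}.
Variable g : R.
Hypothesis g01 : 0 <= g < 1.
Local Notation mu := (@lebesgue_measure R).
Let w (z : R) := Num.sqrt (1 - 2 * g * z + g ^+ 2).

Let D0 z : -1 <= z <= 1 -> 0 < 1 - 2 * g * z + g ^+ 2.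
Proof. by move=> z1; apply: HG_denom_gt0 => //; rewrite ler_norml. Qed.

Let w0 z : -1 <= z <= 1 -> w z != 0.
Proof. by move=> z1; rewrite gt_eqF // sqrtr_gt0 D0. Qed.

Let dw (z : R) : -1 <= z <= 1 -> is_derive z 1 w (- (g / w z)).
Proof.
move=> z1; have h2 := is_derive1_sqrt (D0 z1).
have h1 : is_derive z 1 (fun z => 1 - 2 * g * z + g ^+ 2) (- (2 * g)).
  have h := is_deriveD (is_deriveB (is_derive_cst (1 : R) z (1 : R)) (is_deriveZ (2 * g) (is_derive_id z (1 : R)))) (is_derive_cst (g ^+ 2) z (1 : R)).
  by apply: (is_derive_eq h); rewrite /GRing.scale /=; ring.
have h := @is_derive1_comp R Num.sqrt (fun z => 1 - 2 * g * z + g ^+ 2) z _ _ h2 h1.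
apply: (is_derive_eq h); rewrite -/(w z).
by field; rewrite w0.
Qed.

Let dwV (z : R) : -1 <= z <= 1 -> is_derive z 1 (fun z => (w z)^-1) (g / w z ^+ 3).
Proof.
move=> z1; have h := is_deriveV (w0 z1) (dw z1).
apply: (is_derive_eq h); rewrite /GRing.scale /=.
by field; rewrite w0.
Qed.

Let cont n : {within `[-1, 1], continuous (fun z => (1 - g ^+ 2) / 2 * (z ^+ n / w z ^+ 3))}.
Proof.
apply: continuous_in_subspaceT => z; rewrite inE /= in_itv /= => z1.
have cw : {for z, continuous w}.
  by have dwz := dw z1; apply/differentiable_continuous/derivable1_diffP.
apply: cvgM; first exact: cvg_cst.
apply: cvgM; first exact: exprn_continuous.
apply: cvgV; first by rewrite expf_neq0 // w0.
by apply: (@continuous_comp R R R w (fun u => u ^+ 3)); [exact: cw | exact: exprn_continuous].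
Qed.

Let w1 : w 1 = 1 - g.
Proof.
rewrite /w; have -> : 1 - 2 * g * 1 + g ^+ 2 = (1 - g) ^+ 2 by ring.
by rewrite sqrtr_sqr ger0_norm // subr_ge0 ltW //; case/andP: g01.
Qed.

Let wN1 : w (-1) = 1 + g.
Proof.
rewrite /w; have -> : 1 - 2 * g * (-1) + g ^+ 2 = (1 + g) ^+ 2 by ring.
by rewrite sqrtr_sqr ger0_norm // addr_ge0 //; case/andP: g01.
Qed.

(** From [w' = - g / w] and [(1 / w)' = g / w^3], antiderivatives of [1 / w^3] and [z / w^3] are
    [1 / (g w)] and [z / (g w) + w / g^2]. *)
Lemma HG_interval_moment p : (p < 2)%N ->
  \int[mu]_(z in `[-1, 1]) (2 * pi * (HG_kernel g z * z ^+ p)) = g ^+ p.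
Proof.
move=> p2; have p0 : (pi : R) != 0 by rewrite gt_eqF ?pi_gt0.
have /andP[g0 g1] := g01.
transitivity (\int[mu]_(z in `[-1, 1]) ((1 - g ^+ 2) / 2 * (z ^+ p / w z ^+ 3))).
  apply: eq_Rintegral => z; rewrite inE /= in_itv /= => z1.
  rewrite HG_kernelE //; last by rewrite ler_norml.
  rewrite -/(w z); move: p0 (w0 z1); move: (pi : R) (w z) => P v P0 v0.
  by field; rewrite P0 v0.
have N1 : (-1 : R) < 1 by lra.
(* Those antiderivatives divide by [g]; for [g = 0] the weight [w] is 1 and the integrand a
   monomial. *)
have [g00|gn0] := eqVneq g 0.
  have dF (z : R) : -1 <= z <= 1 -> is_derive z 1 (fun z => z ^+ p.+1 / (2 * p.+1%:R))
      ((1 - g ^+ 2) / 2 * (z ^+ p / w z ^+ 3)).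
    move=> _; have -> : (fun z : R => z ^+ p.+1 / (2 * p.+1%:R)) = (2 * p.+1%:R)^-1 *: (@id R ^+ p.+1).
      by apply/funext => u; rewrite mulrC scalrfctE exprfctE.
    have h := is_deriveZ (2 * p.+1%:R)^-1 (is_deriveX p.+1 (is_derive_id z (1 : R))).
    apply: (is_derive_eq h); rewrite /GRing.scale /= /w g00 expr0n /= mulr0 mul0r subr0 addr0.
    have : p.+1%:R != 0 :> R by rewrite pnatr_eq0.
    rewrite sqrtr1 expr1n; move: (p.+1%:R : R) (z ^+ p) => r t r0.
    by field; rewrite r0.
  rewrite (Rint_FTC N1 (@cont p) dF) g00.
  case: p p2 {dF} => [|[|//]] _; rewrite ?expr0 ?expr1 ?expr2; lra.
have gp : 1 - g != 0 by rewrite subr_eq0 eq_sym lt_eqF.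
have gq : 1 + g != 0 by rewrite gt_eqF // ltr_pwDl.
case: p p2 => [|[|//]] _.
  have dF (z : R) : -1 <= z <= 1 -> is_derive z 1 (fun z => (1 - g ^+ 2) / (2 * g) * (w z)^-1)
      ((1 - g ^+ 2) / 2 * (z ^+ 0 / w z ^+ 3)).
    move=> z1; have h := is_deriveZ ((1 - g ^+ 2) / (2 * g)) (dwV z1).
    apply: (is_derive_eq h); rewrite /GRing.scale /=; field.
    by rewrite gn0 w0.
  rewrite (Rint_FTC N1 (@cont 0%N) dF) w1 wN1 expr0; field.
  by rewrite gn0 gp gq.
have dF (z : R) : -1 <= z <= 1 -> is_derive z 1
    (fun z => (1 - g ^+ 2) / 2 * (g^-1 * (z * (w z)^-1) + (g ^+ 2)^-1 * w z))
    ((1 - g ^+ 2) / 2 * (z ^+ 1 / w z ^+ 3)).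
  move=> z1; have h := is_deriveZ ((1 - g ^+ 2) / 2)
    (is_deriveD (is_deriveZ g^-1 (is_deriveM (is_derive_id z (1 : R)) (dwV z1)))
                (is_deriveZ (g ^+ 2)^-1 (dw z1))).
  apply: (is_derive_eq h); rewrite /GRing.scale /=; field.
  by rewrite gn0 w0.
rewrite (Rint_FTC N1 (@cont 1%N) dF) w1 wN1 expr1; field.
by rewrite gn0 gp gq.
Qed.

End HG_moments.

(** * Sharp bounds of the scattering form on even and odd functions *)

Section scattering_bound.
Context {R : realType}.
Variable g : R.
Hypothesis g01 : 0 <= g < 1.
Local Notation S := (@sphere R).
Local Notation mu := (@lebesgue_measure R).
Local Notation a := (HG_coef g).
Let mS := @measurable_sphere R.
Let finS := sphere_measure_fin mS.
Let e3 : 'rV[R]_3 := delta_mx ord0 2%:R.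
Let e31 : dot e3 e3 = 1. Proof. by rewrite dotE3 !mxE /=; lra. Qed.

Let bmeas_HG_itv : bmeas (T := measurableTypeR R) `[-1, 1]%classic (HG_kernel g).
Proof.
apply: bmeas_uniform_limit => e e0; have [N hN] := HG_kernel_approx g01 e0.
exists (HG_poly g N); last by move=> z /=; rewrite in_itv /= => z1; apply: hN; rewrite ler_norml.
apply: (@bmeas_sum _ _ _ _ _ _ xpredT) => n _; apply: bmeasZ; apply: bmeasX.
apply: bmeas_continuous_itv; apply: continuous_subspaceT => z; exact: cvg_id.
Qed.

(** At the pole [e3] the kernel depends on the height alone, so the longitude contributes [2 pi] and
    the interval moments remain. *)
Lemma HG_sphere_moment p : (p < 2)%N -> scat g (fun y => dot e3 y ^+ p) e3 = g ^+ p.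
Proof.
move=> p2; have Se3 : S e3 by apply/sphereP.
rewrite /scat sphere_integralE; last by apply: bmeasM; [exact: bmeas_HG | exact: bmeas_dotX].
have mI := @measurable_itv R `[-1, 1]; have mJ := @measurable_itv R `[0, 2 * pi].
have bF : bmeas (T := measurableTypeR R) `[-1, 1]%classic (fun z => HG_kernel g z * z ^+ p).
  apply: bmeasM => //; apply: bmeasX; apply: bmeas_continuous_itv.
  by apply: continuous_subspaceT => z; exact: cvg_id.
have b1 : bmeas (T := measurableTypeR R) `[0, 2 * pi]%classic (fun=> 1 : R) by exact: bmeas_cst.
transitivity (\int[(mu \x mu)%E]_(y in sphere_param_domain) (HG_kernel g y.1 * y.1 ^+ p * 1)).
  apply: eq_Rintegral => y _.
  have -> : dot e3 (sphere_param y) = y.1 by rewrite dotE3 !mxE /=; ring.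
  by rewrite mulr1.
rewrite (@bint_prod _ _ (measurableTypeR R) (measurableTypeR R) R mu mu _ _ mI mJ (itv_fin _ _) (itv_fin _ _) _ _ bF b1).
have -> : \int[mu]_(y in `[0, 2 * pi]) (1 : R) = 2 * pi.
  by have := circle_moment0 (1 : R) 0; rewrite /circle_moment; under eq_Rintegral do rewrite expr0.
by rewrite -(HG_interval_moment g01 p2) bintZ // ?itv_fin // mulrC.
Qed.

(** Terms of the wrong parity vanish on [f]; the others are bounded by [zonal_form_le]. The
    resulting sum of [a_n lambda_n] approximates the eigenvalue [g^p] of the scattering operator
    itself. *)
Theorem scat_form_le f p : (p < 2)%N -> bmeas S f ->
  (forall s, f (- s) = (-1) ^+ p * f s) -> scat_form g f f <= g ^+ p * sqnorm f.
Proof.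
move=> p2 bf fp; have [K K0 hK] := scat_form_error g01 bf bf.
pose vol := fine (sphere_measure S : \bar R).
have vol0 : 0 <= vol by rewrite /vol fine_ge0.
have sq0 := sqnorm_ge0 f; have op : nat_of_bool (odd p) = p by case: p p2 {fp} => [|[|//]].
have LK : 0 <= vol * sqnorm f + K by rewrite addr_ge0 // mulr_ge0.
apply: (small_error LK) => e e0; have [N hN] := HG_kernel_approx g01 e0.
have := hK N e (ltW e0) hN; rewrite ler_norml => /andP[_ h1].
have Se3 : S e3 by apply/sphereP.
(* The approximate operator at [e3], applied to the eigenfunction [(e3 . y)^p], is this sum; the
   exact operator gives [g^p], and the two differ by at most [e * vol]. *)
have h2 : \sum_(n < N | odd n == odd p) a n * zonal_eigen n <= g ^+ p + e * vol.
  have bd : bmeas S (fun y => dot e3 y ^+ p) by exact: bmeas_dotX.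
  have b1 y : S y -> `|dot e3 y ^+ p| <= 1.
    by move=> Sy; rewrite normrX exprn_ile1 // dot_sphere_le1.
  have := scat_approx_error g01 bd ler01 (ltW e0) b1 hN Se3.
  rewrite HG_sphere_moment // mulr1 -/vol /scat_approx => h.
  have E : \sum_(n < N) a n * zonal_op n (fun y => dot e3 y ^+ p) e3 =
      \sum_(n < N | odd n == odd p) a n * zonal_eigen n.
    rewrite [LHS](bigID (fun n : 'I_N => odd n == odd p)) /= [X in _ + X]big1 ?addr0; last first.
      move=> n np; rewrite (zonal_op_parity bd _ np) ?mulr0 // => s.
      have -> : dot e3 (- s) = - dot e3 s by rewrite !dotE3 !mxE; ring.
      by rewrite (exprNn (dot e3 s)).
    apply: eq_bigr => n /eqP np; congr (_ * _).
    by rewrite -op -np zonal_op_eigen // e31 expr1n mulr1.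
  by move: h; rewrite E ler_norml => /andP[h _]; lra.
have h3 : \sum_(n < N) a n * zonal_form n f f <= (g ^+ p + e * vol) * sqnorm f.
  apply: le_trans (ler_wpM2r sq0 h2).
  rewrite (bigID (fun n : 'I_N => odd n == odd p)) /= [X in _ + X]big1 ?addr0; last first.
    move=> n np; rewrite /zonal_form; under eq_Rintegral do rewrite (zonal_op_parity bf fp np) mul0r.
    by rewrite Rintegral_cst // mul0r mulr0.
  rewrite mulr_suml; apply: ler_sum => n _.
  by rewrite -[X in _ <= X]mulrA ler_wpM2l ?HG_coef_ge0 // zonal_form_le.
by lra.
Qed.

End scattering_bound.

(** * Meshes and finite element bases *)

Section dual_basis.
Context {R : realType}.

Lemma dotZr n (x y : 'rV[R]_n) a : dot x (a *: y) = a * dot x y.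
Proof. by rewrite /dot mulr_sumr; apply: eq_bigr => i _; rewrite mxE mulrCA. Qed.

Lemma dot_sumr n I (r : seq I) (P : pred I) (x : 'rV[R]_n) (y : I -> 'rV[R]_n) :
  dot x (\sum_(i <- r | P i) y i) = \sum_(i <- r | P i) dot x (y i).
Proof.
rewrite /dot exchange_big /=; apply: eq_bigr => i _.
by rewrite summxE mulr_sumr.
Qed.

(** As many independent vectors as the dimension form an invertible matrix; the coordinate
    functionals are the columns of its inverse. *)
Lemma dual_basis n nv (q : 'I_nv -> 'rV[R]_n) (A : {set 'I_nv}) :
  #|A| = n ->
  (forall w : 'I_nv -> R, \sum_(v in A) w v *: q v = 0 -> forall v, v \in A -> w v = 0) ->
  exists al : 'I_nv -> 'rV[R]_n,
    (forall x, x = \sum_(v in A) dot (al v) x *: q v) /\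
    (forall (w : 'I_nv -> R) v, v \in A -> dot (al v) (\sum_(u in A) w u *: q u) = w v).
Proof.
move=> cA; subst n => free; pose Q : 'M[R]_#|A| := \matrix_(i < #|A|) q (enum_val i).
have sumQ (y : 'rV[R]_#|A|) : y *m Q = \sum_(i < #|A|) y ord0 i *: q (enum_val i).
  by rewrite mulmx_sum_row; apply: eq_bigr => i _; rewrite rowK.
have sumA (w : 'I_nv -> R) : \sum_(u in A) w u *: q u = (\row_i w (enum_val i)) *m Q.
  by rewrite sumQ big_enum_val; apply: eq_bigr => i _; rewrite mxE.
have ev (v : 'I_nv) (y : 'I_#|A| -> R) i0 : enum_val i0 = v ->
    \sum_(i < #|A| | enum_val i == v) y i = y i0.
  move=> <-; rewrite (big_pred1 i0) // => i.
  by rewrite /= (inj_eq enum_val_inj).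
have uQ : Q \in unitmx.
  rewrite -row_free_unit -kermx_eq0; apply/eqP/row_matrixP => k; rewrite row0.
  set y := row k _; have yQ : y *m Q = 0 by apply/sub_kermxP; exact: row_sub.
  pose w v := \sum_(i < #|A| | enum_val i == v) y ord0 i.
  have w0 : \sum_(u in A) w u *: q u = 0.
    rewrite sumA -yQ; congr (_ *m _); apply/rowP => i; rewrite mxE /w.
    exact: (ev _ (fun i => y ord0 i)).
  apply/rowP => i; rewrite [RHS]mxE -(free w w0 (enum_val i) (enum_valP i)).
  by rewrite /w (ev _ (fun i => y ord0 i) i).
(* The sum has at most one term: it selects the column belonging to [v], and is 0 for [v] outside
   [A]. *)
pose al v : 'rV[R]_#|A| := \row_j \sum_(i < #|A| | enum_val i == v) invmx Q j i.
have alE v x : dot (al v) x = \sum_(i < #|A| | enum_val i == v) (x *m invmx Q) ord0 i.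
  rewrite /dot; under eq_bigr do rewrite mxE mulr_suml.
  rewrite exchange_big /=; apply: eq_bigr => i _; rewrite mxE.
  by apply: eq_bigr => j _; rewrite mulrC.
exists al; split => [x|w v vA].
  rewrite sumA -[LHS](mulmxKV uQ); congr (_ *m _); apply/rowP => i.
  by rewrite [RHS]mxE alE (ev _ (fun i => (x *m invmx Q) ord0 i) i).
rewrite sumA alE mulmxK //.
have [i0 vE] : exists i0 : 'I_#|A|, enum_val i0 = v.
  by exists (enum_rank_in vA v); rewrite enum_rankK_in.
by rewrite (ev _ _ i0 vE) mxE vE.
Qed.

(** Appending a coordinate 1 turns affine independence into linear independence, so that
    [dual_basis] applies one dimension higher. *)
Lemma barycentric d nv (p : 'I_nv -> 'rV[R]_d) (A : {set 'I_nv}) :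
  #|A| = d.+1 -> affinely_independent p A ->
  exists (al : 'I_nv -> 'rV[R]_d) (be : 'I_nv -> R),
    (forall x, x = \sum_(v in A) (dot (al v) x + be v) *: p v /\
               \sum_(v in A) (dot (al v) x + be v) = 1) /\
    (forall (w : 'I_nv -> R) v, \sum_(u in A) w u = 1 -> v \in A ->
       dot (al v) (\sum_(u in A) w u *: p u) + be v = w v).
Proof.
move=> cA free; pose q v : 'rV[R]_(d + 1) := row_mx (p v) (const_mx 1).
have sumq (w : 'I_nv -> R) : \sum_(v in A) w v *: q v =
    row_mx (\sum_(v in A) w v *: p v) (const_mx (\sum_(v in A) w v)).
  apply/rowP => j; rewrite summxE mxE; case: splitP => k kE.
    rewrite summxE; apply: eq_bigr => v _; rewrite !mxE; case: splitP => k' k'E.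
      by congr (_ * p v _ _); apply: val_inj; rewrite /= -kE -k'E.
    by exfalso; move: kE; rewrite k'E => e; have := ltn_ord k; rewrite -e ltnNge leq_addr.
  rewrite mxE; apply: eq_bigr => v _; rewrite !mxE; case: splitP => k' k'E.
    by exfalso; move: kE; rewrite k'E => e; have := ltn_ord k'; rewrite e ltnNge leq_addr.
  by rewrite mxE mulr1.
have [||al [al1 al2]] := @dual_basis (d + 1) nv q A.
- by rewrite cA addn1.
- move=> w; rewrite sumq => e.
  have w1 := congr1 lsubmx e; have w2 := congr1 rsubmx e.
  rewrite row_mxKl linear0 in w1; rewrite row_mxKr linear0 in w2; apply: free => //.
  by have := congr1 (fun M : 'M[R]_(1, 1) => M ord0 ord0) w2; rewrite !mxE.
pose h x : 'rV[R]_(d + 1) := row_mx x (const_mx 1).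
have dE v x : dot (al v) (h x) = dot (lsubmx (al v)) x + rsubmx (al v) ord0 ord0.
  rewrite /dot big_split_ord /=; congr (_ + _).
    by apply: eq_bigr => i _; rewrite /h row_mxEl !mxE.
  by rewrite big_ord1 /h row_mxEr !mxE mulr1.
exists (fun v => lsubmx (al v)), (fun v => rsubmx (al v) ord0 ord0); split.
  move=> x; have := al1 (h x); rewrite sumq => /eq_row_mx[h1 h2]; split.
    by rewrite {1}h1; apply: eq_bigr => v _; rewrite dE.
  have := congr1 (fun M : 'M[R]_(1, 1) => M ord0 ord0) h2; rewrite !mxE => ->.
  by apply: eq_bigr => v _; rewrite dE.
move=> w v w1 vA; rewrite -dE /h -w1 -sumq; exact: al2.
Qed.

End dual_basis.

(** * Open sets and Lebesgue measure in several dimensions *)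

Section boxes.
Context {R : realType}.

Definition box n (x : 'rV[R]_n) (e : R) : set 'rV[R]_n :=
  [set y | forall i, `|x ord0 i - y ord0 i| < e].

Lemma measurable_box n x e : measurable (@box n x e).
Proof.
rewrite (_ : box x e = \bigcap_(i in [set: 'I_n]) [set y : 'rV[R]_n | `|x ord0 i - y ord0 i| < e]).
  apply: fin_bigcap_measurable => [|i _]; first exact: finite_finset.
  rewrite (_ : [set _ | _] = (fun y : 'rV[R]_n => y ord0 i) @^-1` (ball (x ord0 i) e)) //.
  by apply: measurable_preimage; [exact: measurable_coord | exact: measurable_ball].
by apply/seteqP; split => y hy i => [_|]; exact: hy.
Qed.

Lemma nbhs_box n (x : 'rV[R]_n) V : nbhs x V -> exists2 e, 0 < e & box x e `<=` V.
Proof.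
move=> /nbhs_ballP[e /= e0 he]; exists e => // y hy; apply: he; split => // i j.
by rewrite ord1; exact: hy.
Qed.

Lemma box_nbhs n (x : 'rV[R]_n) e : 0 < e -> nbhs x (box x e).
Proof. by move=> e0; apply/nbhs_ballP; exists e => // y [_ hy] i; exact: hy. Qed.

(** The sigma-algebra is generated by the coordinates only; an open set belongs to it as the
    countable union of the rational boxes that it contains. *)
Lemma open_measurable_rV n (U : set 'rV[R]_n) : open U -> measurable U.
Proof.
move=> oU; pose B (k : nat) : set 'rV[R]_n :=
  if (unpickle k : option ('rV[rat]_n * nat)) is Some (c, m) then
    let b := box (map_mx ratr c) m.+1%:R^-1 in
    if `[< b `<=` U >] then b else set0
  else set0.
rewrite (_ : U = \bigcup_k B k).
  apply: bigcup_measurable => k _; rewrite /B.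
  by case: unpickle => // -[c m]; case: ifP => // _; exact: measurable_box.
apply/seteqP; split => [x Ux|x [k _]]; last first.
  by rewrite /B; case: unpickle => // -[c m]; case: asboolP => // h /h.
have [e e0 he] := nbhs_box (open_nbhs_nbhs (conj oU Ux)).
(* A rational centre closer than [d] to [x] gives a box of size [d] that contains [x] and lies
   within [2 d < e] of it. *)
have [m [d [d0 dm de]]] : exists (m : nat) d, [/\ 0 < d, d = m.+1%:R^-1 & 2 * d < e].
  exists (Num.truncn (2 / e)), (Num.truncn (2 / e)).+1%:R^-1; split => //.
  by rewrite ltr_pdivrMr // mulrC -ltr_pdivrMr //; exact: truncnS_gt.
have /choice[c hc] : forall i : 'I_n, exists q : rat, `|ratr q - x ord0 i| < d.
  move=> i; have [|q] := @rat_in_itvoo R (x ord0 i - d) (x ord0 i + d).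
    by lra.
  by rewrite in_itv /= => /andP[q1 q2]; exists q; rewrite ltr_norml; apply/andP; split; lra.
exists (pickle (\row_i c i, m)) => //; rewrite /B pickleK -dm; case: asboolP => [_|[]].
  by move=> i; rewrite !mxE; exact: hc.
move=> y hy; apply: he => i; have := hc i; have := hy i; rewrite !mxE.
by move=> h1 h2; rewrite (le_lt_trans _ de) // -(subrKA (ratr (c i))) (le_trans (ler_normD _ _)) // distrC; lra.
Qed.

Lemma lebesgue_rV_box n (x : 'rV[R]_n) e : 0 < e ->
  (0 < lebesgue_rV n (box x e) < +oo)%E.
Proof.
move=> e0; elim: n x => [|n IH] x.
  rewrite /= diracE mem_set; first by rewrite lte01 ltry.
  by move=> [].
have -> : lebesgue_rV n.+1 (box x e) =
    (@lebesgue_measure R \x lebesgue_rV n)%E (@rV_cons R n @^-1` box x e) by [].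
have -> : @rV_cons R n @^-1` box x e =
    (ball (x ord0 ord0) e : set (measurableTypeR R)) `*` box (\row_j x ord0 (lift ord0 j)) e.
  apply/seteqP; split => -[t y] /=; rewrite /rV_cons /=.
    move=> h; split; first by have := h ord0; rewrite mxE unlift_none.
    by move=> i; have := h (lift ord0 i); rewrite !mxE liftK.
  move=> [h1 h2] i; rewrite mxE; case: (unliftP ord0 i) => [j ->|->] //=.
  by have := h2 j; rewrite mxE.
rewrite product_measure1E; [|exact: measurable_ball|exact: measurable_box].
have /andP[h1 h2] := IH (\row_j x ord0 (lift ord0 j)).
have hb := lebesgue_measure_ball (x ord0 ord0) (ltW e0).
set a := (X in (X * _)%E); have -> : a = (e *+ 2)%:E by exact: hb.
apply/andP; split; first by apply: mule_gt0 => //; rewrite lte_fin mulrn_wgt0.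
by apply: lte_mul_pinfty; rewrite ?lee_fin ?mulrn_wge0 // ltW.
Qed.

Lemma lebesgue_rV_gt0 n (x : 'rV[R]_n) V : measurable V -> nbhs x V ->
  (0 < lebesgue_rV n V)%E.
Proof.
move=> mV /nbhs_box[e e0 hV]; have /andP[h _] := lebesgue_rV_box x e0.
by apply: lt_le_trans h _; apply: le_measure; rewrite ?inE //; exact: measurable_box.
Qed.

Lemma lebesgue_rV_fin n (V : set 'rV[R]_n) : measurable V -> bounded_set V ->
  (lebesgue_rV n V < +oo)%E.
Proof.
move=> mV [M [_ hM]]; pose C := `|M| + 1.
have C0 : 0 < C + 1 by rewrite ltr_wpDl // addr_ge0.
have VC : V `<=` box 0 (C + 1).
  move=> y Vy i; rewrite mxE sub0r normrN.
  have : `|y| <= C by apply: hM => //; rewrite /C (le_lt_trans (ler_norm _)) // ltrDl.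
  move=> h; apply: (@le_lt_trans _ _ `|y|); last by rewrite (le_lt_trans h) // ltrDl.
  rewrite /Num.Def.normr /= mx_normrE.
  by apply: (bigmax_sup (ord0, i)).
have /andP[_ h] := lebesgue_rV_box (0 : 'rV[R]_n) C0.
apply: le_lt_trans h; apply: le_measure; rewrite ?inE //; exact: measurable_box.
Qed.

Lemma bmeas_bigcup_ord d (T : measurableType d) n (D : 'I_n -> set T) (f : T -> R) :
  (forall j, measurable (D j)) -> (forall j, bmeas (D j) f) -> bmeas (\bigcup_j D j) f.
Proof.
move=> mD bf; split.
  move=> _ Y mY; rewrite setI_bigcupl.
  apply: fin_bigcup_measurable => [|j _]; first exact: finite_finset.
  by have [mf _] := bf j; exact: mf.
have /choice[M hM] : forall j, exists M, forall x, D j x -> `|f x| <= M by move=> j; have [] := bf j.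
exists (\sum_j `|M j|) => x [j _ Djx]; rewrite (bigD1 j) //=.
rewrite (le_trans (hM j x Djx)) // (le_trans (ler_norm _)) // lerDl.
by apply: sumr_ge0.
Qed.

End boxes.

(** * Positivity of the surface measure on open sets *)

Section sphere_open.
Context {R : realType}.
Local Notation S := (@sphere R).
Local Notation mu := (@lebesgue_measure R).

(** The longitude is [acos (x / r)] or its reflection [2 pi - acos (x / r)], according to the sign
    of the second coordinate; at the poles [r = 0] and any longitude will do. *)
Lemma sphere_param_surj (s : 'rV[R]_3) : S s ->
  exists z t, sphere_param_domain (z, t) /\ sphere_param (z, t) = s.
Proof.
move=> /sphereP; rewrite dotE3; set x := s ord0 0; set y := s ord0 1; set z := s ord0 2%:R => h.
have p0 := pi_gt0 R.
have hz : 1 - z ^+ 2 = x ^+ 2 + y ^+ 2 by rewrite -h; ring.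
have z1 : -1 <= z <= 1.
  rewrite -ler_norml -[X in _ <= X]ger0_norm // -ler_sqr ?nnegrE // !real_normK ?num_real //.
  by rewrite expr1n -subr_ge0 hz addr_ge0 ?sqr_ge0.
pose r := Num.sqrt (1 - z ^+ 2).
have r2 : r ^+ 2 = x ^+ 2 + y ^+ 2 by rewrite sqr_sqrtr hz // addr_ge0 ?sqr_ge0.
have fin t : 0 <= t <= 2 * pi -> r * cos t = x -> r * sin t = y ->
    exists z t, sphere_param_domain (z, t) /\ sphere_param (z, t) = s.
  move=> t01 hx hy; exists z, t; split; first by split; rewrite /= in_itv.
  apply/rowP => -[[|[|[|//]]] i3]; rewrite !mxE /=.
  - by rewrite -/r hx /x; congr (s _ _); apply: val_inj.
  - by rewrite -/r hy /y; congr (s _ _); apply: val_inj.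
  - by rewrite /z; congr (s _ _); apply: val_inj.
have [r0|rn0] := eqVneq r 0.
  have : x ^+ 2 + y ^+ 2 = 0 by rewrite -r2 r0 expr0n.
  move=> /eqP; rewrite paddr_eq0 ?sqr_ge0 // !sqrf_eq0 => /andP[/eqP x0 /eqP y0].
  by apply: (fin 0); rewrite ?r0 ?mul0r // lexx; lra.
have rp : 0 < r by rewrite lt0r rn0 sqrtr_ge0.
pose c := x / r.
have c2 : 1 - c ^+ 2 = (y / r) ^+ 2.
  have -> : c ^+ 2 = x ^+ 2 / r ^+ 2 by rewrite /c exprMn exprVn.
  by rewrite exprMn exprVn r2; field; rewrite -r2 expf_neq0.
have c1 : -1 <= c <= 1.
  rewrite -ler_norml -[X in _ <= X]ger0_norm // -ler_sqr ?nnegrE // !real_normK ?num_real //.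
  by rewrite expr1n -subr_ge0 c2 sqr_ge0.
have [[a0 a1] ca] : (0 <= acos c /\ acos c <= pi) /\ cos (acos c) = c.
  by have [/andP[h1 h2] h3] := acos_def c1.
have sa : r * sin (acos c) = `|y|.
  by rewrite sin_acos // c2 sqrtr_sqr normrM normfV (gtr0_norm rp) mulrC divfK.
have cx : r * c = x by rewrite /c mulrC divfK.
have [y0|y0] := leP 0 y.
  apply: (fin (acos c)); rewrite ?ca ?cx ?sa ?ger0_norm // a0 /=; lra.
apply: (fin (2 * pi - acos c)).
- by apply/andP; split; lra.
- rewrite mulr_natl cosB cos2pi sin2pi mul1r mul0r addr0 ca cx //.
- by rewrite mulr_natl sinB cos2pi sin2pi mul1r mul0r sub0r mulrN sa ltr0_norm // opprK.
Qed.

Lemma itv_inter_gt0 (a b z e : R) : a < b -> a <= z <= b -> 0 < e ->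
  (0 < mu (ball z e `&` `[a, b]%classic))%E.
Proof.
move=> ab /andP[az zb] e0; pose l := Num.max a (z - e); pose r := Num.min b (z + e).
have lr : l < r by rewrite /l /r gt_max !lt_min ab; apply/andP; split; apply/andP; split; lra.
apply: (@lt_le_trans _ _ (mu `]l, r[%classic)).
  by rewrite lebesgue_measure_itv /= lte_fin lr -EFinB lte_fin subr_gt0.
apply: le_measure; rewrite ?inE //.
  by apply: measurableI => //; exact: measurable_ball.
move=> t /=; rewrite /l /r in_itv /= gt_max lt_min => /andP[/andP[at_ zt] /andP[tb tz]].
split; last by rewrite in_itv /= !ltW.
by rewrite /ball /= ltr_norml; apply/andP; split; lra.
Qed.

Lemma sphere_param_continuous (x : R * R) (i : 'I_3) :
  {for x, continuous (fun y : R * R => sphere_param y ord0 i)}.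
Proof.
have c1 : {for x, continuous (fun y : R * R => y.1)} by exact: cvg_fst.
have c2 : {for x, continuous (fun y : R * R => y.2)} by exact: cvg_snd.
have cs : {for x, continuous (fun y : R * R => Num.sqrt (1 - y.1 ^+ 2))}.
  apply: (@continuous_comp _ _ _ (fun y : R * R => 1 - y.1 ^+ 2) Num.sqrt); last exact: sqrt_continuous.
  apply: cvgB; first exact: cvg_cst.
  by apply: (@continuous_comp _ _ _ (fun y : R * R => y.1) (fun u => u ^+ 2)); [exact: c1|exact: exprn_continuous].
case: i => [[|[|[|//]]] i3].
- rewrite (_ : (fun y => _) = (fun y : R * R => Num.sqrt (1 - y.1 ^+ 2) * cos y.2)); last first.
    by apply/funext => y; rewrite mxE.
  apply: cvgM; first exact: cs.
  by apply: (@continuous_comp _ _ _ (fun y : R * R => y.2) cos); [exact: c2|exact: continuous_cos].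
- rewrite (_ : (fun y => _) = (fun y : R * R => Num.sqrt (1 - y.1 ^+ 2) * sin y.2)); last first.
    by apply/funext => y; rewrite mxE.
  apply: cvgM; first exact: cs.
  by apply: (@continuous_comp _ _ _ (fun y : R * R => y.2) sin); [exact: c2|exact: continuous_sin].
- rewrite (_ : (fun y => _) = (fun y : R * R => y.1)) //.
  by apply/funext => y; rewrite mxE.
Qed.

(** Continuity of the parametrization puts a small rectangle of parameters into the preimage. The
    point may lie on the edge of the parameter domain, so the rectangle is cut with it;
    [itv_inter_gt0] keeps the measure positive. *)
Lemma sphere_measure_gt0 (s : 'rV[R]_3) O : S s -> measurable O -> nbhs s O ->
  (0 < sphere_measure (O `&` S) :> \bar R)%E.
Proof.
move=> Ss mO /nbhs_box[e e0 hO]; have [z [t [[/= hz ht] st]]] := sphere_param_surj Ss.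
have : \forall y \near ((z, t) : R * R), forall i, ball (s ord0 i) e (sphere_param y ord0 i).
  have := @filter_forall _ 'I_3 (fun i (y : R * R) => ball (s ord0 i) e (sphere_param y ord0 i)) (nbhs ((z, t) : R * R)) _.
  apply => i; have /cvg_ballP := @sphere_param_continuous (z, t) i.
  by move=> /(_ e e0); rewrite st.
move=> /nbhs_ballP[d /= d0 hd].
pose V : set (measurableTypeR R * measurableTypeR R) :=
  (ball z d `&` `[-1, 1]%classic) `*` (ball t d `&` `[0, 2 * pi]%classic).
have mV1 (c a b : R) : measurable (ball c d `&` `[a, b]%classic : set (measurableTypeR R)).
  by apply: measurableI => //; exact: measurable_ball.
have VO : V `<=` @sphere_param R @^-1` (O `&` S) `&` sphere_param_domain.
  move=> [z' t'] [/= [h1 h2] [h3 h4]]; split; last by split.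
  split; last by apply: sphere_param_in; split.
  by apply: hO => i; have := hd (z', t') (conj h1 h3) i; rewrite /ball.
apply: (@lt_le_trans _ _ ((mu \x mu)%E V)).
  have p0 := pi_gt0 R.
  rewrite product_measure1E; [|exact: mV1|exact: mV1].
  by apply: mule_gt0; apply: itv_inter_gt0 => //; rewrite in_itv in hz ht; lra.
apply: le_measure; rewrite ?inE //; first exact: measurableX.
apply: measurableI; last exact: measurable_sphere_param_domain.
apply: measurable_preimage; first exact: measurable_sphere_param.
by apply: measurableI => //; exact: measurable_sphere.
Qed.

End sphere_open.

Section functionals.
Context {R : realType}.

Lemma measurable_dot_ge n (a : 'rV[R]_n) b : measurable [set x : 'rV[R]_n | 0 <= dot a x + b].
Proof.
rewrite (_ : [set _ | _] = (fun x => dot a x + b) @^-1` `[0, +oo[%classic); last first.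
  by apply/seteqP; split => x /=; rewrite in_itv /= andbT.
by apply: measurable_preimage => //; apply: measurable_funD => //; exact: measurable_dot.
Qed.

Lemma measurable_dot_gt n (a : 'rV[R]_n) b : measurable [set x : 'rV[R]_n | 0 < dot a x + b].
Proof.
rewrite (_ : [set _ | _] = (fun x => dot a x + b) @^-1` `]0, +oo[%classic); last first.
  by apply/seteqP; split => x /=; rewrite in_itv /= andbT.
by apply: measurable_preimage => //; apply: measurable_funD => //; exact: measurable_dot.
Qed.

Lemma norm_dot_le_box n (a x y : 'rV[R]_n) e : 0 <= e -> box x e y ->
  `|dot a y - dot a x| <= (\sum_i `|a ord0 i|) * e.
Proof.
move=> e0 h; rewrite /dot -sumrB (le_trans (ler_norm_sum _ _ _)) // mulr_suml.
apply: ler_sum => i _; rewrite -mulrBr normrM ler_wpM2l // distrC ltW //; exact: h.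
Qed.

Lemma nbhs_dot_gt n (a x : 'rV[R]_n) b c : c < dot a x + b ->
  nbhs x [set y | c < dot a y + b].
Proof.
move=> h; pose K := \sum_i `|a ord0 i| + 1.
have K0 : 0 < K by rewrite ltr_wpDl // sumr_ge0.
pose e := (dot a x + b - c) / K.
have e0 : 0 < e by rewrite divr_gt0 // subr_gt0.
apply: filterS (box_nbhs x e0) => y /(norm_dot_le_box a (ltW e0)).
rewrite /=; have : (\sum_i `|a ord0 i|) * e < dot a x + b - c.
  have -> : dot a x + b - c = K * e by rewrite mulrC divfK // gt_eqF.
  by rewrite ltr_pM2r // ltrDl.
by rewrite ler_norml => h1 /andP[h2 _]; lra.
Qed.

Lemma nbhs_dot_neq0 n (a x : 'rV[R]_n) b : dot a x + b != 0 ->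
  nbhs x [set y | dot a y + b != 0].
Proof.
rewrite neq_lt => /orP[h|h].
  have := @nbhs_dot_gt n (- a) x (- b) 0; rewrite -[X in 0 < X]opprK oppr_gt0 opprD.
  have dN y : dot (- a) y = - dot a y.
    by rewrite /dot -sumrN; apply: eq_bigr => i _; rewrite mxE mulNr.
  rewrite dN !opprK => /(_ h); apply: filterS => y /=; rewrite dN -opprD oppr_gt0 => h'.
  by rewrite lt_eqF.
by apply: filterS (nbhs_dot_gt h) => y /= h'; rewrite gt_eqF.
Qed.

End functionals.

Lemma dot_eq0 (R : realType) n (x : 'rV[R]_n) : dot x x = 0 -> x = 0.
Proof.
rewrite /dot => h; apply/rowP => i; rewrite mxE; apply/eqP; rewrite -sqrf_eq0 expr2.
apply/eqP; apply: (@psumr_eq0P R 'I_n xpredT (fun i => x ord0 i * x ord0 i)) => // k _.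
exact: sqr_ge0.
Qed.

(** * Geometry of the mesh of the sphere *)

Section spherical_mesh.
Context {R : realType}.
Local Notation S := (@sphere R).
Variables (nv ne : nat) (q : 'I_nv -> 'rV[R]_3) (T : 'I_ne -> {set 'I_nv}).
Hypothesis mesh : spherical_triangulation q T.

Let Tinj : injective T. Proof. by case: mesh. Qed.
Let T3 j : #|T j| = 3%N. Proof. by case: mesh => _ _ /(_ j)[]. Qed.
Let Tind j : linearly_independent q (T j). Proof. by case: mesh => _ _ /(_ j)[]. Qed.
Let Tint i j : spherical_triangle q (T i) `&` spherical_triangle q (T j) =
  spherical_triangle q (T i :&: T j).
Proof. by case: mesh. Qed.

Lemma spherical_dual j : exists al : 'I_nv -> 'rV[R]_3,
  (forall x, x = \sum_(v in T j) dot (al v) x *: q v) /\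
  (forall (w : 'I_nv -> R) v, v \in T j -> dot (al v) (\sum_(u in T j) w u *: q u) = w v).
Proof. exact: dual_basis (T3 j) (@Tind j). Qed.

Lemma spherical_triangleE j al :
  (forall x, x = \sum_(v in T j) dot (al v) x *: q v) ->
  (forall (w : 'I_nv -> R) v, v \in T j -> dot (al v) (\sum_(u in T j) w u *: q u) = w v) ->
  spherical_triangle q (T j) = S `&` [set x | forall v, v \in T j -> 0 <= dot (al v) x] /\
  spherical_triangle_interior q (T j) = S `&` [set x | forall v, v \in T j -> 0 < dot (al v) x].
Proof.
move=> al1 al2; split; apply/seteqP; split => s.
- by move=> [Ss [w [w0 sE]]]; split => //= v vT; rewrite sE al2.
- move=> [Ss /= h]; split => //; exists (fun v => if v \in T j then dot (al v) s else 0); split.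
    by move=> v; case: ifP => // /h.
  by rewrite {1}(al1 s); apply: eq_bigr => v ->.
- by move=> [Ss [w [w0 sE]]]; split => //= v vT; rewrite sE al2.
(* The weights must be positive at every vertex of the mesh, hence the default 1; for the closed
   triangle 0 was enough. *)
- move=> [Ss /= h]; split => //; exists (fun v => if v \in T j then dot (al v) s else 1); split.
    by move=> v; case: ifP => // /h.
  by rewrite {1}(al1 s); apply: eq_bigr => v ->.
Qed.

Lemma measurable_forall_dot (A : {set 'I_nv}) (al : 'I_nv -> 'rV[R]_3) :
  measurable [set x | forall v, v \in A -> 0 <= dot (al v) x] /\
  measurable [set x | forall v, v \in A -> 0 < dot (al v) x].
Proof.
split.
  rewrite (_ : [set _ | _] = \bigcap_(v in [set` A]) [set x | 0 <= dot (al v) x + 0]); last first.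
    by apply/seteqP; split => x h v /= vA; have := h v vA; rewrite /= addr0.
  apply: fin_bigcap_measurable => [|v _]; first exact: finite_finset.
  exact: measurable_dot_ge.
rewrite (_ : [set _ | _] = \bigcap_(v in [set` A]) [set x | 0 < dot (al v) x + 0]); last first.
  by apply/seteqP; split => x h v /= vA; have := h v vA; rewrite /= addr0.
apply: fin_bigcap_measurable => [|v _]; first exact: finite_finset.
exact: measurable_dot_gt.
Qed.

Lemma measurable_spherical_triangle j : measurable (spherical_triangle q (T j)) /\
  measurable (spherical_triangle_interior q (T j)).
Proof.
have [al [al1 al2]] := spherical_dual j; have [-> ->] := spherical_triangleE al1 al2.
have [m1 m2] := measurable_forall_dot (T j) al.
by split; apply: measurableI => //; exact: measurable_sphere.
Qed.

Lemma interior_nbhs j s : spherical_triangle_interior q (T j) s ->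
  exists O, [/\ measurable O, nbhs s O & O `&` S `<=` spherical_triangle_interior q (T j)].
Proof.
have [al [al1 al2]] := spherical_dual j; have [_ ->] := spherical_triangleE al1 al2.
move=> [Ss /= h]; exists [set x | forall v, v \in T j -> 0 < dot (al v) x]; split.
- by have [] := measurable_forall_dot (T j) al.
- have := @filter_forall _ 'I_nv (fun v (y : 'rV[R]_3) => v \in T j -> 0 < dot (al v) y) (nbhs s) _.
  apply => v; case: (boolP (v \in T j)) => vT; last by apply: filterS (@filterT _ (nbhs s) _).
  have := h v vT; rewrite -[dot (al v) s]addr0 => /nbhs_dot_gt; apply: filterS => y /=.
  by rewrite addr0.
- by move=> x [].
Qed.

(** The normalized sum of the vertices: its coordinates are equal and positive, so it is not the
    zero vector. *)
Lemma interior_nonempty j : exists s, spherical_triangle_interior q (T j) s.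
Proof.
have [al [al1 al2]] := spherical_dual j; have [_ ->] := spherical_triangleE al1 al2.
pose c := \sum_(u in T j) (1 : R) *: q u.
have dc v : v \in T j -> dot (al v) c = 1 by move=> vT; rewrite (al2 (fun=> 1)).
have [v0 v0T] : exists v0, v0 \in T j by apply/card_gt0P; rewrite T3.
have c0 : 0 < dot c c.
  rewrite lt0r sumr_ge0 ?andbT => [|i _]; last exact: sqr_ge0.
  apply/negP => /eqP cc0; have := dc v0 v0T; have -> : c = 0.
    exact: dot_eq0.
  rewrite /dot big1 => [/eqP|i _]; first by rewrite eq_sym oner_eq0.
  by rewrite mxE mulr0.
pose r := Num.sqrt (dot c c); have r0 : 0 < r by rewrite sqrtr_gt0.
exists (r^-1 *: c); split.
  apply/sphereP; rewrite dotZr (dotC _ c) dotZr -(sqr_sqrtr (ltW c0)) -/r.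
  by field; rewrite gt_eqF.
by move=> v vT /=; rewrite dotZr dc // mulr1 invr_gt0.
Qed.

(** By conformity a common point is spanned by the common vertices, so its coordinate at a vertex
    missing from [T j] would be 0. In the interior it is positive; hence [T i] is contained in
    [T j], and both have three vertices. *)
Lemma interior_disjoint i j s : spherical_triangle_interior q (T i) s ->
  spherical_triangle q (T j) s -> i = j.
Proof.
have [al [al1 al2]] := spherical_dual i; have [e1 e2] := spherical_triangleE al1 al2.
rewrite e2 => -[Ss h] sj; apply: Tinj; apply/eqP; rewrite eqEcard !T3 leqnn andbT.
have : (spherical_triangle q (T i) `&` spherical_triangle q (T j)) s.
  by split => //; rewrite e1; split => // v /h /ltW.
rewrite Tint => -[_ [w [w0 sE]]]; apply/fintype.subsetP => v vT.
pose w' u := if u \in T i :&: T j then w u else 0.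
have sE' : s = \sum_(u in T i) w' u *: q u.
  rewrite sE big_mkcond [RHS]big_mkcond; apply: eq_bigr => u _; rewrite /w' inE.
  by case: (u \in T i) => //=; case: (u \in T j) => //; rewrite scale0r.
have := h v vT; rewrite sE' al2 // /w' inE vT /=.
by case: (v \in T j) => //; rewrite ltxx.
Qed.

End spherical_mesh.
Lemma bmeasU d (T : measurableType d) (R : realType) (A B : set T) (f : T -> R) :
  measurable A -> measurable B -> bmeas A f -> bmeas B f -> bmeas (A `|` B) f.
Proof.
move=> mA mB [mf [M hM]] [mg [N hN]]; split; first by apply/measurable_funU.
by exists (Num.max M N) => x [/hM|/hN] h; rewrite le_max h ?orbT.
Qed.

(* Linear independence modulo null sets. *)
Definition sphere_independent (R : realType) n (f : 'I_n -> 'rV[R]_3 -> R) :=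
  forall y : 'I_n -> R, (exists k, y k != 0) -> exists s O,
    [/\ sphere s, measurable O, nbhs s O &
        forall x, O x -> sphere x -> \sum_k y k * f k x != 0].

Section angular_bases.
Context {R : realType}.
Local Notation S := (@sphere R).
Variables (nv ne : nat) (q : 'I_nv -> 'rV[R]_3) (T : 'I_ne -> {set 'I_nv}).
Hypothesis mesh : spherical_triangulation q T.

Section even.
Hypothesis sym : antipodally_symmetric q T.
Variables (n : nat) (rep : 'I_n -> 'I_ne).
Hypothesis repP : antipodal_representatives q T rep.

Let antipode_triangle j : exists j', spherical_triangle q (T j') = antipode (spherical_triangle q (T j)) := sym j.

Lemma bmeas_pair_indicator k : bmeas S (pair_indicator q T rep k).
Proof.
apply: bmeas_indic; have [j' <-] := antipode_triangle (rep k).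
by apply: measurableU; apply (measurable_spherical_triangle mesh _).1.
Qed.

Lemma pair_indicatorN k s : pair_indicator q T rep k (- s) = pair_indicator q T rep k s.
Proof.
rewrite /pair_indicator !indicE; congr (_%:R); congr nat_of_bool; apply/idP/idP; rewrite !inE /antipode /=.
  case=> [h|[x hx /oppr_inj <-]]; last by left.
  by right; exists (- s); rewrite ?opprK.
case=> [h|[x hx <-]]; last by left; rewrite opprK.
by right; exists s.
Qed.

(** Inside the triangle [rep k] the indicators of the other pairs vanish, because each triangle
    belongs to exactly one selected pair. *)
Lemma sphere_independent_pair : sphere_independent (pair_indicator q T rep).
Proof.
move=> y [k yk]; have [s ints] := interior_nonempty mesh (rep k).
have [U [mO nO OS]] := interior_nbhs mesh ints.
exists s, U; split => //; first by case: ints.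
move=> x Ox Sx; have intx := OS _ (conj Ox Sx).
have Tx : spherical_triangle q (T (rep k)) x.
  by case: intx => Sx' [w [w0 xE]]; split => //; exists w; split => // v; exact: ltW.
have other k' : k' != k -> pair_indicator q T rep k' x = 0.
  move=> kk'; rewrite /pair_indicator indicE memNset // => h.
  have [k0 [_ uk]] := repP (rep k).
  have ek : k0 = k by apply: uk; left.
  have ek' : k0 = k'.
    apply: uk; case: h => h; first by left; rewrite (interior_disjoint mesh intx h).
    have [j' jE] := antipode_triangle (rep k'); right; rewrite -jE.
    by rewrite -jE in h; rewrite (interior_disjoint mesh intx h).
  by rewrite -ek' ek eqxx in kk'.
rewrite (bigD1 k) //= big1 ?addr0 => [|k' kk']; last by rewrite other // mulr0.
by rewrite /pair_indicator indicE mem_set ?mulr1 //; left.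
Qed.

End even.

Section odd.

Lemma odd_P1_interior f j : odd_P1 q T f ->
  exists a b, forall x, spherical_triangle_interior q (T j) x -> f x = dot a x + b.
Proof. by case=> _ /(_ j). Qed.

Lemma bmeas_odd_P1 f : odd_P1 q T f -> bmeas S f.
Proof.
move=> Pf; pose I := \bigcup_j spherical_triangle_interior q (T j).
have mI : measurable I.
  apply: fin_bigcup_measurable => [|j _]; first exact: finite_finset.
  by have [] := measurable_spherical_triangle mesh j.
have IS : I `<=` S by move=> x [j _ []].
rewrite -(setDUK IS); apply: bmeasU => //.
- by apply: measurableD => //; exact: measurable_sphere.
- apply: bmeas_bigcup_ord => j; first by have [] := measurable_spherical_triangle mesh j.
  have [a [b fE]] := odd_P1_interior j Pf.
  apply: (bmeas_eq (f := fun x => dot a x + b)) => [x /fE -> //|].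
  apply: (bmeasS (D := S)); [exact: measurable_sphere | by move=> x [] |].
  by apply: bmeasD; [exact: bmeas_dot | exact: bmeas_cst].
- apply: (bmeas_eq (f := fun=> 0)); last exact: bmeas_cst.
  move=> x [Sx nI]; case: Pf => _ _ -> // j jx; apply: nI; by exists j.
Qed.

Variables (n : nat) (psi : 'I_n -> 'rV[R]_3 -> R).
Hypothesis psiP : is_basis_on setT (odd_P1 q T) psi.

Let psiV m : odd_P1 q T (psi m). Proof. by case: psiP. Qed.

Lemma bmeas_odd_basis m : bmeas S (psi m).
Proof. exact: bmeas_odd_P1. Qed.

Lemma odd_basisN m s : psi m (- s) = - psi m s.
Proof. by have [] := psiV m. Qed.

(** A nontrivial combination is nonzero somewhere, necessarily inside a triangle, since the
    representatives vanish elsewhere. There it is affine, so it stays nonzero nearby. *)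
Lemma sphere_independent_odd : sphere_independent psi.
Proof.
move=> y [k yk].
have [s hs] : exists s, \sum_m y m * psi m s != 0.
  apply: contrapT => /forallNP h; move: yk; apply/negP; rewrite negbK; apply/eqP.
  case: psiP => _ free _; apply: free => x _; have /negP := h x.
  by rewrite negbK => /eqP.
have [j ints] : exists j, spherical_triangle_interior q (T j) s.
  apply: contrapT => /forallNP h; move: hs; rewrite big1 ?eqxx // => m _.
  by have [_ _ ->] := psiV m; rewrite ?mulr0.
have /choice[a /choice[b ab]] : forall m, exists a b, forall x,
    spherical_triangle_interior q (T j) x -> psi m x = dot a x + b.
  by move=> m; exact: odd_P1_interior.
pose al := \sum_m y m *: a m; pose be := \sum_m y m * b m.
have hE x : spherical_triangle_interior q (T j) x -> \sum_m y m * psi m x = dot al x + be.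
  move=> ix; rewrite dotC dot_sumr -big_split; apply: eq_bigr => m _.
  by rewrite (ab m x ix) dotZr dotC mulrDr.
have [U [mO nO OS]] := interior_nbhs mesh ints.
exists s, (U `&` [set x | dot al x + be != 0]); split.
- by case: ints.
- apply: measurableI => //.
  rewrite (_ : [set _ | _] = (fun x => dot al x + be) @^-1` (~` [set 0])).
    apply: measurable_preimage; last by apply: measurableC; exact: measurable_set1.
    by apply: measurable_funD => //; exact: measurable_dot.
  by apply/seteqP; split => x /=; [move/eqP | move=> h; apply/eqP].
- by apply: filterI => //; apply: nbhs_dot_neq0; rewrite -hE.
- by move=> x [Ox h] Sx; rewrite hE //; exact: OS.
Qed.

End odd.
End angular_bases.

Definition space_independent (R : realType) d n (Om : set 'rV[R]_d) (h : 'I_n -> 'rV[R]_d -> R) :=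
  forall y : 'I_n -> R, (exists k, y k != 0) -> exists (r : 'rV[R]_d) (V : set 'rV[R]_d),
    [/\ measurable V, nbhs r V, V `<=` Om &
        forall x, V x -> \sum_k y k * h k x != 0].

(** * The mesh of the spatial domain and its finite elements *)

Section spatial_mesh.
Context {R : realType}.
Variables (d nv ne : nat) (Om : set 'rV[R]_d) (p : 'I_nv -> 'rV[R]_d) (T : 'I_ne -> {set 'I_nv}).
Hypotheses (Om_open : open Om) (Om_bounded : bounded_set Om).
Hypothesis mesh : triangulation p T Om.

Let Tinj : injective T. Proof. by case: mesh. Qed.
Let Tcard j : #|T j| = d.+1. Proof. by case: mesh. Qed.
Let Tind j : affinely_independent p (T j). Proof. by case: mesh. Qed.
Let Tint i j : simplex p (T i) `&` simplex p (T j) = simplex p (T i :&: T j).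
Proof. by case: mesh. Qed.
Let Tcover : \bigcup_j simplex p (T j) = closure Om. Proof. by case: mesh. Qed.

Lemma measurable_Om : measurable Om.
Proof. exact: open_measurable_rV. Qed.

Lemma Om_fin : (lebesgue_rV d Om < +oo)%E.
Proof. by apply: lebesgue_rV_fin => //; exact: measurable_Om. Qed.

Let bary j := barycentric (Tcard j) (@Tind j).

Lemma simplexE j al be :
  (forall x, x = \sum_(v in T j) (dot (al v) x + be v) *: p v /\
             \sum_(v in T j) (dot (al v) x + be v) = 1) ->
  (forall (w : 'I_nv -> R) v, \sum_(u in T j) w u = 1 -> v \in T j ->
     dot (al v) (\sum_(u in T j) w u *: p u) + be v = w v) ->
  simplex p (T j) = [set x | forall v, v \in T j -> 0 <= dot (al v) x + be v].
Proof.
move=> al1 al2; apply/seteqP; split => s.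
  by move=> [w [w0 w1 sE]] v vT; rewrite sE al2.
move=> /= h; have [sE s1] := al1 s.
exists (fun v => if v \in T j then dot (al v) s + be v else 0); split.
- by move=> v; case: ifP => // /h.
- by rewrite -[RHS]s1; apply: eq_bigr => v ->.
- by rewrite {1}sE; apply: eq_bigr => v ->.
Qed.

Lemma measurable_simplex j : measurable (simplex p (T j)).
Proof.
have [al [be [al1 al2]]] := bary j; rewrite (simplexE al1 al2).
rewrite (_ : [set _ | _] = \bigcap_(v in [set` T j]) [set x | 0 <= dot (al v) x + be v]) //.
apply: fin_bigcap_measurable => [|v _]; first exact: finite_finset.
exact: measurable_dot_ge.
Qed.

Lemma bmeas_affine_simplex j a b : bmeas (simplex p (T j)) (fun x => dot a x + b).
Proof.
apply: bmeasD; last exact: bmeas_cst.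
split; first by apply: measurable_funTS; exact: measurable_dot.
exists (\sum_v `|dot a (p v)|) => x [w [w0 w1 ->]].
rewrite dot_sumr (le_trans (ler_norm_sum _ _ _)) // big_mkcond /=.
apply: ler_sum => v _; case: ifP => // vT.
rewrite dotZr normrM (ger0_norm (w0 v)) ler_piMl //.
by rewrite -w1 (bigD1 v) //= lerDl sumr_ge0.
Qed.

Lemma bmeas_P1 f : continuous_P1 p T Om f -> bmeas (closure Om) f.
Proof.
move=> [_ Pf]; rewrite -Tcover; apply: bmeas_bigcup_ord => j; first exact: measurable_simplex.
have [a [b fE]] := Pf j.
by apply: bmeas_eq (bmeas_affine_simplex j a b) => x /fE.
Qed.

Lemma bmeas_element_indicator D j : bmeas D (element_indicator p T j).
Proof. by apply: bmeas_indic; exact: measurable_simplex. Qed.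

Lemma measurable_closure_Om : measurable (closure Om).
Proof.
rewrite -Tcover; apply: fin_bigcup_measurable => [|j _]; first exact: finite_finset.
exact: measurable_simplex.
Qed.

Lemma bmeas_P1_Om f : continuous_P1 p T Om f -> bmeas Om f.
Proof.
move=> /bmeas_P1; apply: bmeasS; first exact: measurable_closure_Om.
exact: subset_closure.
Qed.

(** The open part of the simplex [T j] is disjoint from the other simplices, by the same conformity
    argument as on the sphere. *)
Lemma space_independent_indicator : space_independent Om (element_indicator p T).
Proof.
move=> y [j yj]; have [al [be [al1 al2]]] := bary j; have sE := simplexE al1 al2.
pose W : set 'rV[R]_d := [set x | forall v, v \in T j -> 0 < dot (al v) x + be v].
have mW : measurable W.
  rewrite (_ : W = \bigcap_(v in [set` T j]) [set x | 0 < dot (al v) x + be v]) //.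
  apply: fin_bigcap_measurable => [|v _]; first exact: finite_finset.
  exact: measurable_dot_gt.
have nW x : W x -> nbhs x W.
  move=> Wx; have := @filter_forall _ 'I_nv (fun v (y : 'rV[R]_d) => v \in T j -> 0 < dot (al v) y + be v) (nbhs x) _.
  apply => v; case: (boolP (v \in T j)) => vT; last by apply: filterS (@filterT _ (nbhs x) _).
  by have := nbhs_dot_gt (Wx v vT); apply: filterS => z.
have [x0 Wx0] : exists x, W x.
  exists (\sum_(u in T j) d.+1%:R^-1 *: p u) => v vT.
  rewrite (al2 (fun=> d.+1%:R^-1)) ?invr_gt0 // sumr_const Tcard -[LHS]mulr_natr.
  by rewrite mulVf // pnatr_eq0.
have Ws : W `<=` simplex p (T j) by rewrite sE => x Wx v /Wx /ltW.
have clx0 : closure Om x0 by rewrite -Tcover; exists j => //; exact: Ws.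
(* The centroid [x0] is known to lie only in the closure; a point of [Om] near it is still in the
   open simplex. *)
have [r [Or Wr]] := clx0 _ (nW x0 Wx0).
exists r, (W `&` Om); split.
- by apply: measurableI => //; exact: measurable_Om.
- by apply: filterI; [exact: nW | exact: open_nbhs_nbhs].
- by move=> x [].
- move=> x [Wx Ox]; rewrite (bigD1 j) //= big1 ?addr0.
    by rewrite /element_indicator indicE mem_set ?mulr1 //; exact: Ws.
  move=> i ij; rewrite /element_indicator indicE memNset ?mulr0 // => si.
  have : (simplex p (T j) `&` simplex p (T i)) x by split => //; exact: Ws.
  rewrite Tint => -[w [w0 w1 xE]]; move: ij; apply/negP; rewrite negbK; apply/eqP.
  apply/esym/Tinj/eqP; rewrite eqEcard !Tcard leqnn andbT; apply/fintype.subsetP => v vT.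
  pose w' u := if u \in T j :&: T i then w u else 0.
  have e u : (if u \in T j then w' u else 0) = (if u \in T j :&: T i then w u else 0).
    by rewrite /w' inE; case: (u \in T j).
  have w1' : \sum_(u in T j) w' u = 1.
    by rewrite -w1 big_mkcond [RHS]big_mkcond; apply: eq_bigr => u _; exact: e.
  have xE' : x = \sum_(u in T j) w' u *: p u.
    rewrite xE big_mkcond [RHS]big_mkcond; apply: eq_bigr => u _; rewrite /w' inE.
    by case: (u \in T j) => //=; case: (u \in T i) => //; rewrite scale0r.
  have := Wx v vT; rewrite xE' al2 // /w' inE vT /=.
  by case: (v \in T i) => //; rewrite ltxx.
Qed.

Variables (n : nat) (phi : 'I_n -> 'rV[R]_d -> R).
Hypothesis phi_basis : is_basis_on (closure Om) (continuous_P1 p T Om) phi.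

Let phiV i : continuous_P1 p T Om (phi i). Proof. by case: phi_basis. Qed.

Lemma bmeas_phi i : bmeas Om (phi i). Proof. exact: bmeas_P1_Om. Qed.
Lemma bmeas_phi_closure i : bmeas (closure Om) (phi i). Proof. exact: bmeas_P1. Qed.

(** The basis is free on the closure, so a combination is nonzero at a point that may lie on the
    boundary. Continuity within the closure moves this to a point of [Om], where a neighbourhood is
    available. *)
Lemma space_independent_P1 : space_independent Om phi.
Proof.
move=> y [k yk]; pose h x := \sum_i y i * phi i x.
have ch x : closure Om x -> h x' @[x' --> within (closure Om) (nbhs x)] --> h x.
  move=> clx; rewrite /h; elim: (index_enum _) => [|i s IH].
    rewrite big_nil; under eq_fun do rewrite big_nil; exact: cvg_cst.
  rewrite big_cons; under eq_fun do rewrite big_cons.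
  apply: cvgD => //; apply: cvgM; first exact: cvg_cst.
  by have [/subspace_continuousP c _] := phiV i; exact: c.
have near0 x : closure Om x -> h x != 0 -> nbhs x [set x' | closure Om x' -> h x' != 0].
  by move=> clx hx; exact: (cvgr_neq0 _ (ch x clx) hx).
have [x [clx hx]] : exists x, closure Om x /\ h x != 0.
  apply: contrapT => /forallNP H; move: yk; apply/negP; rewrite negbK; apply/eqP.
  case: phi_basis => _ free _; apply: free => x clx.
  have := H x; rewrite not_andE => -[//|/negP]; by rewrite negbK => /eqP.
have [r [Or hr]] := clx _ (near0 x clx hx).
have {}hr : h r != 0 by apply: hr; exact: subset_closure.
have mh : bmeas Om h by apply: (@bmeas_sum _ _ _ _ _ _ xpredT) => i _; apply: bmeasZ; exact: bmeas_phi.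
exists r, (Om `&` h @^-1` (~` [set 0])); split.
- case: mh => mh _; apply: mh; first exact: measurable_Om.
  by apply: measurableC; exact: measurable_set1.
- apply: filterI; first exact: open_nbhs_nbhs.
  have := near0 r (subset_closure Or) hr.
  move=> /(filterI (open_nbhs_nbhs (conj Om_open Or))); apply: filterS => z [Oz] /(_ (subset_closure Oz)) hz /=.
  exact/eqP.
- by move=> z [].
- by move=> z [_ /= /eqP].
Qed.

End spatial_mesh.

(** * Gram matrices of the bilinear forms *)

Section tensor.
Context {R : realType}.
Variables (m n : nat).

Definition tensor_index (k : 'I_(m * n)) : 'I_m * 'I_n :=
  enum_val (cast_ord (esym (mxvec_cast m n)) k).

Lemma tensor_index_bij : bijective tensor_index.
Proof.
apply: (@bij_comp _ _ _ (@enum_val _ _) (cast_ord (esym (mxvec_cast m n)))).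
  exact: enum_val_bij.
by exists (cast_ord (mxvec_cast m n)); [exact: cast_ordKV | exact: cast_ordK].
Qed.

Lemma tensor_sum (F : 'I_m -> 'I_n -> R) :
  \sum_(k < m * n) F (tensor_index k).1 (tensor_index k).2 = \sum_i \sum_j F i j.
Proof.
rewrite pair_bigA /= (reindex tensor_index) //.
by apply: onW_bij; exact: tensor_index_bij.
Qed.

End tensor.

Section forms.
Context {R : realType}.
Variables (d : nat) (Om : set 'rV[R]_d.+1).
Hypotheses (mOm : measurable Om) (finOm : (lebesgue_rV d.+1 Om < +oo)%E).
Local Notation S := (@sphere R).
Local Notation lam := (lebesgue_rV d.+1).
Let mS := @measurable_sphere R.
Let finS := sphere_measure_fin mS.
Implicit Types (f : 'rV[R]_3 -> R) (h : 'rV[R]_d.+1 -> R).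

Lemma phase_integral_tensor f h : bmeas S f -> bmeas Om h ->
  phase_integral Om (fun x => f x.1 * h x.2) =
  (\int[sphere_measure]_(s in S) f s) * \int[lam]_(r in Om) h r.
Proof.
move=> bf bh; rewrite /phase_integral.
exact: (@bint_prod _ _ _ _ R sphere_measure lam _ _ mS mOm finS finOm _ _ bf bh).
Qed.

Lemma eq_phase_integral F G : (forall s r, S s -> Om r -> F (s, r) = G (s, r)) ->
  phase_integral Om F = phase_integral Om G.
Proof.
move=> FG; apply: eq_Rintegral => -[s r]; rewrite inE => -[Ss Or]; exact: FG.
Qed.

Lemma mass_form_tensor sigma f h f' h' : bmeas Om sigma ->
  bmeas S f -> bmeas Om h -> bmeas S f' -> bmeas Om h' ->
  mass_form Om sigma (fun x => f x.1 * h x.2) (fun x => f' x.1 * h' x.2) =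
  (\int[sphere_measure]_(s in S) (f s * f' s)) *
  \int[lam]_(r in Om) (sigma r * (h r * h' r)).
Proof.
move=> bs bf bh bf' bh'.
rewrite -phase_integral_tensor; [|exact: bmeasM|by apply: bmeasM => //; exact: bmeasM].
by apply: eq_phase_integral => s r _ _ /=; ring.
Qed.

Lemma scattering_tensor g f h s r : 0 <= g < 1 -> bmeas S f -> S s ->
  scattering g (fun x => f x.1 * h x.2) (s, r) = scat g f s * h r.
Proof.
move=> g01 bf Ss; rewrite /scattering /scat /= mulrC -bintZ //; last first.
  by apply: bmeasM => //; exact: bmeas_HG.
by apply: eq_Rintegral => y _; ring.
Qed.

Lemma scattering_form_tensor g sigma f h f' h' : 0 <= g < 1 -> bmeas Om sigma ->
  bmeas S f -> bmeas Om h -> bmeas S f' -> bmeas Om h' ->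
  scattering_form Om g sigma (fun x => f x.1 * h x.2) (fun x => f' x.1 * h' x.2) =
  scat_form g f f' * \int[lam]_(r in Om) (sigma r * (h r * h' r)).
Proof.
move=> g01 bs bf bh bf' bh'; have bsc := bmeas_scat g01 bf.
rewrite -phase_integral_tensor; [|exact: bmeasM|by apply: bmeasM => //; exact: bmeasM].
apply: eq_phase_integral => s r Ss _ /=.
by rewrite scattering_tensor //; ring.
Qed.

Section quadratic.
Variables (m n : nat) (f : 'I_m -> 'rV[R]_3 -> R) (h : 'I_n -> 'rV[R]_d.+1 -> R).
Hypotheses (bf : forall k, bmeas S (f k)) (bh : forall i, bmeas Om (h i)).
Let B := tensor_basis f h.

(** The function with coordinates [v] is the sum over [k] of [nodal v k r * f k s]: at fixed [r], an
    angular combination with these coefficients. *)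
Definition nodal (v : 'cV[R]_(m * n)) k r : R :=
  \sum_i v (mxvec_index k i) ord0 * h i r.

Lemma bmeas_nodal v k : bmeas Om (nodal v k).
Proof. by apply: (@bmeas_sum _ _ _ _ _ _ xpredT) => i _; exact: bmeasZ. Qed.

Lemma tensor_indexK (k : 'I_(m * n)) : mxvec_index (tensor_index k).1 (tensor_index k).2 = k.
Proof.
rewrite /mxvec_index /tensor_index -surjective_pairing enum_valK.
exact: cast_ordKV.
Qed.

(** The angular operators act at each [r] separately, so the form on phase space is an integral over
    [r] of an angular form. The bounds on the sphere can then be used pointwise in [r]. *)
Lemma quadratic_tensor (X : 'M[R]_(m * n)) (al : 'I_m -> 'I_m -> R) sigma v :
  bmeas Om sigma ->
  (forall k l, X k l = al (tensor_index l).1 (tensor_index k).1 *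
     \int[lam]_(r in Om) (sigma r * (h (tensor_index l).2 r * h (tensor_index k).2 r))) ->
  bilin X v v = \int[lam]_(r in Om)
     (sigma r * \sum_a \sum_b al b a * nodal v a r * nodal v b r).
Proof.
move=> bs XE; rewrite bilinE.
pose w a i := v (mxvec_index a i) ord0.
pose I i j := \int[lam]_(r in Om) (sigma r * (h j r * h i r)).
transitivity (\sum_a \sum_i \sum_b \sum_j al b a * I i j * w a i * w b j).
  rewrite -(tensor_sum (fun a i => \sum_b \sum_j al b a * I i j * w a i * w b j)).
  apply: eq_bigr => k _.
  rewrite -(tensor_sum (fun b j => al b (tensor_index k).1 * I (tensor_index k).2 j * w (tensor_index k).1 (tensor_index k).2 * w b j)).
  by apply: eq_bigr => l _; rewrite XE /w !tensor_indexK.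
have bhh i j : bmeas Om (fun r => sigma r * (h j r * h i r)).
  by apply: bmeasM => //; exact: bmeasM.
transitivity (\int[lam]_(r in Om) (\sum_a \sum_i \sum_b \sum_j
    (al b a * w a i * w b j) * (sigma r * (h j r * h i r)))).
  have b4 a i b j : bmeas Om (fun r => (al b a * w a i * w b j) * (sigma r * (h j r * h i r))).
    exact: bmeasZ.
  have b3 a i b := @bmeas_sum _ _ _ Om _ (index_enum 'I_n) xpredT _ (fun j _ => b4 a i b j).
  have b2 a i := @bmeas_sum _ _ _ Om _ (index_enum 'I_m) xpredT _ (fun b _ => b3 a i b).
  have b1 a := @bmeas_sum _ _ _ Om _ (index_enum 'I_n) xpredT _ (fun i _ => b2 a i).
  rewrite bint_sum //; apply: eq_bigr => a _.
  rewrite bint_sum //; apply: eq_bigr => i _.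
  rewrite bint_sum //; apply: eq_bigr => b _.
  rewrite bint_sum //; apply: eq_bigr => j _.
  by rewrite bintZ // /I; ring.
apply: eq_Rintegral => r _; rewrite mulr_sumr; apply: eq_bigr => a _.
rewrite exchange_big /= mulr_sumr; apply: eq_bigr => b _.
have -> : al b a * nodal v a r * nodal v b r =
    al b a * \sum_i \sum_j (w a i * h i r) * (w b j * h j r).
  by rewrite -mulrA /nodal big_distrlr.
rewrite mulrA mulr_sumr; apply: eq_bigr => i _.
rewrite mulr_sumr; apply: eq_bigr => j _; ring.
Qed.

End quadratic.
End forms.
Lemma bint_gt0 d (T : measurableType d) (R : realType) (m : {measure set T -> \bar R})
    (D U : set T) (f : T -> R) :
  measurable D -> (m D < +oo)%E -> bmeas D f -> (forall x, D x -> 0 <= f x) ->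
  measurable U -> U `<=` D -> (0 < m U)%E -> (forall x, U x -> 0 < f x) ->
  0 < \int[m]_(x in D) f x.
Proof.
move=> mD fD bf f0 mU UD mU0 fU.
rewrite lt0r Rintegral_ge0 // andbT; apply/negP => /eqP I0.
have iD := bmeas_integrable mD fD bf.
have I0' : (\int[m]_(x in D) (f x)%:E = 0)%E.
  by rewrite -[LHS]fineK ?integrable_fin_num // -/(Rintegral m D f) I0.
have A0 : (\int[m]_(x in D) `|(EFin \o f) x| = 0)%E.
  by rewrite -I0'; apply: eq_integral => x; rewrite inE => /f0 h /=; rewrite ger0_norm.
have [N [mN N0 hN]] := (ae_eq_integral_abs m mD (measurable_int m iD)).1 A0.
have UN : U `<=` N.
  move=> x Ux; apply: hN => /= /(_ (UD x Ux)) [] e.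
  by have := fU x Ux; rewrite e ltxx.
have : (m U <= m N)%E by apply: le_measure; rewrite ?inE.
by rewrite N0 leNgt mU0.
Qed.

Section tensor_bounds.
Context {R : realType}.
Variables (d : nat) (Om : set 'rV[R]_d.+1).
Hypotheses (mOm : measurable Om) (finOm : (lebesgue_rV d.+1 Om < +oo)%E).
Local Notation S := (@sphere R).
Local Notation lam := (lebesgue_rV d.+1).
Let mS := @measurable_sphere R.
Let finS := sphere_measure_fin mS.
Variables (m n : nat) (f : 'I_m -> 'rV[R]_3 -> R) (h : 'I_n -> 'rV[R]_d.+1 -> R).
Hypotheses (bf : forall k, bmeas S (f k)) (bh : forall i, bmeas Om (h i)).
Let B := tensor_basis f h.

Let comb (y : 'I_m -> R) s := \sum_a y a * f a s.

Let bcomb y : bmeas S (comb y).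
Proof. by apply: (@bmeas_sum _ _ _ _ _ _ xpredT) => a _; exact: bmeasZ. Qed.

Let comb_bilin (y : 'I_m -> R) (A : 'I_m -> 'rV[R]_3 -> R) : (forall a, bmeas S (A a)) ->
  \int[sphere_measure]_(s in S) ((\sum_a y a * A a s) * comb y s) =
  \sum_a \sum_b (\int[sphere_measure]_(s in S) (A b s * f a s)) * y a * y b.
Proof.
move=> bA; transitivity (\int[sphere_measure]_(s in S)
    (\sum_a \sum_b (y a * y b) * (A b s * f a s))).
  apply: eq_Rintegral => s _; rewrite mulrC big_distrlr /=.
  by apply: eq_bigr => a _; apply: eq_bigr => b _; ring.
have b2 a b : bmeas S (fun s => (y a * y b) * (A b s * f a s)) by apply: bmeasZ; exact: bmeasM.
have b1 a := @bmeas_sum _ _ _ S _ (index_enum 'I_m) xpredT _ (fun b _ => b2 a b).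
rewrite bint_sum //; apply: eq_bigr => a _; rewrite bint_sum //; apply: eq_bigr => b _.
by rewrite bintZ //; [ring | exact: bmeasM].
Qed.

Let sqnorm_comb y : sqnorm (comb y) =
  \sum_a \sum_b (\int[sphere_measure]_(s in S) (f b s * f a s)) * y a * y b.
Proof.
rewrite -comb_bilin //; apply: eq_Rintegral => s _; rewrite expr2; congr (_ * _).
Qed.

Variable g : R.
Hypothesis g01 : 0 <= g < 1.

Let scat_comb y : scat_form g (comb y) (comb y) =
  \sum_a \sum_b scat_form g (f b) (f a) * y a * y b.
Proof.
rewrite -comb_bilin; last by move=> a; exact: bmeas_scat.
apply: eq_Rintegral => s; rewrite inE => Ss; congr (_ * _).
rewrite /scat /comb; under eq_Rintegral do rewrite mulr_sumr.
rewrite bint_sum // => [|a]; last first.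
  by apply: bmeasM; [exact: bmeas_HG | exact: bmeasZ].
apply: eq_bigr => a _; rewrite -bintZ //; last by apply: bmeasM => //; exact: bmeas_HG.
by apply: eq_Rintegral => x _; ring.
Qed.

Variables (sigt sigs : 'rV[R]_d.+1 -> R).
Hypotheses (bt : bmeas Om sigt) (bs : bmeas Om sigs).
Let M : 'M[R]_(m * n) := form_matrix (mass_form Om sigt) B B.
Let K : 'M[R]_(m * n) := form_matrix (scattering_form Om g sigs) B B.

Let ME k l : M k l = (\int[sphere_measure]_(s in S)
    (f (tensor_index l).1 s * f (tensor_index k).1 s)) *
  \int[lam]_(r in Om) (sigt r * (h (tensor_index l).2 r * h (tensor_index k).2 r)).
Proof. by rewrite mxE; exact: mass_form_tensor. Qed.

Let KE k l : K k l = scat_form g (f (tensor_index l).1) (f (tensor_index k).1) *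
  \int[lam]_(r in Om) (sigs r * (h (tensor_index l).2 r * h (tensor_index k).2 r)).
Proof. by rewrite mxE; exact: scattering_form_tensor. Qed.

Let hC (sig : 'rV[R]_d.+1 -> R) i j : \int[lam]_(r in Om) (sig r * (h i r * h j r)) =
  \int[lam]_(r in Om) (sig r * (h j r * h i r)).
Proof. by apply: eq_Rintegral => r _; rewrite (mulrC (h i r)). Qed.

Lemma symm_mass : symm M.
Proof.
apply/matrixP => k l; rewrite mxE !ME hC; congr (_ * _).
by apply: eq_Rintegral => s _; rewrite mulrC.
Qed.

Lemma symm_scattering : symm K.
Proof. by apply/matrixP => k l; rewrite mxE !KE hC scat_formC. Qed.

Let Mquad v : bilin M v v =
  \int[lam]_(r in Om) (sigt r * sqnorm (comb (fun a => nodal h v a r))).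
Proof.
apply: (etrans (quadratic_tensor (X := M) mOm finOm bh v bt ME)).
by apply: eq_Rintegral => r _; rewrite sqnorm_comb.
Qed.

Let Kquad v : bilin K v v =
  \int[lam]_(r in Om) (sigs r * scat_form g (comb (fun a => nodal h v a r))
                                            (comb (fun a => nodal h v a r))).
Proof.
apply: (etrans (quadratic_tensor (X := K) mOm finOm bh v bs KE)).
by apply: eq_Rintegral => r _; rewrite scat_comb.
Qed.

Let b_sq v : bmeas Om (fun r => sqnorm (comb (fun a => nodal h v a r))).
Proof.
apply: (bmeas_eq (f := fun r => \sum_a \sum_b (\int[sphere_measure]_(s in S) (f b s * f a s)) * nodal h v a r * nodal h v b r)).
  by move=> r _; rewrite sqnorm_comb.
apply: (@bmeas_sum _ _ _ _ _ _ xpredT) => a _; apply: (@bmeas_sum _ _ _ _ _ _ xpredT) => b _.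
by apply: bmeasM; [apply: bmeasZ|]; exact: bmeas_nodal.
Qed.

Let b_sc v : bmeas Om (fun r => scat_form g (comb (fun a => nodal h v a r)) (comb (fun a => nodal h v a r))).
Proof.
apply: (bmeas_eq (f := fun r => \sum_a \sum_b scat_form g (f b) (f a) * nodal h v a r * nodal h v b r)).
  by move=> r _; rewrite scat_comb.
apply: (@bmeas_sum _ _ _ _ _ _ xpredT) => a _; apply: (@bmeas_sum _ _ _ _ _ _ xpredT) => b _.
by apply: bmeasM; [apply: bmeasZ|]; exact: bmeas_nodal.
Qed.

Variables (c gamma : R).
Hypotheses (gamma0 : 0 < gamma) (c0 : 0 <= c).
Hypothesis sigt_ge : forall r, Om r -> gamma <= sigt r.
Hypothesis sigs_ge0 : forall r, Om r -> 0 <= sigs r.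
Hypothesis sigs_le : forall r, Om r -> sigs r <= c * sigt r.

Lemma psd_scattering : psd K.
Proof.
move=> v; rewrite Kquad; apply: Rintegral_ge0 => r Or.
by rewrite mulr_ge0 ?sigs_ge0 // scat_form_ge0.
Qed.

(** At each [r] the factor [c] comes from [sigs <= c sigt], used on the nonnegative scattering form,
    and [g^p] from [scat_form_le], used on a combination with the parity of the basis. *)
Lemma psd_mass_sub_scattering p : (p < 2)%N ->
  (forall k s, f k (- s) = (-1) ^+ p * f k s) -> psd ((c * g ^+ p) *: M - K).
Proof.
move=> p2 fp v; rewrite bilinBl bilinZl Mquad Kquad subr_ge0 -bintZ //; last exact: bmeasM.
apply: le_bint => //; [exact: bmeasM | by apply: bmeasZ; exact: bmeasM |].
move=> r Or; set F := comb _.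
have FN s : F (- s) = (-1) ^+ p * F s.
  by rewrite /F /comb mulr_sumr; apply: eq_bigr => a _; rewrite fp; ring.
have le1 := scat_form_le g01 p2 (bcomb _) FN.
have ge1 := scat_form_ge0 g01 (bcomb (fun a => nodal h v a r)).
apply: (@le_trans _ _ (c * sigt r * scat_form g F F)).
  by rewrite ler_wpM2r // sigs_le.
have -> : c * g ^+ p * (sigt r * sqnorm F) = c * sigt r * (g ^+ p * sqnorm F) by ring.
by rewrite ler_wpM2l // mulr_ge0 // (le_trans (ltW gamma0)) // sigt_ge.
Qed.

Hypotheses (indf : sphere_independent f) (indh : space_independent Om h).

(** Independence is used twice: in space some nodal function is nonzero on a set [V] of positive
    measure, and at each point of [V] the angular combination is nonzero on an open part of the
    sphere. *)
Lemma pd_mass : pd M.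
Proof.
move=> v v0; rewrite Mquad.
have [k vk] : exists k, v k ord0 != 0.
  apply: contrapT => /forallNP H; move: v0; apply/negP; rewrite negbK; apply/eqP/colP => k.
  by rewrite mxE; have /negP := H k; rewrite negbK => /eqP.
have [r [V [mV nV VO hV]]] : exists (r : 'rV[R]_d.+1) (V : set 'rV[R]_d.+1), [/\ measurable V, nbhs r V, V `<=` Om &
    forall x, V x -> nodal h v (tensor_index k).1 x != 0].
  apply: (indh (y := fun i => v (mxvec_index (tensor_index k).1 i) ord0)).
  by exists (tensor_index k).2; rewrite tensor_indexK.
apply: (bint_gt0 (U := V)) => //.
- exact: bmeasM.
- by move=> x Ox; rewrite mulr_ge0 ?sqnorm_ge0 // (le_trans (ltW gamma0)) // sigt_ge.
- exact: lebesgue_rV_gt0 nV.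
move=> x Vx; apply: mulr_gt0; first by apply: lt_le_trans gamma0 _; apply/sigt_ge/VO.
have [s [U [Ss mU nU hU]]] : exists s U, [/\ S s, measurable U, nbhs s U &
    forall z, U z -> S z -> comb (fun a => nodal h v a x) z != 0].
  by apply: indf; exists (tensor_index k).1; exact: hV.
apply: (bint_gt0 (U := U `&` S)) => //.
- by apply: bmeasX.
- by move=> z _; exact: sqr_ge0.
- by apply: measurableI.
- exact: sphere_measure_gt0 nU.
- by move=> z [Uz Sz]; rewrite exprn_even_gt0 //= hU.
Qed.

End tensor_bounds.

(** * The coefficients: the albedo [c] and bounded representatives *)

Section coefficients.
Context {R : realType}.
Variables (d : nat) (Om : set 'rV[R]_d.+1).
Local Notation lam := (lebesgue_rV d.+1).
Implicit Types f : 'rV[R]_d.+1 -> R.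

Let lamT0 : (0 < lam [set: 'rV[R]_d.+1])%E.
Proof. exact: (@lebesgue_rV_gt0 R d.+1 0 setT measurableT filterT). Qed.

Let Linf_normE f : Linf_norm Om f = ess_sup lam (EFin \o (fun r => `|(f \_ Om) r|)).
Proof. by rewrite /Linf_norm unlock /= lamT0. Qed.

Lemma Linf_bounded f : Linf Om f -> exists M, {ae lam, forall r, Om r -> `|f r| <= M}.
Proof.
move=> [_]; rewrite Linf_normE => /ess_supr_bounded[M hM]; exists M.
by apply: filterS hM => r hr Or; move: hr; rewrite patchE mem_set.
Qed.

Lemma Linf_norm_le f M : 0 <= M -> {ae lam, forall r, Om r -> `|f r| <= M} ->
  (Linf_norm Om f <= M%:E)%E.
Proof.
move=> M0 hM; rewrite Linf_normE; apply/ess_supP; apply: filterS hM => r hr /=.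
rewrite lee_fin patchE; case: ifPn; first by rewrite inE => /hr.
by rewrite normr0.
Qed.

Lemma Linf_norm_ge f M : (Linf_norm Om f <= M%:E)%E ->
  {ae lam, forall r, Om r -> `|f r| <= fine (Linf_norm Om f)}.
Proof.
move=> fM; have fE : (fine (Linf_norm Om f))%:E = Linf_norm Om f.
  rewrite fineK // ge0_fin_numE; first exact: le_lt_trans fM (ltry _).
  exact: Lnorm_ge0.
have := ess_sup_ge lam (EFin \o (fun r => `|(f \_ Om) r|)).
rewrite -Linf_normE; apply: filterS => r hr Or.
by move: hr; rewrite -fE /= lee_fin patchE mem_set.
Qed.

Variables (sigma_a sigma_s : 'rV[R]_d.+1 -> R) (gamma : R).
Hypotheses (mOm : measurable Om) (gamma0 : 0 < gamma).
Hypotheses (Linf_a : Linf Om sigma_a) (Linf_s : Linf Om sigma_s).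
Hypothesis ge0_s : {ae lam, forall r, Om r -> 0 <= sigma_s r}.
Hypothesis ge_a : {ae lam, forall r, Om r -> gamma <= sigma_a r}.
Let sigma_t := sigma_a \+ sigma_s.
Let c := fine (Linf_norm Om (fun r => sigma_s r / sigma_t r)).

Lemma albedo_bounds : 0 <= c < 1 /\
  {ae lam, forall r, Om r -> sigma_s r <= c * sigma_t r}.
Proof.
have [Ma hMa] := Linf_bounded Linf_a.
have [Ms hMs] := Linf_bounded Linf_s.
(* An essential bound of [sigma_t], so that [sigma_s / sigma_t = 1 - sigma_a / sigma_t <= 1 - gamma
   / M]. The summand [gamma] gives [0 < gamma <= M], hence a bound in [[0, 1)]. *)
pose M := `|Ma| + `|Ms| + gamma.
have Mgamma : gamma <= M by rewrite lerDr addr_ge0.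
have M0 : 0 < M := lt_le_trans gamma0 Mgamma.
pose e := 1 - gamma / M.
have e0 : 0 <= e by rewrite subr_ge0 ler_pdivrMr // mul1r.
have e1 : e < 1 by rewrite ltrBlDr ltrDl divr_gt0.
have hle : {ae lam, forall r, Om r -> `|sigma_s r / sigma_t r| <= e}.
  apply: filterS3 hMa hMs (filterI ge0_s ge_a) => r ha hs [h0 hg] Or.
  have {}ha := ha Or; have {}hs := hs Or; have {}h0 := h0 Or; have {}hg := hg Or.
  have t0 : 0 < sigma_t r by rewrite ltr_wpDr // (lt_le_trans gamma0).
  rewrite ger0_norm ?divr_ge0 ?(ltW t0) // ler_pdivrMr //.
  have tM : sigma_t r <= M.
    rewrite /sigma_t /= /M; have := ler_norm Ma; have := ler_norm Ms.
    have := ler_norm (sigma_a r); have := ler_norm (sigma_s r); have := gamma0; lra.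
  have : gamma / M * sigma_t r <= gamma.
    by rewrite mulrAC ler_pdivrMr // ler_wpM2l // ltW.
  rewrite /e mulrBl mul1r {2}/sigma_t /=; lra.
have ce := Linf_norm_le e0 hle.
have c0 : 0 <= c by apply: fine_ge0; exact: Lnorm_ge0.
have ge := Linf_norm_ge ce.
split.
  rewrite c0 /=; apply: le_lt_trans e1; rewrite -lee_fin fineK //.
  rewrite ge0_fin_numE; first exact: le_lt_trans ce (ltry _).
  exact: Lnorm_ge0.
apply: filterS3 ge ge0_s ge_a => r hc h0 hg Or.
have t0 : 0 < sigma_t r by rewrite ltr_wpDr ?h0 // (lt_le_trans gamma0) ?hg.
by have := le_trans (ler_norm _) (hc Or); rewrite ler_pdivrMr.
Qed.

(** On the exceptional null set [sigma_t] is replaced by [gamma] and [sigma_s] by 0, values for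
    which all the inequalities hold. *)
Lemma bounded_representatives : exists st ss : 'rV[R]_d.+1 -> R,
  [/\ bmeas Om st, bmeas Om ss,
      forall r, Om r -> [/\ gamma <= st r, 0 <= ss r & ss r <= c * st r]
    & {ae lam, forall r, Om r -> st r = sigma_t r /\ ss r = sigma_s r}].
Proof.
have [Ma hMa] := Linf_bounded Linf_a.
have [Ms hMs] := Linf_bounded Linf_s.
have [/andP[c0 _] hc] := albedo_bounds.
have [N [mN N0 hN]] := filterI hc (filterI (filterI hMa hMs) (filterI ge0_s ge_a)).
have good r : Om r -> ~ N r -> [/\ sigma_s r <= c * sigma_t r, `|sigma_a r| <= Ma,
    `|sigma_s r| <= Ms, 0 <= sigma_s r & gamma <= sigma_a r].
  move=> Or Nr; apply: contrapT => H; apply: Nr; apply: hN => /= -[h1 [[h2 h3] [h4 h5]]].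
  by apply: H; split; [exact: h1|exact: h2|exact: h3|exact: h4|exact: h5].
have [ma _] := Linf_a; have [ms _] := Linf_s.
have mC : measurable_fun Om (\1_(~` N) : 'rV[R]_d.+1 -> R).
  by apply: measurable_indic; exact: measurableC.
have bC f M : measurable_fun Om f -> (forall r, Om r -> ~ N r -> `|f r| <= M) ->
    bmeas Om (fun r => f r * \1_(~` N) r).
  move=> mf hM; split; first exact: measurable_funM.
  exists `|M| => r Or; rewrite indicE; case: (boolP (r \in ~` N)).
    by rewrite inE mulr1 => /hM h; rewrite (le_trans (h _)) // ler_norm.
  by rewrite mulr0 normr0.
exists (fun r => sigma_t r * \1_(~` N) r + gamma * \1_N r), (fun r => sigma_s r * \1_(~` N) r).
have nN r : N r -> (\1_N r = 1 :> R) /\ (\1_(~` N) r = 0 :> R).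
  by move=> Nr; rewrite !indicE mem_set // memNset //; apply.
have nC r : ~ N r -> (\1_N r = 0 :> R) /\ (\1_(~` N) r = 1 :> R).
  by move=> Nr; rewrite !indicE memNset // mem_set.
split.
- apply: bmeasD; last by apply: bmeasZ; exact: bmeas_indic.
  apply: (bC _ (Ma + Ms)); first exact: measurable_funD.
  move=> r Or /(good _ Or)[_ ha hs _ _].
  by rewrite (le_trans (ler_normD _ _)) // lerD.
- by apply: (bC _ Ms) => // r Or /(good _ Or)[].
- move=> r Or; have [Nr|Nr] := pselect (N r).
    have [-> ->] := nN _ Nr; rewrite !mulr0 add0r mulr1; split => //.
    by rewrite mulr_ge0 // ltW.
  have [-> ->] := nC _ Nr; rewrite mulr0 !mulr1 addr0.
  have [h1 _ _ h0 hg] := good _ Or Nr; split => //.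
  by rewrite /sigma_t /=; lra.
- exists N; split => // r /= /not_implyP[Or H]; apply: contrapT => Nr; apply: H.
  by have [-> ->] := nC _ Nr; rewrite mulr0 !mulr1 addr0.
Qed.

End coefficients.

Section ae_coefficients.
Context {R : realType}.
Variables (d : nat) (Om : set 'rV[R]_d.+1).
Hypothesis mOm : measurable Om.
Local Notation S := (@sphere R).
Local Notation lam := (lebesgue_rV d.+1).
Variables sigma sigma' : 'rV[R]_d.+1 -> R.
Hypotheses (ms : measurable_fun Om sigma) (ms' : measurable_fun Om sigma').
Hypothesis ss' : {ae lam, forall r, Om r -> sigma r = sigma' r}.

(** A null set of positions, multiplied by all directions, is null in phase space. *)
Lemma phase_integral_ae (K : 'rV[R]_3 * 'rV[R]_d.+1 -> R) : measurable_fun (S `*` Om) K ->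
  phase_integral Om (fun x => sigma x.2 * K x) = phase_integral Om (fun x => sigma' x.2 * K x).
Proof.
move=> mK; have mD : measurable (S `*` Om) by apply: measurableX => //; exact: measurable_sphere.
have mc f : measurable_fun Om f ->
    measurable_fun (S `*` Om) (fun x : 'rV[R]_3 * 'rV[R]_d.+1 => f x.2 : R).
  move=> mf; apply: (measurable_comp (F := Om) mOm _ mf); first by move=> _ [x [_ ?] <-].
  exact: measurable_funTS measurable_snd.
rewrite /phase_integral /Rintegral; congr fine; apply: ae_eq_integral => //.
- by apply/measurable_EFinP; apply: measurable_funM => //; exact: mc.
- by apply/measurable_EFinP; apply: measurable_funM => //; exact: mc.
have [N [mN N0 hN]] := ss'; exists (setT `*` N); split; first exact: measurableX.
  by apply: (etrans (product_measure1E _ _ measurableT mN)); rewrite N0 mule0.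
move=> [s r] /= /not_implyP[[_ Or]] H; split => //; apply: hN => /= /(_ Or) e.
by apply: H; rewrite e.
Qed.

Variables (m n : nat) (f : 'I_m -> 'rV[R]_3 -> R) (h : 'I_n -> 'rV[R]_d.+1 -> R).
Hypotheses (bf : forall k, bmeas S (f k)) (bh : forall i, bmeas Om (h i)).
Let B := tensor_basis f h.
Let mS := @measurable_sphere R.

Lemma mass_matrix_ae : form_matrix (mass_form Om sigma) B B = form_matrix (mass_form Om sigma') B B.
Proof.
apply/matrixP => k l; rewrite !mxE /mass_form.
transitivity (phase_integral Om (fun x => sigma x.2 * (B l x * B k x))).
  by apply: eq_phase_integral => s r _ _; rewrite mulrA.
rewrite phase_integral_ae; last first.
  suff [] : bmeas (S `*` Om) (fun x => B l x * B k x) by [].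
  by apply: bmeasM; apply: bmeasM; (exact: bmeas_fst || exact: bmeas_snd).
by apply: eq_phase_integral => s r _ _; rewrite mulrA.
Qed.

Lemma scattering_matrix_ae g : 0 <= g < 1 ->
  form_matrix (scattering_form Om g sigma) B B = form_matrix (scattering_form Om g sigma') B B.
Proof.
move=> g01; apply/matrixP => k l; rewrite !mxE /scattering_form.
pose K x := scat g (f (tensor_index l).1) x.1 * h (tensor_index l).2 x.2 * B k x.
have E sig : phase_integral Om (fun x => sig x.2 * scattering g (B l) x * B k x) =
    phase_integral Om (fun x => sig x.2 * K x).
  apply: eq_phase_integral => s r Ss _.
  rewrite (scattering_tensor (h (tensor_index l).2) r g01 (bf (tensor_index l).1) Ss) /K /=.
  by rewrite -!mulrA.
rewrite !E; apply: phase_integral_ae.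
suff [] : bmeas (S `*` Om) K by [].
by apply: bmeasM; apply: bmeasM; (apply: bmeas_fst || apply: bmeas_snd) => //; exact: bmeas_scat.
Qed.

End ae_coefficients.

(** * The boundary matrix *)

Section boundary.
Context {R : realType}.
Variables (d : nat) (hd : (d.+1 <= 3)%N) (Om : set 'rV[R]_d.+1).
Variables (nv ne : nat) (p : 'I_nv -> 'rV[R]_d.+1) (T : 'I_ne -> {set 'I_nv}).
Local Notation S := (@sphere R).
Local Notation lam := (lebesgue_rV d).
Let mS := @measurable_sphere R.
Local Notation USd := (@unit_simplex R d).

Lemma measurable_unit_simplex : measurable USd.
Proof.
rewrite (_ : USd = (\bigcap_(i in [set: 'I_d]) [set t : 'rV[R]_d | 0 <= dot (delta_mx ord0 i) t + 0]) `&`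
    [set t | 0 <= dot (const_mx (-1)) t + 1]).
  apply: measurableI; last exact: measurable_dot_ge.
  by apply: fin_bigcap_measurable => [|i _]; [exact: finite_finset | exact: measurable_dot_ge].
have dotd i (t : 'rV[R]_d) : dot (delta_mx ord0 i) t = t ord0 i.
  rewrite /dot (bigD1 i) //= mxE !eqxx mul1r big1 ?addr0 // => j ji.
  by rewrite mxE (negbTE ji) andbF mul0r.
have dotN (t : 'rV[R]_d) : dot (const_mx (-1)) t = - \sum_i t ord0 i.
  by rewrite /dot -sumrN; apply: eq_bigr => i _; rewrite mxE mulN1r.
apply/seteqP; split => t /= [h1 h2]; split.
- by move=> i _ /=; rewrite dotd addr0.
- by rewrite dotN addrC subr_ge0.
- by move=> i; have /= := h1 i I; rewrite dotd addr0.
- by move: h2; rewrite dotN addrC subr_ge0.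
Qed.

Lemma unit_simplex_fin : (lam USd < +oo)%E.
Proof.
have /andP[_] := lebesgue_rV_box (0 : 'rV[R]_d) (ltr0n R 2).
apply: le_lt_trans; apply: le_measure; rewrite ?inE //.
- exact: measurable_unit_simplex.
- exact: measurable_box.
move=> t [t0 t1] i; rewrite mxE sub0r normrN ger0_norm //.
apply: (@le_lt_trans _ _ 1); last by rewrite ltr1n.
by apply: le_trans t1; rewrite (bigD1 i) //= lerDl sumr_ge0.
Qed.

Lemma measurable_facet_param F : measurable_fun setT (facet_param p F : 'rV[R]_d -> _).
Proof.
apply: measurable_fun_rV => i; rewrite /facet_param.
under eq_fun do rewrite mxE mxE.
apply: measurable_funD; first exact: measurable_cst.
apply: measurable_sum => j; apply: measurable_funM; last exact: measurable_cst.
exact: measurable_coord.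
Qed.

Lemma facet_param_simplex (F : {set 'I_nv}) (t : 'rV[R]_d) : #|F| = d.+1 -> USd t ->
  simplex p F (facet_param p F t).
Proof.
move=> cF [t0 t1].
have se : size (enum F) = d.+1 by rewrite -cardE.
have /card_gt0P[v0 _] : (0 < #|F|)%N by rewrite cF.
(* The barycentric weights in the order of [enum F]. A vertex outside [F] has index [d.+1], where
   [insub] fails and the weight is 0, so the weights are nonnegative everywhere. *)
pose wt i := if i is j.+1 then (if insub j is Some k then t ord0 k else 0 : R)
             else 1 - \sum_i t ord0 i.
have wtS (i : 'I_d) : wt (lift ord0 i) = t ord0 i.
  by rewrite lift0 /wt insubT //= => Hi; congr (t _ _); exact: val_inj.
have sumF (V : nmodType) (G : 'I_nv -> nat -> V) : \sum_(v in F) G v (index v (enum F)) =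
    \sum_(i < d.+1) G (nth v0 (enum F) i) i.
  rewrite -big_enum /= (big_nth v0) se big_mkord; apply: eq_bigr => i _.
  by rewrite index_uniq ?se ?enum_uniq.
have fv (i : 'I_d.+1) : facet_vertex p F i = p (nth v0 (enum F) i).
  by rewrite /facet_vertex (nth_map v0) ?se.
exists (fun v => wt (index v (enum F))); split.
- move=> v; case: (index v (enum F)) => [|i] /=; first by rewrite subr_ge0.
  by case: insub.
- rewrite (sumF _ (fun _ i => wt i)) big_ord_recl.
  by under eq_bigr do rewrite wtS; rewrite /wt /= subrK.
- rewrite (sumF _ (fun v i => wt i *: p v)) big_ord_recl -(fv ord0) /facet_param.
  rewrite scalerBl scale1r -addrA; congr (_ + _).
  under [X in _ = _ + X]eq_bigr => i _ do rewrite -(fv (lift ord0 i)) wtS.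
  rewrite mulmx_sum_row scaler_suml -sumrN -big_split /=; apply: eq_bigr => i _.
  by rewrite rowK scalerBr addrC.
Qed.

Variable nu : 'rV[R]_d.+1 -> 'rV[R]_d.+1.
Hypotheses (mnu : measurable_fun setT nu)
  (nu_normal : forall r, (closure Om `\` Om) r -> is_outer_normal Om r (nu r)).

Variables (m n : nat) (f : 'I_m -> 'rV[R]_3 -> R) (h : 'I_n -> 'rV[R]_d.+1 -> R).
Hypotheses (mcl : measurable (closure Om)).
Hypotheses (bf : forall k, bmeas S (f k)) (bh : forall i, bmeas (closure Om) (h i)).
Let B := tensor_basis f h.
Let Rb : 'M[R]_(m * n) := form_matrix (boundary_form hd Om p T nu) B B.

Lemma symm_boundary : symm Rb.
Proof.
apply/matrixP => k l; rewrite !mxE; apply: eq_bigr => F _; congr (_ * _).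
by apply: eq_Rintegral => x _; rewrite mulrAC.
Qed.

Let facet_closure F t : F \in boundary_facets Om p T -> USd t ->
  (closure Om `\` Om) (facet_param p F t).
Proof.
rewrite inE => /and3P[/eqP cF _ /asboolP sF] Ut; apply: sF.
exact: facet_param_simplex.
Qed.

Let bflux F : F \in boundary_facets Om p T ->
  bmeas (S `*` USd) (fun x : 'rV[R]_3 * 'rV[R]_d =>
    `|dot (direction hd x.1) (nu (facet_param p F x.2))| : R).
Proof.
move=> bF; apply: bmeas_abs; rewrite /dot.
apply: (@bmeas_sum _ _ _ _ _ _ xpredT) => i _; apply: bmeasM.
  apply: (bmeas_fst mS measurable_unit_simplex (f := fun s => direction hd s ord0 i)).
  by apply: (bmeas_eq _ (bmeas_coord (widen_ord hd i))) => s _; rewrite mxE.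
apply: (bmeas_snd mS measurable_unit_simplex (f := fun t => nu (facet_param p F t) ord0 i)).
split.
  apply: measurable_funTS; apply: (measurableT_comp (measurable_coord i)).
  by apply: measurableT_comp mnu _; exact: measurable_facet_param.
exists 1 => t Ut; have [e1 _] := nu_normal (facet_closure bF Ut).
have d1 : dot (nu (facet_param p F t)) (nu (facet_param p F t)) = 1.
  rewrite -[LHS]sqr_sqrtr; first by rewrite -/(enorm _) e1 expr1n.
  by apply: sumr_ge0 => j _; rewrite -expr2 sqr_ge0.
rewrite -[leRHS]d1 -(@ler_pXn2r _ 2) ?nnegrE // ?d1 // expr1n real_normK ?num_real //.
by rewrite -d1 /dot (bigD1 i) //= expr2 lerDl sumr_ge0 // => j _; rewrite -expr2 sqr_ge0.
Qed.

Let bB F k : F \in boundary_facets Om p T ->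
  bmeas (S `*` USd) (fun x : 'rV[R]_3 * 'rV[R]_d => B k (x.1, facet_param p F x.2)).
Proof.
move=> bF; apply: bmeasM.
  exact: (bmeas_fst mS measurable_unit_simplex (f := f _)).
apply: (bmeas_snd mS measurable_unit_simplex (f := fun t => h (tensor_index k).2 (facet_param p F t))).
apply: (bmeas_comp (E := closure Om) (f := h _)) => //.
- exact: measurable_unit_simplex.
- exact: measurable_facet_param.
- by move=> t Ut; have [] := facet_closure bF Ut.
Qed.

(** On each facet the quadratic form is the integral of [|s . n|] times the square of the discrete
    function, with the nonnegative surface element as factor. *)
Lemma psd_boundary : psd Rb.
Proof.
move=> v; rewrite bilinE.
pose I F k l := \int[(sphere_measure \x lam)%E]_(x in S `*` USd)
  (`|dot (direction hd x.1) (nu (facet_param p F x.2))| * B l (x.1, facet_param p F x.2)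
     * B k (x.1, facet_param p F x.2)).
have mSU : measurable (S `*` USd) by apply: measurableX => //; exact: measurable_unit_simplex.
have fSU : ((sphere_measure \x lam)%E (S `*` USd) < +oo)%E.
  apply: product_measure_fin => //; first exact: measurable_unit_simplex.
    exact: sphere_measure_fin.
  exact: unit_simplex_fin.
rewrite (_ : \sum_k _ = \sum_(F in boundary_facets Om p T)
    Num.sqrt (\det (facet_edges p F *m (facet_edges p F)^T)) *
    \sum_k \sum_l I F k l * (v k ord0 * v l ord0)); last first.
  under eq_bigr => k _ do under eq_bigr => l _ do
    rewrite mxE /boundary_form /boundary_integral -mulrA mulr_suml.
  under eq_bigr => k _ do rewrite exchange_big /=.
  rewrite exchange_big /=; apply: eq_bigr => F _; rewrite mulr_sumr; apply: eq_bigr => k _.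
  by rewrite mulr_sumr; apply: eq_bigr => l _; rewrite [RHS]mulrA.
apply: sumr_ge0 => F bF; rewrite mulr_ge0 ?sqrtr_ge0 //.
pose bx x k := B k (x.1, facet_param p F x.2).
pose a x := `|dot (direction hd x.1) (nu (facet_param p F x.2))|.
have b2 k l : bmeas (S `*` USd) (fun x => (v k ord0 * v l ord0) * (a x * bx x l * bx x k)).
  by apply: bmeasZ; apply: bmeasM; [apply: bmeasM|]; (exact: bB || exact: bflux).
have b1 k := @bmeas_sum _ _ _ (S `*` USd) _ (index_enum 'I_(m * n)) xpredT _ (fun l _ => b2 k l).
rewrite (_ : \sum_k _ = \int[(sphere_measure \x lam)%E]_(x in S `*` USd)
    \sum_k \sum_l (v k ord0 * v l ord0) * (a x * bx x l * bx x k)); last first.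
  rewrite bint_sum //; apply: eq_bigr => k _; rewrite bint_sum //; apply: eq_bigr => l _.
  rewrite bintZ //; first by rewrite mulrC.
  by apply: bmeasM; [apply: bmeasM|]; (exact: bB || exact: bflux).
apply: Rintegral_ge0 => x _.
rewrite (_ : \sum_k _ = a x * (\sum_k v k ord0 * bx x k) ^+ 2).
  by rewrite mulr_ge0 ?sqr_ge0 // normr_ge0.
rewrite expr2 big_distrlr /= mulr_sumr; apply: eq_bigr => k _.
by rewrite mulr_sumr; apply: eq_bigr => l _; ring.
Qed.

End boundary.

Theorem lemma5p5 (R : realType)
  (* the spatial domain Om, of dimension d.+1 *)
  (d : nat) (hd : (d.+1 <= 3)%N) (Om : set 'rV[R]_d.+1)
  (Om_open : open Om) (Om_nonempty : Om !=set0)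
  (Om_bounded : bounded_set Om) (Om_convex : convex_set Om)
  (nu : 'rV[R]_d.+1 -> 'rV[R]_d.+1) (nu_measurable : measurable_fun setT nu)
  (nu_normal : forall r, (closure Om `\` Om) r -> is_outer_normal Om r (nu r))
  (* the coefficients *)
  (g : R) (g_ge0 : 0 <= g) (g_lt1 : g < 1)
  (sigma_a sigma_s : 'rV[R]_d.+1 -> R)
  (sigma_a_Linf : Linf Om sigma_a) (sigma_s_Linf : Linf Om sigma_s)
  (sigma_s_ge0 : {ae lebesgue_rV d.+1, forall r, Om r -> 0 <= sigma_s r})
  (gamma : R) (gamma_gt0 : 0 < gamma)
  (sigma_a_ge : {ae lebesgue_rV d.+1, forall r, Om r -> gamma <= sigma_a r})
  (* the mesh of Om *)
  (kappa : R) (nvR neR : nat) (p : 'I_nvR -> 'rV[R]_d.+1)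
  (TR : 'I_neR -> {set 'I_nvR})
  (TR_mesh : triangulation p TR Om)
  (TR_shape_regular : shape_regular kappa setT (fun j => simplex p (TR j)))
  (TR_quasi_uniform : quasi_uniform kappa (fun j => simplex p (TR j)))
  (* the mesh of the sphere *)
  (nvS neS : nat) (v : 'I_nvS -> 'rV[R]_3) (TS : 'I_neS -> {set 'I_nvS})
  (TS_mesh : spherical_triangulation v TS)
  (TS_shape_regular :
     shape_regular kappa sphere (fun j => spherical_triangle v (TS j)))
  (TS_quasi_uniform : quasi_uniform kappa (fun j => spherical_triangle v (TS j)))
  (TS_symmetric : antipodally_symmetric v TS)
  (* the bases phi_i, mu_k and psi_m *)
  (nRp : nat) (phi : 'I_nRp -> 'rV[R]_d.+1 -> R)
  (phi_basis : is_basis_on (closure Om) (continuous_P1 p TR Om) phi)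
  (nSp : nat) (rep : 'I_nSp -> 'I_neS)
  (rep_pairs : antipodal_representatives v TS rep)
  (nSm : nat) (psi : 'I_nSm -> 'rV[R]_3 -> R)
  (psi_basis : is_basis_on setT (odd_P1 v TS) psi)
  (* the coarse space, the right-hand side and the number of inner iterations *)
  (N : nat) (W : 'M[R]_(nSp * nRp, N)) (W_indep : row_free W^T)
  (q : 'cV[R]_(nSp * nRp)) (l : nat) (hl : (1 <= l)%N) :
  let sigma_t := sigma_a \+ sigma_s in
  let c := fine (Linf_norm Om (fun r => sigma_s r / sigma_t r)) in
  let even := tensor_basis (pair_indicator v TS rep) phi in
  let odd := tensor_basis psi (element_indicator p TR) in
  let Mp := form_matrix (mass_form Om sigma_t) even even in
  let Mm := form_matrix (mass_form Om sigma_t) odd odd in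
  let Kp := form_matrix (scattering_form Om g sigma_s) even even in
  let Km := form_matrix (scattering_form Om g sigma_s) odd odd in
  let Rb := form_matrix (boundary_form hd Om p TR nu) even even in
  let A := form_matrix (transport_form hd Om) even odd in
  let E := A^T *m invmx (Mm - Km) *m A + Mp + Rb in
  let E0 := (1 - c * g)^-1 *: (A^T *m invmx Mm *m A) + Mp + Rb in
  let B := E - Kp in
  let P1 := precond1 E0 E l in
  let eta := contraction_factor B W P1 in
  (exists u : 'cV[R]_(nSp * nRp),
    [/\ E *m u = Kp *m u + q,
        forall u', E *m u' = Kp *m u' + q -> u' = u
      & forall u0, let un := outer_iteration B (precond2_1 B W P1) q u0 in
          (un @ \oo --> u) /\
          forall n, energy_norm B (u - un n.+1) <=
                    eta * energy_norm B (u - un n)])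
  /\ eta <= c /\ c < 1.
Proof.
move=> sigma_t c even odd Mp Mm Kp Km Rb A E E0 B P1 eta.
have mOm := measurable_Om Om_open.
have finOm := Om_fin Om_open Om_bounded.
have mcl : measurable (closure Om) by move: (measurable_closure_Om TR_mesh).
have g01 : 0 <= g < 1 by rewrite g_ge0.
have c01 : 0 <= c < 1.
  by have [] := albedo_bounds gamma_gt0 sigma_a_Linf sigma_s_Linf sigma_s_ge0 sigma_a_ge.
have c0 : 0 <= c by case/andP: c01.
have [st [ss [bt bs hts aets]]] := bounded_representatives gamma_gt0
  sigma_a_Linf sigma_s_Linf sigma_s_ge0 sigma_a_ge.
have mt : measurable_fun Om sigma_t.
  by apply: measurable_funD; [case: sigma_a_Linf | case: sigma_s_Linf].
have ms : measurable_fun Om sigma_s by case: sigma_s_Linf.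
have aet : {ae lebesgue_rV d.+1, forall r, Om r -> sigma_t r = st r}.
  by apply: filterS aets => r h /h[].
have aes : {ae lebesgue_rV d.+1, forall r, Om r -> sigma_s r = ss r}.
  by apply: filterS aets => r h /h[].
have t_ge r : Om r -> gamma <= st r by case/hts.
have s_ge r : Om r -> 0 <= ss r by case/hts.
have s_le r : Om r -> ss r <= c * st r by case/hts.
have bpair := bmeas_pair_indicator TS_mesh TS_symmetric.
have bphi := bmeas_phi TR_mesh phi_basis.
have bpsi := bmeas_odd_basis TS_mesh psi_basis.
have bchi := bmeas_element_indicator TR_mesh Om.
have pairN k s : pair_indicator v TS rep k (- s) = (-1) ^+ 0 * pair_indicator v TS rep k s.
  by rewrite expr0 mul1r pair_indicatorN.
have psiN k s : psi k (- s) = (-1) ^+ 1 * psi k s.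
  by rewrite expr1 mulN1r; exact: (odd_basisN psi_basis).
have ipair := sphere_independent_pair TS_mesh TS_symmetric rep_pairs.
have iphi := space_independent_P1 Om_open TR_mesh phi_basis.
have ipsi := sphere_independent_odd TS_mesh psi_basis.
have ichi := space_independent_indicator Om_open TR_mesh.
have mst : measurable_fun Om st by case: bt.
have mss : measurable_fun Om ss by case: bs.
(* From here on the everywhere bounded representatives stand in for the coefficients; the matrices
   are the same. *)
have eMp : Mp = form_matrix (mass_form Om st) even even.
  exact: (mass_matrix_ae mOm mt mst aet (bpair _ rep) bphi).
have eMm : Mm = form_matrix (mass_form Om st) odd odd.
  exact: (mass_matrix_ae mOm mt mst aet bpsi bchi).
have eKp : Kp = form_matrix (scattering_form Om g ss) even even.
  exact: (scattering_matrix_ae mOm ms mss aes (bpair _ rep) bphi g01).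
have eKm : Km = form_matrix (scattering_form Om g ss) odd odd.
  exact: (scattering_matrix_ae mOm ms mss aes bpsi bchi g01).
have sMp : symm Mp by rewrite eMp; exact: symm_mass.
have sMm : symm Mm by rewrite eMm; exact: symm_mass.
have sKp : symm Kp by rewrite eKp; exact: symm_scattering.
have sKm : symm Km by rewrite eKm; exact: symm_scattering.
have pKp : psd Kp by rewrite eKp; exact: psd_scattering.
have pKm : psd Km by rewrite eKm; exact: psd_scattering.
have pMp : pd Mp by rewrite eMp; exact: (pd_mass _ _ _ _ bt gamma_gt0).
have pMm : pd Mm by rewrite eMm; exact: (pd_mass _ _ _ _ bt gamma_gt0).
have pMKp : psd (c *: Mp - Kp).
  (* The even basis is the case [p = 0] of the parity bound, the odd basis below the case
     [p = 1]. *)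
  rewrite -[c]mulr1 -(expr0 g) eMp eKp.
  exact: (psd_mass_sub_scattering mOm finOm (bpair _ rep) bphi g01 bt bs gamma_gt0).
have pMKm : psd ((c * g) *: Mm - Km).
  rewrite -(expr1 g) eMm eKm.
  exact: (psd_mass_sub_scattering mOm finOm bpsi bchi g01 bt bs gamma_gt0).
have sRb : symm Rb by exact: symm_boundary.
have pRb : psd Rb.
  exact: (psd_boundary _ _ _ nu_measurable nu_normal mcl (bpair _ rep) (bmeas_phi_closure TR_mesh phi_basis)).
exact: (preconditioned_iteration A q c01 g01 sMp sRb sKp sMm sKm pMp pRb pKp
  pMKp pMm pKm pMKm W_indep hl).
Qed.
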